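(* Let $\mathbb K$ be a field, $0\ne t\in\mathbb K$, and $\kappa\in\mathbb Z^\ell$ with $\kappa_l-\kappa_{l+1}\ge n$ for $1\le l<\ell$, and suppose $(\mathbb K,t)$ separates $\mathrm{Std}(\mathcal P_n)$. Let $\alpha=\{\alpha_r(\mathfrak s)\}$ be a seminormal coefficient system for $\mathscr H_n(\mathbb K)$. Then $\mathscr H_n(\mathbb K)$ has a basis $\{f_{\mathfrak s\mathfrak t}\mid(\mathfrak s,\mathfrak t)\in\mathrm{Std}^2(\mathcal P_n)\}$ with $f_{\mathfrak s\mathfrak t}\in H_{\mathfrak s\mathfrak t}$ such that for all $(\mathfrak s,\mathfrak t)$, $1\le k\le n$, $1\le r<n$: $$f_{\mathfrak s\mathfrak t}^*=f_{\mathfrak t\mathfrak s},\quad f_{\mathfrak s\mathfrak t}L_k=[c_k(\mathfrak t)]f_{\mathfrak s\mathfrak t},\quad f_{\mathfrak s\mathfrak t}T_r=\alpha_r(\mathfrak t)f_{\mathfrak s\mathfrak v}-\frac1{[\rho_r(\mathfrak t)]}f_{\mathfrak s\mathfrak t},$$ where $\mathfrak v=\mathfrak t(r,r+1)$ and $f_{\mathfrak s\mathfrak v}=0$ if $\mathfrak v$ is not standard. Moreover, there exist non-zero $\gamma_{\mathfrak t}\in\mathbb K$, $\mathfrak t\in\mathrm{Std}(\mathcal P_n)$, such that $F_{\mathfrak u}f_{\mathfrak s\mathfrak t}F_{\mathfrak v}=\delta_{\mathfrak u\mathfrak s}\delta_{\mathfrak t\mathfrak v}f_{\mathfrak s\mathfrak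 t}$, $f_{\mathfrak s\mathfrak t}f_{\mathfrak u\mathfrak v}=\delta_{\mathfrak t\mathfrak u}\gamma_{\mathfrak t}f_{\mathfrak s\mathfrak v}$ and $F_{\mathfrak t}=\gamma_{\mathfrak t}^{-1}f_{\mathfrak t\mathfrak t}$. Furthermore $\{F_{\mathfrak t}\mid\mathfrak t\in\mathrm{Std}(\mathcal P_n)\}$ is a complete set of pairwise orthogonal primitive idempotents; every irreducible $\mathscr H_n(\mathbb K)$-module is isomorphic to $F_{\mathfrak s}\mathscr H_n(\mathbb K)$ for some $\mathfrak s$, and $F_{\mathfrak s}\mathscr H_n(\mathbb K)\cong F_{\mathfrak u}\mathscr H_n(\mathbb K)$ iff $\mathfrak s,\mathfrak u$ have the same shape. Finally, the basis $\{f_{\mathfrak s\mathfrak t}\}$ is uniquely determined by $\alpha$ and the scalars $\{\gamma_{\mathfrak t^\lambda}\mid\lambda\in\mathcal P_n\}\subseteq\mathbb K^\times$.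
   Context: Quantum integers $[d]=[d]_t$: $1+t+\dots+t^{d-1}$ ($d\ge0$), $-(t^{-1}+\dots+t^d)$ ($d<0$). $\mathscr H_n(\mathbb K)=\mathscr H_n(\mathbb K,t,\kappa)$ is the unital $\mathbb K$-algebra with generators $L_1,\dots,L_n,T_1,\dots,T_{n-1}$ and relations $\prod_{l=1}^\ell(L_1-[\kappa_l])=0$, $(T_r+1)(T_r-t)=0$, $L_rL_s=L_sL_r$, $T_rT_s=T_sT_r$ ($|r-s|>1$), $T_sT_{s+1}T_s=T_{s+1}T_sT_{s+1}$, $T_rL_s=L_sT_r$ ($s\ne r,r+1$), $L_{r+1}(T_r-t+1)=T_rL_r+1$. $*$ is the unique anti-involution fixing all $T_r$ and $L_k$. $(\mathbb K,t)$ separates $\mathrm{Std}(\mathcal P_n)$ if $[n]^!\prod_{1\le l<m\le\ell}\prod_{-n<d<n}[\kappa_l-\kappa_m+d]\neq0$. $\mathcal P_n$ is the set of $\ell$-multipartitions of $n$; nodes $(l,r,c)$; standard tableaux as usual, $\mathrm{Std}(\lambda)$, $\mathrm{Std}(\mathcal P_n)=\bigcup_\lambda\mathrm{Std}(\lambda)$, $\mathrm{Std}^2(\mathcal P_n)$ the pairs of standard tableaux of the same shape. The content of node $(l,r,c)$ is $\kappa_l-r+c$; $c_k(\mathfrak t)$ is the content of the node containing $k$; $\rho_r(\mathfrak t)=c_r(\mathfrak t)-c_{r+1}(\mathfrak t)$; $\mathfrak t(r,r+1)$ is $\mathfrak t$ with $r,r+1$ swapped; $\mathfrak t^\lambda$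 has $1,\dots,n$ entered along rows of components in order. $H_{\mathfrak s\mathfrak t}=\{h\mid L_rh=[c_r(\mathfrak s)]h,\ hL_r=[c_r(\mathfrak t)]h\ \forall r\}$. With $\mathrm{Cont}=\{c_r(\mathfrak t)\mid 1\le r\le n,\mathfrak t\in\mathrm{Std}(\mathcal P_n)\}$, $F_{\mathfrak t}=\prod_{k=1}^n\prod_{c\in\mathrm{Cont},[c_k(\mathfrak t)]\ne[c]}\frac{L_k-[c]}{[c_k(\mathfrak t)]-[c]}$. A seminormal coefficient system is a set of scalars $\alpha_r(\mathfrak s)\in\mathbb K$ ($1\le r<n$, $\mathfrak s\in\mathrm{Std}(\mathcal P_n)$; values at non-standard tableaux are taken to be $0$) such that for all standard $\mathfrak t$: (a) $\alpha_r(\mathfrak t)\alpha_{r+1}(\mathfrak ts_r)\alpha_r(\mathfrak ts_rs_{r+1})=\alpha_{r+1}(\mathfrak t)\alpha_r(\mathfrak ts_{r+1})\alpha_{r+1}(\mathfrak ts_{r+1}s_r)$ for $r<n-1$; (b) $\alpha_r(\mathfrak t)\alpha_k(\mathfrak ts_r)=\alpha_k(\mathfrak t)\alpha_r(\mathfrak ts_k)$ if $|r-k|>1$; (c) with $\mathfrak v=\mathfrak t(r,r+1)$: $\alpha_r(\mathfrak t)=0$ if $\mathfrak v$ is not standard, and otherwise $\alpha_r(\mathfrak t)\alpha_r(\mathfrak v)=\frac{[1+\rho_r(\mathfrak t)][1+\rho_r(\mathfrak v)]}{[\rho_r(\mathfrak t)][\rho_r(\mathfrak v)]}$. Here $\mathfrak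 ts_r=\mathfrak t(r,r+1)$. *)

(* Defs.v *)
From HB Require Import structures.
From mathcomp Require Import all_boot all_order all_algebra.
Set Implicit Arguments. Unset Strict Implicit. Unset Printing Implicit Defensive.
Import Order.TTheory GRing.Theory Num.Theory.
Local Open Scope ring_scope.

Definition qint (K : fieldType) (q : K) (d : int) : K :=
  match d with
  | Posz m => \sum_(i < m) q ^+ i
  | Negz m => - \sum_(i < m.+1) q ^- i.+1
  end.

(* A node (comp, row, col) is stored 0-indexed; a partition of n has    *)
(* fewer than n rows and columns so 'I_n suffices.  A tableau is the    *)
(* map  (entry k) |-> node ; entry k (1 <= k <= n) is stored at index   *)
(* k-1 : 'I_n.                                                          *)
Definition node (l n : nat) := ('I_l * 'I_n * 'I_n)%type.
Definition tab (l n : nat) := {ffun 'I_n -> node l n}.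

Section Tableaux.
Variables (l n : nat).

Definition ncomp (x : node l n) : nat := x.1.1.
Definition nrow (x : node l n) : nat := x.1.2.
Definition ncol (x : node l n) : nat := x.2.

(* t is standard iff it is injective and every node's upper and left     *)
(* neighbours (when they exist) carry smaller entries.  Equivalently the *)
(* image of t is the diagram of an l-multipartition of n and the entries *)
(* increase along rows and down columns of each component.              *)
Definition std (t : tab l n) : bool :=
  injectiveb t &&
  [forall k : 'I_n,
     ((nrow (t k) == 0%N) ||
      [exists j : 'I_n, [&& (j < k)%N, ncomp (t j) == ncomp (t k),
                           nrow (t j) == (nrow (t k)).-1 & ncol (t j) == ncol (t k)]])
  && ((ncol (t k) == 0%N) ||
      [exists j : 'I_n, [&& (j < k)%N, ncomp (t j) == ncomp (t k),
                           nrow (t j) == nrow (t k) & ncol (t j) == (ncol (t k)).-1]])].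

Definition tshape (t : tab l n) : {set node l n} := [set x | x \in codom t].

Definition Std2 : {set tab l n * tab l n} :=
  [set p | [&& std p.1, std p.2 & tshape p.1 == tshape p.2]].

Definition node_lt (x y : node l n) : bool :=
  (ncomp x < ncomp y)%N ||
  ((ncomp x == ncomp y) && ((nrow x < nrow y)%N ||
                            ((nrow x == nrow y) && (ncol x < ncol y)%N))).

(* t = t^lambda (lambda = tshape t): entries 1..n entered along the rows  *)
(* of the components in order.                                          *)
Definition initial (t : tab l n) : bool :=
  std t && [forall i : 'I_n, forall j : 'I_n, (i < j)%N ==> node_lt (t i) (t j)].

(* the transposition of the entries r and r+1 (1-indexed), acting on    *)
(* the 0-indexed positions r-1 and r                                     *)
Definition swp (r : nat) (i : 'I_n) : 'I_n :=
  if val i == r.-1 then insubd i r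
  else if val i == r then insubd i r.-1 else i.

Definition tswap (t : tab l n) (r : nat) : tab l n := [ffun i => t (swp r i)].

Variable kappa : 'I_l -> int.

Definition content (x : node l n) : int :=
  kappa x.1.1 - (nrow x)%:Z + (ncol x)%:Z.

Definition ct (t : tab l n) (k : nat) : int :=
  if (insub k.-1 : option 'I_n) is Some i then content (t i) else 0.

Definition rho (t : tab l n) (r : nat) : int := ct t r - ct t r.+1.

Definition Cont : seq int :=
  undup [seq ct t k | t <- enum [pred t | std t], k <- iota 1 n].

End Tableaux.

Section Params.
Variables (K : fieldType) (q : K) (l n : nat) (kappa : 'I_l -> int).

Definition kappa_gap : Prop :=
  forall i j : 'I_l, val j = (val i).+1 -> (n%:Z <= kappa i - kappa j).

Definition separates : Prop :=
  (\prod_(1 <= k < n.+1) qint q k%:Z) *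
  (\prod_(i < l) \prod_(j < l | (i < j)%N)
     \prod_(e < (n.*2).-1) qint q (kappa i - kappa j + e%:Z - (n.-1)%:Z)) != 0.

Definition alphaz (alpha : nat -> tab l n -> K) (r : nat) (t : tab l n) : K :=
  if std t then alpha r t else 0.

Definition seminormal_coeff (alpha : nat -> tab l n -> K) : Prop :=
  forall t : tab l n, std t ->
  [/\
      forall r, (0 < r)%N -> (r.+1 < n)%N ->
        alphaz alpha r t * alphaz alpha r.+1 (tswap t r)
          * alphaz alpha r (tswap (tswap t r) r.+1)
        = alphaz alpha r.+1 t * alphaz alpha r (tswap t r.+1)
          * alphaz alpha r.+1 (tswap (tswap t r.+1) r),
      forall r k, (0 < r < n)%N -> (0 < k < n)%N -> (r.+1 < k)%N || (k.+1 < r)%N ->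
        alphaz alpha r t * alphaz alpha k (tswap t r)
        = alphaz alpha k t * alphaz alpha r (tswap t k)
    &
      forall r, (0 < r < n)%N ->
        let v := tswap t r in
        if std v then
          alphaz alpha r t * alphaz alpha r v
          = qint q (1 + rho kappa t r) * qint q (1 + rho kappa v r)
            / (qint q (rho kappa t r) * qint q (rho kappa v r))
        else alphaz alpha r t = 0].

End Params.

(* Generators are indexed as in the paper: L_k (1 <= k <= n),           *)
(* T_r (1 <= r < n); values outside these ranges are irrelevant.        *)
Section Hecke.
Variables (K : fieldType) (q : K) (l n : nat) (kappa : 'I_l -> int).

Definition hecke_rel (B : algType K) (L T : nat -> B) : Prop :=
  ((0 < n)%N -> \prod_(i < l) (L 1%N - (qint q (kappa i))%:A) = 0) /\
  (forall r, (0 < r < n)%N -> (T r + 1) * (T r - q%:A) = 0) /\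
  (forall r s, (0 < r <= n)%N -> (0 < s <= n)%N -> L r * L s = L s * L r) /\
  (forall r s, (0 < r < n)%N -> (0 < s < n)%N -> (r.+1 < s)%N || (s.+1 < r)%N ->
     T r * T s = T s * T r) /\
  (forall s, (0 < s)%N -> (s.+1 < n)%N ->
     T s * T s.+1 * T s = T s.+1 * T s * T s.+1) /\
  (forall r s, (0 < r < n)%N -> (0 < s <= n)%N -> s != r -> s != r.+1 ->
     T r * L s = L s * T r) /\
  (forall r, (0 < r < n)%N -> L r.+1 * (T r - q%:A + 1) = T r * L r + 1).

(* (A, L, T) is the algebra presented by these generators and relations: *)
(* it satisfies the relations and is initial among such K-algebras.      *)
Definition hecke_universal (A : algType K) (L T : nat -> A) : Prop :=
  forall (B : algType K) (LB TB : nat -> B), hecke_rel LB TB ->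
  exists phi : {lrmorphism A -> B},
    ((forall k, (0 < k <= n)%N -> phi (L k) = LB k) /\
     (forall r, (0 < r < n)%N -> phi (T r) = TB r)) /\
    (forall psi : {lrmorphism A -> B},
       (forall k, (0 < k <= n)%N -> psi (L k) = LB k) ->
       (forall r, (0 < r < n)%N -> psi (T r) = TB r) ->
       forall x, psi x = phi x).

Definition is_hecke (A : algType K) (L T : nat -> A) : Prop :=
  hecke_rel L T /\ hecke_universal L T.

Variables (A : algType K) (L T : nat -> A).

Definition is_star (star : A -> A) : Prop :=
  (forall (a : K) x y, star (a *: x + y) = a *: star x + star y) /\
  (forall x y, star (x * y) = star y * star x) /\
  (forall x, star (star x) = x) /\
  (forall k, (0 < k <= n)%N -> star (L k) = L k) /\
  (forall r, (0 < r < n)%N -> star (T r) = T r).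

Definition inH (s t : tab l n) (h : A) : Prop :=
  forall r, (0 < r <= n)%N ->
    L r * h = (qint q (ct kappa s r)) *: h /\ h * L r = (qint q (ct kappa t r)) *: h.

Definition Fid (t : tab l n) : A :=
  \prod_(1 <= k < n.+1)
    \prod_(c <- Cont n kappa | qint q (ct kappa t k) != qint q c)
      ((L k - (qint q c)%:A) * ((qint q (ct kappa t k) - qint q c)^-1)%:A).

Definition is_basis (I : finType) (S : {set I}) (f : I -> A) : Prop :=
  (forall c : I -> K, \sum_(p in S) c p *: f p = 0 -> forall p, p \in S -> c p = 0) /\
  (forall a : A, exists c : I -> K, a = \sum_(p in S) c p *: f p).

Definition seminormal_basis (star : A -> A) (alpha : nat -> tab l n -> K)
    (f : tab l n -> tab l n -> A) (gamma : tab l n -> K) : Prop :=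
  is_basis (Std2 l n) (fun p => f p.1 p.2) /\
  (forall s t, (s, t) \in Std2 l n ->
     [/\ inH s t (f s t),
         star (f s t) = f t s,
         forall k, (0 < k <= n)%N -> f s t * L k = qint q (ct kappa t k) *: f s t
       & forall r, (0 < r < n)%N ->
           f s t * T r = (if std (tswap t r) then alpha r t *: f s (tswap t r) else 0)
                         - (qint q (rho kappa t r))^-1 *: f s t]) /\
  (forall t, std t -> gamma t != 0) /\
  (forall s t u v, (s, t) \in Std2 l n -> std u -> std v ->
     Fid u * f s t * Fid v = if (u == s) && (t == v) then f s t else 0) /\
  (forall s t u v, (s, t) \in Std2 l n -> (u, v) \in Std2 l n ->
     f s t * f u v = if t == u then gamma t *: f s v else 0) /\
  (forall t, std t -> Fid t = (gamma t)^-1 *: f t t).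

End Hecke.

Section Idem.
Variable R : nzRingType.

Definition idem (e : R) : Prop := e * e = e.

Definition primitive_idem (e : R) : Prop :=
  idem e /\ e != 0 /\
  (forall e1 e2, idem e1 -> idem e2 -> e1 * e2 = 0 -> e2 * e1 = 0 ->
     e = e1 + e2 -> e1 = 0 \/ e2 = 0).

Definition complete_orth_prim (I : finType) (S : {set I}) (F : I -> R) : Prop :=
  \sum_(i in S) F i = 1 /\
  (forall i j, i \in S -> j \in S -> i != j -> F i * F j = 0) /\
  (forall i, i \in S -> primitive_idem (F i)).

(* Right R-modules are left modules over the converse ring R^c;          *)
(* (a : R^c) *: m  is  m . a.                                           *)
Definition irreducible_rmod (M : lmodType R^c) : Prop :=
  (exists m : M, m != 0) /\
  (forall S : M -> Prop,
     S 0 -> (forall x y, S x -> S y -> S (x + y)) ->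
     (forall x (a : R^c), S x -> S (a *: x)) ->
     (forall x, S x -> x = 0) \/ (forall x, S x)).

Definition rmod_iso_ideal (M : lmodType R^c) (e : R) : Prop :=
  exists phi : M -> R,
    (forall x y, phi (x + y) = phi x + phi y) /\
    (forall x (a : R^c), phi (a *: x) = phi x * (a : R)) /\
    injective phi /\
    (forall y : R, (exists h, y = e * h) <-> (exists x, y = phi x)).

Definition ideal_iso (e e' : R) : Prop :=
  exists phi : R -> R,
    (forall x y, phi (e * x + e * y) = phi (e * x) + phi (e * y)) /\
    (forall x a, phi (e * x * a) = phi (e * x) * a) /\
    (forall x y, phi (e * x) = phi (e * y) -> e * x = e * y) /\
    (forall y : R, (exists h, y = e' * h) <-> (exists x, y = phi (e * x))).

End Idem.

(* Main.v *)
Require Import Defs.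
From HB Require Import structures.
From mathcomp Require Import all_boot all_order all_algebra.
From mathcomp Require Import zify ring.
From Stdlib Require Import ClassicalEpsilon.
Import Order.TTheory GRing.Theory Num.Theory.
Local Open Scope ring_scope.
Set Implicit Arguments. Unset Strict Implicit. Unset Printing Implicit Defensive.

(* The generators L_k act on the right regular module, and everything follows from an analysis of their eigenvectors in the style of Okounkov and Vershik. By induction on k, the simultaneous eigenvalues of L_1, ..., L_k are the contents of the standard tableaux with k entries, and L_(k+1) acts semisimply on the eigenspace of such a tableau, its eigenvalues being the contents of the addable nodes: an intertwiner of L_k and L_(k+1), whose square is a polynomial in them, gives a polynomial that kills L_(k+1), and the superfluous roots are removed because contents c, c cannot be consecutive on an eigenvector and c, c+1, c (or c, c-1, c) would contradict the braid relation. Hence the F_t are orthogonal idempotents with sum 1.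

The vectors x T_r + x / [rho_r(t)] move an eigenvector x from t to t(r,r+1). Transporting F_(t^lambda) along descents, with the normalisation prescribed by alpha, gives vectors g_t; the conditions on alpha are exactly what makes this independent of the path (diamond lemma), so the span of the g_t is a right ideal and f_st = star(g_s) g_t. That no F_t vanishes is seen in the seminormal representation, where the same hexagon computation proves the braid relation. *)

(** * Linear combinations and quantum integers *)

(** [A] is known only through its universal property: no spanning set, no finite dimension and no
    faithful module is given. The spectrum must be read off from the relations alone, so the
    spectral statements concern arbitrary vectors of any algebra satisfying [hecke_rel], and
    decompositions take the form of induction principles for additive predicates. The universal
    property enters twice: to map [A] to the matrices of the seminormal representation, and to pass
    from stability under the generators to stability under [A].

    Only L_1 comes with a polynomial; that of L_(k+1) has to be deduced from that of L_k. Adding a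
    node of content c to a diagram deletes c from the contents of the addable nodes and creates at
    most c + 1 and c - 1. *)

(* Formal linear combinations over a list of atoms: two of them agree as soon as all coefficients do, which reduces identities between vectors to [ring] or [field] goals. *)
Inductive lexp (K : Type) :=
  | LAtom of nat | LZero | LAdd of lexp K & lexp K | LOpp of lexp K
  | LScale of K & lexp K.
Arguments LAtom {K}.
Arguments LZero {K}.

Fixpoint leval (K : pzRingType) (W : lmodType K) (vs : seq W) (e : lexp K) : W :=
  match e with
  | LAtom i => vs`_i
  | LZero => 0
  | LAdd a b => leval vs a + leval vs b
  | LOpp a => - leval vs a
  | LScale c a => c *: leval vs a
  end.

Fixpoint lcoef (K : pzRingType) (i : nat) (e : lexp K) : K :=
  match e with
  | LAtom j => if Nat.eqb i j then 1 else 0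
  | LZero => 0
  | LAdd a b => lcoef i a + lcoef i b
  | LOpp a => - lcoef i a
  | LScale c a => c * lcoef i a
  end.

Lemma levalE (K : pzRingType) (W : lmodType K) (vs : seq W) (e : lexp K) :
  leval vs e = \sum_(i < size vs) lcoef i e *: vs`_i.
Proof.
elim: e => [j||a IHa b IHb|a IHa|c a IHa] /=.
- have E (i : nat) : Nat.eqb i j = (i == j) by apply/PeanoNat.Nat.eqb_spec/eqP.
  under eq_bigr => i _ do rewrite E.
  have [lt_j|ge_j] := ltnP j (size vs).
    rewrite (bigD1 (Ordinal lt_j)) //= eqxx scale1r big1 ?addr0 // => i ni.
    by rewrite -val_eqE /= in ni; rewrite (negPf ni) scale0r.
  rewrite nth_default // big1 // => i _.
  by rewrite ltn_eqF ?scale0r // (leq_trans (ltn_ord i)).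
- by rewrite big1 // => i _; rewrite scale0r.
- by rewrite IHa IHb -big_split; apply: eq_bigr => i _; rewrite scalerDl.
- by rewrite IHa -sumrN; apply: eq_bigr => i _; rewrite scaleNr.
- by rewrite IHa scaler_sumr; apply: eq_bigr => i _; rewrite scalerA.
Qed.

Fixpoint all_below (m : nat) (P : nat -> Prop) : Prop :=
  if m is m'.+1 then all_below m' P /\ P m' else True.

Lemma all_belowP (m : nat) (P : nat -> Prop) :
  all_below m P -> forall i, (i < m)%N -> P i.
Proof.
elim: m => //= m IH [Hm Pm] i; rewrite ltnS leq_eqVlt => /predU1P[->//|].
exact: IH.
Qed.

Lemma leval_eq (K : pzRingType) (W : lmodType K) (vs : seq W) (e1 e2 : lexp K) :
  all_below (size vs) (fun i => lcoef i e1 = lcoef i e2) ->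
  leval vs e1 = leval vs e2.
Proof.
move=> /all_belowP H; rewrite !levalE; apply: eq_bigr => i _.
by rewrite H.
Qed.

(* Syntactic equality of monomials, up to the path to the ring structure in their products. *)
Ltac lat_same x y :=
  match constr:((x, y)) with
  | (?a, ?a) => constr:(true)
  | (@GRing.one _, @GRing.one _) => constr:(true)
  | (@GRing.mul _ ?a ?b, @GRing.mul _ ?c ?d) =>
      match lat_same a c with true => lat_same b d | false => constr:(false) end
  | _ => constr:(false)
  end.
Ltac lat_in x vs :=
  match vs with
  | nil => constr:(false)
  | ?y :: ?r => match lat_same x y with true => constr:(true) | false => lat_in x r end
  end.
Ltac lat_idx x vs :=
  match vs with
  | ?y :: ?r => match lat_same x y with
                | true => constr:(O)
                | false => let i := lat_idx x r in constr:(S i)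
                end
  end.
Ltac lat_collect e vs :=
  match e with
  | (?a + ?b) => let vs := lat_collect a vs in lat_collect b vs
  | (- ?a) => lat_collect a vs
  | (_ *: ?a) => lat_collect a vs
  | (GRing.zero) => vs
  | ?x => let b := lat_in x vs in
          match b with true => vs | false => constr:(x :: vs) end
  end.
Ltac lat_reify K e vs :=
  match e with
  | (?a + ?b) => let a := lat_reify K a vs in let b := lat_reify K b vs in
                 constr:(@LAdd K a b)
  | (- ?a) => let a := lat_reify K a vs in constr:(@LOpp K a)
  | (?c *: ?a) => let a := lat_reify K a vs in constr:(@LScale K c a)
  | (GRing.zero) => constr:(@LZero K)
  | ?x => let i := lat_idx x vs in constr:(@LAtom K i)
  end.
Ltac lincomb K :=
  lazymatch goal with
  | |- @eq ?W ?a ?b =>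
    let vs := lat_collect a (@nil W) in
    let vs := lat_collect b vs in
    let ea := lat_reify K a vs in
    let eb := lat_reify K b vs in
    apply: (@leval_eq K _ vs ea eb); rewrite /=; do ?split
  end.

Section Quantum.
Variables (K : fieldType) (q : K).
Hypothesis q0 : q != 0.
Local Notation "[ d ]" := (qint q d) (format "[ d ]").

Lemma qint0 : [0] = 0. Proof. exact: big_ord0. Qed.

Lemma qintS d : [d + 1] = q * [d] + 1.
Proof.
case: d => [m|m].
  have -> : Posz m + 1 = Posz m.+1 by lia.
  rewrite /qint big_ord_recl expr0 addrC mulr_sumr; congr (_ + _).
  by apply: eq_bigr => i _; rewrite exprS.
case: m => [|m].
  have -> : Negz 0 + 1 = 0 by lia.
  by rewrite qint0 /qint big_ord1 expr1 mulrN divff // addNr.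
have -> : Negz m.+1 + 1 = Negz m by lia.
rewrite /qint [in RHS]big_ord_recl mulrN mulrDr expr1 divff // opprD addrAC addNr add0r.
rewrite mulr_sumr; congr (- _); apply: eq_bigr => i _.
by rewrite [in RHS]exprS invfM mulrA divff ?mul1r.
Qed.

(** The power q^d for an integer d, kept as an expression in [d] so that [ring] and [field] see
    through it and q = 1 is no exception. *)
Definition qpow (d : int) : K := 1 + (q - 1) * [d].

Lemma qpowS d : qpow (d + 1) = q * qpow d.
Proof. by rewrite /qpow qintS; ring. Qed.

Lemma int_step_ind (P : int -> Prop) :
  P 0 -> (forall d, P d -> P (d + 1)) -> (forall d, P (d + 1) -> P d) ->
  forall d, P d.
Proof.
move=> P0 Pu Pd; case=> m; elim: m => [|m IH] //.
- by have -> : Posz m.+1 = Posz m + 1; [lia|apply: Pu].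
- by apply: Pd; have -> : Negz 0 + 1 = 0 by lia.
- by apply: Pd; have -> : Negz m.+1 + 1 = Negz m by lia.
Qed.

Lemma qpow_neq0 d : qpow d != 0.
Proof.
elim/int_step_ind: d => [|d|d].
- by rewrite /qpow qint0 mulr0 addr0 oner_eq0.
- by rewrite qpowS => ?; rewrite mulf_neq0.
- by rewrite qpowS mulf_eq0 (negPf q0).
Qed.

Lemma qintD a b : [a + b] = [a] + qpow a * [b].
Proof.
elim/int_step_ind: a => [|a|a].
- by rewrite add0r /qpow qint0 mulr0 addr0 add0r mul1r.
- by rewrite addrAC !qintS qpowS => ->; ring.
- rewrite addrAC !qintS qpowS => E; apply: (mulfI q0).
  by apply: (addIr 1); rewrite E; ring.
Qed.

(** Eigenvalues of the L_k give differences [a] - [b], the seminormal formulae involve [a - b]; they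
    differ by the unit q^b. *)
Lemma qint_sub a b : [a] - [b] = qpow b * [a - b].
Proof. by have := qintD b (a - b); rewrite addrCA subrr addr0 => ->; ring. Qed.

Lemma qint_eq a b : ([a] == [b]) = ([a - b] == 0).
Proof. by rewrite -subr_eq0 qint_sub mulf_eq0 (negPf (qpow_neq0 b)). Qed.

Lemma qintN d : [- d] = - (qpow (- d) * [d]).
Proof. by have := qint_sub 0 (- d); rewrite qint0 sub0r sub0r opprK => <-; rewrite opprK. Qed.

Lemma qintN_eq0 d : ([- d] == 0) = ([d] == 0).
Proof. by rewrite qintN oppr_eq0 mulf_eq0 (negPf (qpow_neq0 _)). Qed.

Lemma qint_subVE a b : [a] != [b] -> [a - b]^-1 = qpow b / ([a] - [b]).
Proof.
move=> ab; rewrite qint_sub invfM mulrA divff ?qpow_neq0 ?mul1r //.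
Qed.

End Quantum.

(** * Standard sequences of nodes *)

(* [lia] on the arithmetic hypotheses only: the others slow it down considerably. *)
Ltac arith :=
  repeat match goal with
  | H : is_true (leq _ _) |- _ => revert H
  | H : is_true (andb (leq _ _) (leq _ _)) |- _ => revert H
  | H : is_true (negb (leq _ _)) |- _ => revert H
  | H : @eq ?S _ _ |- _ => first [unify S nat | unify S int]; revert H
  end; clear; lia.
Section StandardSequences.
Variables (l n : nat).
Implicit Types (x y z u w : node l n) (s : seq (node l n)).

Lemma node_eqP x y :
  ncomp x = ncomp y -> nrow x = nrow y -> ncol x = ncol y -> x = y.
Proof.
case: x y => [[a b] c] [[a' b'] c']; rewrite /ncomp /nrow /ncol /=.
by move=> /val_inj-> /val_inj-> /val_inj->.
Qed.

Lemma ncompP x y : ncomp x = ncomp y -> x.1.1 = y.1.1.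
Proof. exact: val_inj. Qed.

Lemma nrow_lt x : (nrow x < n)%N. Proof. exact: ltn_ord. Qed.
Lemma ncol_lt x : (ncol x < n)%N. Proof. exact: ltn_ord. Qed.

Lemma node_exists x i j : (i < n)%N -> (j < n)%N ->
  exists w, [/\ ncomp w = ncomp x, nrow w = i & ncol w = j].
Proof. by move=> hi hj; exists (x.1.1, Ordinal hi, Ordinal hj). Qed.

(** The diagrams of multipartitions are the lower sets of this order, so partitions need no notion
    of their own. *)
Definition le_node x y : bool :=
  [&& ncomp x == ncomp y, nrow x <= nrow y & ncol x <= ncol y]%N.

Lemma le_node_refl x : le_node x x. Proof. by rewrite /le_node eqxx !leqnn. Qed.

Definition addable s x : bool :=
  (x \notin s) && [forall y, (le_node y x && (y != x)) ==> (y \in s)].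

(* The entries of a standard tableau, the largest one first. *)
Fixpoint stdseq s : bool :=
  if s is x :: s' then addable s' x && stdseq s' else true.

Lemma addableP s x :
  reflect (x \notin s /\ forall y, le_node y x -> y != x -> y \in s) (addable s x).
Proof.
apply: (iffP andP) => [[nx /forallP H]|[nx H]]; split=> //.
  by move=> y lyx nyx; have := H y; rewrite lyx nyx.
by apply/forallP=> y; apply/implyP=> /andP[]; apply: H.
Qed.

Lemma eq_addable s1 s2 : s1 =i s2 -> addable s1 =1 addable s2.
Proof.
move=> E x; rewrite /addable E; congr (_ && _).
by apply: eq_forallb => y; rewrite E.
Qed.

Lemma addable_cons s u z : addable s z -> u != z -> addable (u :: s) z.
Proof.
move=> /addableP[nz H] uz; apply/addableP; split.
  by rewrite in_cons negb_or eq_sym uz.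
by move=> y lyz nyz; rewrite in_cons H ?orbT.
Qed.

Lemma stdseq_cat s1 s2 : stdseq (s1 ++ s2) -> stdseq s2.
Proof. by elim: s1 => //= x s1 IH /andP[_ /IH]. Qed.

Lemma stdseq_uniq s : stdseq s -> uniq s.
Proof. by elim: s => //= x s IH /andP[/andP[-> _] /IH]. Qed.

Lemma stdseq_closed s x y : stdseq s -> x \in s -> le_node y x -> y \in s.
Proof.
elim: s => //= z s IH /andP[/addableP[_ Hz] hs].
have [-> _ _|nyz] := eqVneq y z; first by rewrite mem_head.
rewrite !in_cons => /predU1P[->|xs] lyx.
  by rewrite Hz ?orbT.
by rewrite (IH hs xs lyx) orbT.
Qed.

(** A node of the interval from [y] to [z] other than its ends would lie in [s], and the lower set
    [s] would then contain [y]. So [z] is the right or the lower neighbour of [y]. *)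
Lemma addable_new s y z : stdseq (y :: s) -> addable (y :: s) z -> ~~ addable s z ->
  [/\ ncomp z = ncomp y & (nrow z = nrow y /\ ncol z = (ncol y).+1) \/
                          (nrow z = (nrow y).+1 /\ ncol z = ncol y)].
Proof.
move=> hs /addableP[nz Hz] naz.
move: (hs) => /= /andP[/addableP[nys Hy] hs'].
move: nz; rewrite in_cons negb_or => /andP[nzy nzs].
have lyz : le_node y z.
  apply: contraNT naz => nlyz; apply/addableP; split=> // w lwz nwz.
  have := Hz w lwz nwz; rewrite in_cons => /predU1P[E|//].
  by rewrite -E lwz in nlyz.
have Hmid w : le_node y w -> le_node w z -> w != y -> w = z.
  move=> lyw lwz nwy; apply/eqP; apply: contraNT nys => nwz.
  have := Hz w lwz nwz; rewrite in_cons (negPf nwy) /= => ws.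
  exact: stdseq_closed hs' ws lyw.
move/and3P: (lyz) => [/eqP cyz ryz cyz'].
split=> //.
have [w1 [a1 b1 c1]] := node_exists y (nrow_lt y) (ncol_lt z).
have [w2 [a2 b2 c2]] := node_exists y (nrow_lt z) (ncol_lt y).
have [Ec|nc] := eqVneq (ncol z) (ncol y).
  right; split=> //.
  have lt_r : (nrow y < nrow z)%N.
    rewrite ltn_neqAle ryz andbT; apply: contra nzy => /eqP E.
    by apply/eqP/node_eqP.
  have h : ((nrow y).+1 < n)%N by apply: leq_ltn_trans lt_r (nrow_lt z).
  have [w [a b c]] := node_exists y h (ncol_lt y).
  have <- : w = z; last by [].
  apply: Hmid; first by rewrite /le_node a b c; lia.
    by rewrite /le_node a b c; lia.
  by apply/eqP=> E; move: b; rewrite E; lia.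
left; have lt_c : (ncol y < ncol z)%N by rewrite ltn_neqAle cyz' andbT eq_sym.
have h : ((ncol y).+1 < n)%N by apply: leq_ltn_trans lt_c (ncol_lt z).
have [w [a b c]] := node_exists y (nrow_lt y) h.
have E : w = z.
  apply: Hmid; first by rewrite /le_node a b c; lia.
    by rewrite /le_node a b c; lia.
  by apply/eqP=> E; move: c; rewrite E; lia.
by rewrite -E b c.
Qed.

Lemma addable_incomp s u z : stdseq s -> addable s u -> addable s z -> u != z ->
  ~~ le_node u z.
Proof.
move=> hs /addableP[nu _] /addableP[_ Hz] nuz.
by apply: contra nu => /Hz; apply.
Qed.

Lemma row_nbr s z : addable s z -> (0 < nrow z)%N ->
  exists w, [/\ w \in s, ncomp w = ncomp z, nrow z = (nrow w).+1 & ncol w = ncol z].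
Proof.
move=> /addableP[_ H] h.
have h1 : ((nrow z).-1 < n)%N by have := nrow_lt z; lia.
have [w [a b c]] := node_exists z h1 (ncol_lt z).
exists w; split=> //; last by lia.
apply: H; first by rewrite /le_node a b c; lia.
by apply/eqP=> E; move: b; rewrite E; lia.
Qed.

Lemma col_nbr s z : addable s z -> (0 < ncol z)%N ->
  exists w, [/\ w \in s, ncomp w = ncomp z, nrow w = nrow z & ncol z = (ncol w).+1].
Proof.
move=> /addableP[_ H] h.
have h1 : ((ncol z).-1 < n)%N by have := ncol_lt z; lia.
have [w [a b c]] := node_exists z (nrow_lt z) h1.
exists w; split=> //; last by lia.
apply: H; first by rewrite /le_node a b c; lia.
by apply/eqP=> E; move: c; rewrite E; lia.
Qed.

(** The first row up to the column of [x] and the first column up to the row of [y] form a hook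
    inside the diagram. This bounds differences of contents within a component. *)
Lemma hook_bound s x y : stdseq s -> x \in s -> y \in s -> ncomp x = ncomp y ->
  (ncol x + nrow y < size s)%N.
Proof.
elim: s x y => // z s IH x y /= /andP[az hs].
have Hdiag : (ncol z + nrow z < (size s).+1)%N.
  have [/row_nbr-/(_ _ az)|r0] := ltnP 0 (nrow z).
    case=> w [ws E1 E2 E3]; have := IH w w hs ws ws erefl; lia.
  have [/col_nbr-/(_ _ az)|c0] := ltnP 0 (ncol z).
    case=> w [ws E1 E2 E3]; have := IH w w hs ws ws erefl; lia.
  lia.
rewrite !in_cons => /predU1P[->|xs] /predU1P[->|ys] E //.
- have := IH y y hs ys ys erefl.
  have [/col_nbr-/(_ _ az)|c0] := ltnP 0 (ncol z); last lia.
  by case=> w [ws E1 E2 E3]; have := IH w y hs ws ys; rewrite E1 => /(_ E); lia.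
- have := IH x x hs xs xs erefl.
  have [/row_nbr-/(_ _ az)|c0] := ltnP 0 (nrow z); last lia.
  by case=> w [ws E1 E2 E3]; have := IH x w hs xs ws; rewrite E1 => /(_ E); lia.
- exact: leqW (IH x y hs xs ys E).
Qed.

(** Each of the two components contains a hook as in [hook_bound], and the two are disjoint. *)
Lemma two_comp_bound s x y : stdseq s -> x \in s -> y \in s -> ncomp x <> ncomp y ->
  (nrow x + ncol x + (nrow y + ncol y) + 1 < size s)%N.
Proof.
elim: s x y => // z s IH x y /= /andP[az hs].
have Hz w : w \in s -> ncomp z <> ncomp w ->
  (nrow z + ncol z + (nrow w + ncol w) + 1 < (size s).+1)%N.
  move=> ws E; have := hook_bound hs ws ws erefl.
  have [/row_nbr-/(_ _ az)|r0] := ltnP 0 (nrow z).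
    by case=> v [vs E1 E2 E3]; have := IH v w hs vs ws; rewrite E1 => /(_ E); lia.
  have [/col_nbr-/(_ _ az)|c0] := ltnP 0 (ncol z).
    by case=> v [vs E1 E2 E3]; have := IH v w hs vs ws; rewrite E1 => /(_ E); lia.
  lia.
rewrite !in_cons => /predU1P[->|xs] /predU1P[->|ys] E //.
- exact: Hz.
- by have := Hz x xs (fun E' => E (esym E')); lia.
- exact: leqW (IH x y hs xs ys E).
Qed.

Lemma stdseq_swap s1 s2 u z : stdseq (s2 ++ z :: u :: s1) -> ~~ le_node u z ->
  stdseq (s2 ++ u :: z :: s1).
Proof.
elim: s2 => [|y s2 IH] /= H nle.
  case/and3P: H => az au ->; rewrite andbT.
  have nuz : u != z by apply: contraNneq nle => ->; apply: le_node_refl.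
  rewrite addable_cons //=; last by rewrite eq_sym.
  case/addableP: az => nz Hz; apply/addableP; split.
    by move: nz; rewrite in_cons negb_or => /andP[].
  move=> y lyz nyz; have := Hz y lyz nyz; rewrite in_cons => /predU1P[E|//].
  by rewrite -E lyz in nle.
case/andP: H => ay hs; rewrite IH // andbT.
rewrite -(@eq_addable (s2 ++ z :: u :: s1)) // => w.
by rewrite !mem_cat !in_cons; congr (_ || _); apply: orbCA.
Qed.

Variable kappa : 'I_l -> int.
Local Notation cont := (content kappa).

(** The nodes are incomparable, so one lies strictly above and strictly to the right of the other;
    row and column each contribute at least 1. *)
Lemma addable_content s u z : stdseq s -> addable s u -> addable s z ->
  u != z -> ncomp u = ncomp z -> (1 < `|cont u - cont z|)%N.
Proof.
move=> hs au az nuz E.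
have := addable_incomp hs au az nuz.
have := addable_incomp hs az au; rewrite eq_sym => /(_ nuz).
rewrite /le_node /content E (ncompP E) eqxx /=; lia.
Qed.

(** * Separation of contents by the parameters *)

Section Separated.
Variables (K : fieldType) (q : K).
Hypotheses (q0 : q != 0) (sep : separates q n kappa).
Local Notation "[ d ]" := (qint q d) (format "[ d ]").

Lemma qint_small_neq0 (d : int) : d != 0 -> (`|d| <= n)%N -> [d] != 0.
Proof.
have H (k : nat) : (0 < k <= n)%N -> [k%:Z] != 0.
  move=> hk; move: sep; rewrite /separates mulf_eq0 negb_or => /andP[+ _].
  rewrite prodf_seq_neq0 => /allP/(_ k) /=.
  by rewrite mem_index_iota ltnS; apply.
case: d => m d0 dn; first by apply: H; lia.
rewrite NegzE qintN_eq0 //; apply: H; lia.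
Qed.

Lemma qint_kappa_neq0 (i j : 'I_l) (d : int) : i != j -> (`|d| < n)%N ->
  [kappa i - kappa j + d] != 0.
Proof.
have H (i' j' : 'I_l) (e : int) : (i' < j')%N -> (`|e| < n)%N ->
    [kappa i' - kappa j' + e] != 0.
  move=> lij he; move: sep; rewrite /separates mulf_eq0 negb_or => /andP[_].
  move/prodf_neq0/(_ i' isT)/prodf_neq0/(_ j' lij).
  (* The product over -n < e < n is indexed from 0, so [e] sits at position e + n - 1. *)
  have h : (absz (e + n%:Z - 1)%R < (n.*2).-1)%N by lia.
  move/prodf_neq0/(_ (Ordinal h) isT) => /=.
  by congr (qint _ _ != 0); lia.
rewrite neq_ltn => /orP[lij|lji] hd; first exact: H.
have -> : kappa i - kappa j + d = - (kappa j - kappa i + - d) by lia.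
by rewrite qintN_eq0 //; apply: H => //; lia.
Qed.

(** Nodes of one component are separated by the quantum factorial, nodes of different components by
    the double product; the hook bounds put the argument in range. The shift [e] allows for adjacent
    contents. *)
Lemma qint_content_neq0 s x y (e : int) : stdseq s -> x \in s -> y \in s ->
  (size s + `|e| <= n.+1)%N -> (`|e| <= 1)%N ->
  (ncomp x = ncomp y -> cont x - cont y + e != 0) ->
  [cont x - cont y + e] != 0.
Proof.
move=> hs xs ys hse he Hc.
have [E|/eqP nE] := eqVneq (ncomp x) (ncomp y).
  apply: qint_small_neq0; first exact: Hc.
  have := hook_bound hs xs ys E; have := hook_bound hs ys xs (esym E).
  rewrite /content (ncompP E); lia.
have := two_comp_bound hs xs ys nE => B.
have -> : cont x - cont y + e =
  kappa x.1.1 - kappa y.1.1 + ((ncol x)%:Z - (nrow x)%:Z - ((ncol y)%:Z - (nrow y)%:Z) + e).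
  by rewrite /content; lia.
apply: qint_kappa_neq0; last by lia.
by apply: contra_notN nE => /eqP E; rewrite /ncomp E.
Qed.

Lemma addable_qint_neq s u z (e : int) : stdseq s -> addable s u -> addable s z ->
  u != z -> (size s + `|e| < n)%N -> (`|e| <= 1)%N -> [cont u + e] != [cont z].
Proof.
move=> hs au az nuz hse he; rewrite qint_eq //.
have -> : cont u + e - cont z = cont u - cont z + e by lia.
apply: (@qint_content_neq0 [:: z, u & s]) => //=.
- by rewrite au hs !andbT; apply: addable_cons.
- by rewrite !inE eqxx orbT.
- by rewrite mem_head.
- by move=> E; have := addable_content hs au az nuz E; lia.
Qed.

Lemma addable_qint_neq1 s u z (e : int) : stdseq s -> addable s u -> addable s z ->
  (`|e| = 1)%N -> (size s + 1 < n)%N -> [cont u + e] != [cont z].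
Proof.
move=> hs au az he hsn; have [<-|nuz] := eqVneq u z.
  rewrite qint_eq //; have -> : cont u + e - cont u = e by lia.
  by apply: qint_small_neq0; lia.
by apply: (@addable_qint_neq s) => //; lia.
Qed.

Lemma addable_qint_neq0 s u z : stdseq s -> addable s u -> addable s z ->
  u != z -> (size s < n)%N -> [cont u] != [cont z].
Proof.
move=> hs au az nuz hsn; have := @addable_qint_neq s u z 0 hs au az nuz.
by rewrite addr0; apply; lia.
Qed.

End Separated.
End StandardSequences.

(** * Eigenvectors of the L_k *)

Section Weights.
Variables (K : fieldType) (q : K) (l n : nat) (kappa : 'I_l -> int).
Variables (A : algType K) (L T : nat -> A).
Hypotheses (q0 : q != 0) (hrel : hecke_rel q n kappa L T).
Local Notation "[ d ]" := (qint q d) (format "[ d ]").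
Local Notation cont := (content kappa).

Definition alg_simp := (mulrDl, mulrDr, mulrN, mulNr, mulr1, mul1r, mul0r, mulr0,
  =^~ @scalerAl K A, =^~ @scalerAr K A, mulrA).

Lemma LL_comm r s : (0 < r <= n)%N -> (0 < s <= n)%N -> L r * L s = L s * L r.
Proof. by case: hrel => _ [_ [H _]]; apply: H. Qed.

Lemma TT_comm r s : (0 < r < n)%N -> (0 < s < n)%N -> (r.+1 < s)%N || (s.+1 < r)%N ->
  T r * T s = T s * T r.
Proof. by case: hrel => _ [_ [_ [H _]]]; apply: H. Qed.

Lemma T_braid s : (0 < s)%N -> (s.+1 < n)%N ->
  T s * T s.+1 * T s = T s.+1 * T s * T s.+1.
Proof. by case: hrel => _ [_ [_ [_ [H _]]]]; apply: H. Qed.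

Lemma TL_comm r s : (0 < r < n)%N -> (0 < s <= n)%N -> s != r -> s != r.+1 ->
  T r * L s = L s * T r.
Proof. by case: hrel => _ [_ [_ [_ [_ [H _]]]]]; apply: H. Qed.

Lemma T_quad r : (0 < r < n)%N -> T r * T r = (q - 1) *: T r + q *: 1.
Proof.
case: hrel => _ [H _] /H; rewrite !alg_simp => E.
apply/eqP; rewrite -subr_eq0; apply/eqP; rewrite -[RHS]E; lincomb K; ring.
Qed.

Lemma T_L r : (0 < r < n)%N -> T r * L r = L r.+1 * T r - (q - 1) *: L r.+1 - 1.
Proof.
case: hrel => _ [_ [_ [_ [_ [_ H]]]]] /H; rewrite !alg_simp => E.
by apply: (addIr 1); rewrite -E; lincomb K; ring.
Qed.

Lemma T_L1 r : (0 < r < n)%N -> T r * L r.+1 = L r * T r + (q - 1) *: L r.+1 + 1.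
Proof.
(* The familiar recursion for Jucys-Murphy elements; multiplying it by T_r and reducing the square
   gives the claim up to the unit q. *)
move=> hr; have E : q *: L r.+1 = T r * L r * T r + T r.
  rewrite (T_L hr) !alg_simp -mulrA (T_quad hr) !alg_simp.
  by lincomb K; ring.
have E2 : q *: (T r * L r.+1) = (q - 1) *: (T r * L r * T r) +
    q *: (L r * T r) + (q - 1) *: T r + q *: 1.
  rewrite scalerAr E mulrDr !mulrA (T_quad hr) !alg_simp.
  by lincomb K; ring.
apply: (scalerI q0); rewrite E2.
have -> : T r * L r * T r = q *: L r.+1 - T r by rewrite E addrK.
by lincomb K; ring.
Qed.

(** This is the commutator L_r T_r - T_r L_r, rewritten by [T_L]. On an eigenvector with contents
    c1, c2 it acts as [c1] - [c2] times T_r + 1/[c1 - c2], free of denominators. *)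
Definition intertwiner r : A := (L r - L r.+1) * T r + (q - 1) *: L r.+1 + 1.
Local Notation phi := intertwiner.

Lemma intertwiner_L r : (0 < r < n)%N -> phi r * L r = L r.+1 * phi r.
Proof.
move=> hr; have C : L r * L r.+1 = L r.+1 * L r by apply: LL_comm; arith.
rewrite /phi !alg_simp -![_ * T r * L r]mulrA (T_L hr) !alg_simp C.
by lincomb K; ring.
Qed.

Lemma intertwiner_L1 r : (0 < r < n)%N -> phi r * L r.+1 = L r * phi r.
Proof.
move=> hr; have C : L r * L r.+1 = L r.+1 * L r by apply: LL_comm; arith.
rewrite /phi !alg_simp -![_ * T r * L r.+1]mulrA (T_L1 hr) !alg_simp -C.
by lincomb K; ring.
Qed.

Lemma intertwiner_comm r s : (0 < r < n)%N -> (0 < s <= n)%N -> s != r -> s != r.+1 ->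
  phi r * L s = L s * phi r.
Proof.
move=> hr hs s1 s2; rewrite /phi !alg_simp -![_ * T r * L s]mulrA (TL_comm hr) //.
by rewrite !mulrA !(LL_comm (s := s)) //; arith.
Qed.

Lemma intertwiner_sqr r : (0 < r < n)%N ->
  phi r * phi r = - ((L r.+1 - 1 - q *: L r) * (q *: L r.+1 - L r + 1)).
Proof.
move=> hr; have C : L r * L r.+1 = L r.+1 * L r by apply: LL_comm; arith.
rewrite {2}/phi !mulrDr mulr1 mulrA mulrBr -scalerAr intertwiner_L //.
rewrite intertwiner_L1 // -mulrBl -mulrA.
have -> : phi r * T r = (q *: L r - q *: L r.+1) + (q - 1) *: (L r * T r) + T r.
  rewrite /phi !alg_simp -![_ * T r * T r]mulrA (T_quad hr) !alg_simp.
  by lincomb K; ring.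
rewrite /phi !alg_simp -C.
by lincomb K; ring.
Qed.

Lemma eigen_horner (B : A) (x : A) (b : K) (p : {poly K}) :
  x * B = b *: x -> x * horner_alg B p = p.[b] *: x.
Proof.
move=> xB; elim/poly_ind: p => [|p c IH]; first by rewrite rmorph0 mulr0 horner0 scale0r.
rewrite rmorphD rmorphM /= horner_algX horner_algC mulrDr mulrA IH.
rewrite -scalerAl xB hornerMXaddC scalerA -scalerAr mulr1 -scalerDl.
by rewrite mulrC.
Qed.

Lemma horner_alg_intertwine (B C F : A) (p : {poly K}) :
  B * F = F * C -> horner_alg B p * F = F * horner_alg C p.
Proof.
move=> E; elim/poly_ind: p => [|p c IH]; first by rewrite !rmorph0 mulr0 mul0r.
rewrite !rmorphD !rmorphM /= !horner_algX !horner_algC mulrDr mulrDl.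
by rewrite -mulrA E !mulrA IH -scalerAl -scalerAr mul1r mulr1.
Qed.

Lemma horner_algXsubC (B : A) (b : K) : horner_alg B ('X - b%:P) = B - b *: 1.
Proof. by rewrite rmorphB /= horner_algX horner_algC. Qed.

(** Factors are peeled off one at a time: [x] times the polynomial without X - b is an eigenvector
    for [b] inside [W], hence 0. *)
Lemma remove_factors (W : A -> Prop) (B : A) (bs : seq K) (p : {poly K}) (x : A) :
  (forall y p, W y -> W (y * horner_alg B p)) ->
  (forall y b, b \in bs -> W y -> y * B = b *: y -> y = 0) -> W x ->
  x * horner_alg B (p * \prod_(b <- bs) ('X - b%:P)) = 0 -> x * horner_alg B p = 0.
Proof.
move=> WB; elim: bs p => [|b bs IH] p Hb Wx.
  by rewrite big_nil mulr1.
rewrite big_cons mulrA => /IH E; have {}E : x * horner_alg B (p * ('X - b%:P)) = 0.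
  by apply: E => // y b' b's; apply: Hb; rewrite in_cons b's orbT.
apply: (Hb _ b); [exact: mem_head|exact: WB|].
apply/eqP; rewrite -subr_eq0; apply/eqP; rewrite -[RHS]E.
by rewrite rmorphM /= horner_algXsubC mulrA mulrBr -scalerAr mulr1.
Qed.

Lemma eigen_decomposition (W P : A -> Prop) (B : A) (bs : seq K) (x : A) :
  (forall y z, W y -> W z -> W (y + z)) -> (forall c y, W y -> W (c *: y)) ->
  (forall y p, W y -> W (y * horner_alg B p)) ->
  P 0 -> (forall y z, P y -> P z -> P (y + z)) ->
  (forall y b, b \in bs -> W y -> y * B = b *: y -> P y) ->
  uniq bs -> W x -> x * horner_alg B (\prod_(b <- bs) ('X - b%:P)) = 0 -> P x.
Proof.
move=> WD WZ WB P0 PD; elim: bs x => [|b bs IH] x Hb.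
  by rewrite big_nil rmorph1 mulr1 => _ _ ->.
move=> /= /andP[nb ub] Wx; rewrite big_cons => E.
set g := \prod_(b <- bs) _ in E.
have gb : g.[b] != 0.
  rewrite horner_prod prodf_seq_neq0; apply/allP => c cs /=.
  by rewrite hornerXsubC subr_eq0; apply: contraNneq nb => ->.
(* Lagrange interpolation: [y] is the component of [x] for [b], and x - y is killed by the remaining
   factors. *)
pose y := g.[b]^-1 *: (x * horner_alg B g).
have Wy : W y by apply/WZ/WB.
have yB : y * B = b *: y.
  apply/eqP; rewrite -subr_eq0 /y -scalerAl scalerA mulrC -scalerA -scalerBr.
  rewrite scaler_eq0 invr_eq0 (negPf gb) /=; apply/eqP; rewrite -[RHS]E.
  by rewrite mulrC rmorphM /= horner_algXsubC mulrA mulrBr -scalerAr mulr1.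
have -> : x = y + (x - y) by rewrite addrC subrK.
apply: (PD); first by apply: (Hb y b) => //; apply: mem_head.
apply: IH => //.
- by move=> z c cs; apply: Hb; rewrite in_cons cs orbT.
- by apply: WD => //; rewrite -scaleN1r; apply: WZ.
- by rewrite mulrBl (eigen_horner _ yB) /y scalerA mulfV // scale1r subrr.
Qed.

Fixpoint weight (s : seq (node l n)) (x : A) : Prop :=
  if s is y :: s' then x * L (size s').+1 = [cont y] *: x /\ weight s' x else True.


Lemma weightD s x y : weight s x -> weight s y -> weight s (x + y).
Proof.
elim: s => //= z s IH [Ex Wx] [Ey Wy]; split; last exact: IH.
by rewrite mulrDl Ex Ey scalerDr.
Qed.

Lemma weightZ s c x : weight s x -> weight s (c *: x).
Proof.
elim: s => //= z s IH [Ex Wx]; split; last exact: IH.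
by rewrite -scalerAl Ex !scalerA mulrC.
Qed.

Lemma weight_mul s x z : (forall j, (0 < j <= size s)%N -> z * L j = L j * z) ->
  weight s x -> weight s (x * z).
Proof.
elim: s => //= y s IH H [Ex Wx]; split.
  by rewrite -mulrA H ?leqnn // mulrA Ex scalerAl.
by apply: IH => // j hj; apply: H; arith.
Qed.

Lemma weight_horner s x k p : (size s < k <= n)%N ->
  weight s x -> weight s (x * horner_alg (L k) p).
Proof.
move=> hk; apply: weight_mul => j hj; apply: horner_alg_intertwine.
by apply: LL_comm; arith.
Qed.

Lemma eigen_T_L r x (c1 c2 : int) : (0 < r < n)%N ->
  x * L r = [c1] *: x -> x * L r.+1 = [c2] *: x ->
  x * T r * L r = [c2] *: (x * T r) - qpow q c2 *: x /\
  x * T r * L r.+1 = [c1] *: (x * T r) + qpow q c2 *: x.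
Proof.
move=> hr E1 E2; split.
  rewrite -mulrA (T_L hr) !alg_simp E2 !alg_simp /qpow.
  by lincomb K; ring.
rewrite -mulrA (T_L1 hr) !alg_simp E1 E2 !alg_simp /qpow.
by lincomb K; ring.
Qed.

Lemma eigen_step r x (c1 c2 : int) : (0 < r < n)%N -> [c1] != [c2] ->
  x * L r = [c1] *: x -> x * L r.+1 = [c2] *: x ->
  let y := x * T r + [c1 - c2]^-1 *: x in
  y * L r = [c2] *: y /\ y * L r.+1 = [c1] *: y.
Proof.
move=> hr nc E1 E2 /=; have [F1 F2] := eigen_T_L hr E1 E2.
have nc' : [c1] - [c2] != 0 by rewrite subr_eq0.
rewrite (qint_subVE q0 nc); move: (qpow q c2) F1 F2 => a F1 F2.
rewrite !mulrDl F1 F2 -!scalerAl E1 E2.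
by split; lincomb K; field.
Qed.

Lemma weight_T s r x : (size s < r < n)%N -> weight s x -> weight s (x * T r).
Proof. by move=> hr; apply: weight_mul => j hj; apply: TL_comm; arith. Qed.

Lemma weight_intertwiner s r x : (size s < r < n)%N ->
  weight s x -> weight s (x * intertwiner r).
Proof. by move=> hr; apply: weight_mul => j hj; apply: intertwiner_comm; arith. Qed.

Lemma weight_cat s1 s2 x : weight (s1 ++ s2) x -> weight s2 x.
Proof. by elim: s1 => //= y s1 IH [_ /IH]. Qed.

Lemma weight_swap s1 s2 u z x : (size s1 + size s2 + 2 <= n)%N ->
  weight (s2 ++ z :: u :: s1) x ->
  weight (s2 ++ u :: z :: s1) (x * intertwiner (size s1).+1).
Proof.
elim: s2 => [|y s2 IH] hs /=.
  have hr : (0 < (size s1).+1 < n)%N by rewrite /=; arith.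
  move=> [Ez [Eu W]]; split; last split.
  - by rewrite -mulrA intertwiner_L1 // mulrA Eu scalerAl.
  - by rewrite -mulrA intertwiner_L // mulrA Ez scalerAl.
  - by apply: weight_intertwiner => //; arith.
move=> [Ey W]; split; last by apply: IH => //; move: hs => /=; arith.
move: Ey; rewrite !size_cat /= => Ey.
by rewrite -mulrA intertwiner_comm ?mulrA ?Ey ?scalerAl //; move: hs => /=; arith.
Qed.

(* On a weight vector, [phi_r^2] is a scalar that vanishes only for adjacent contents. *)
Lemma intertwiner_inj r x (c1 c2 : int) : (0 < r < n)%N ->
  x * L r = [c1] *: x -> x * L r.+1 = [c2] *: x ->
  [c1 + 1] != [c2] -> [c1 - 1] != [c2] -> x * intertwiner r = 0 -> x = 0.
Proof.
move=> hr E1 E2 n1 n2 E.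
have Ec1 : [c1] = q * [c1 - 1] + 1 by rewrite -qintS // subrK.
have : x * (intertwiner r * intertwiner r) =
    (- q * ([c2] - [c1 + 1]) * ([c2] - [c1 - 1])) *: x.
  by rewrite intertwiner_sqr // !(alg_simp, E1, E2) qintS // Ec1; lincomb K; ring.
rewrite mulrA E mul0r => /esym/eqP; rewrite scaler_eq0 => /predU1P[/eqP|/eqP->//].
rewrite !mulf_eq0 oppr_eq0 (negPf q0) /= !subr_eq0.
by rewrite ![[c2] == _]eq_sym (negPf n1) (negPf n2).
Qed.

Hypothesis sep : separates q n kappa.

Definition addpoly (s : seq (node l n)) : {poly K} :=
  \prod_(z | addable s z) ('X - [cont z]%:P).

(* The next entry of a standard tableau occupies an addable node. *)
Definition branching (s : seq (node l n)) : Prop :=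
  forall x, weight s x -> x * horner_alg (L (size s).+1) (addpoly s) = 0.

Lemma weight_vanish s x b : branching s -> weight s x ->
  x * L (size s).+1 = b *: x -> (forall z, addable s z -> b != [cont z]) -> x = 0.
Proof.
move=> Q Wx E H; have := Q x Wx; rewrite (eigen_horner _ E) => /eqP.
rewrite scaler_eq0 => /orP[|/eqP//].
rewrite horner_prod => /prodf_eq0[z az].
by rewrite hornerXsubC subr_eq0 (negPf (H z az)).
Qed.

(** With r = size s + 1 and c the content of [y], a non-zero [x] would give a Jordan block (x
    T_r)(L_r - [c]) = - q^c x. But [addpoly s] evaluated at L_r kills x T_r, and [c] is only a
    simple root of it. *)
Lemma repeated_content_vanish s y x : stdseq (y :: s) -> branching s ->
  ((size s).+1 < n)%N -> weight (y :: s) x ->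
  x * L (size s).+2 = [cont y] *: x -> x = 0.
Proof.
move=> /= /andP[ay hs] Q hn [E1 W] E2.
have hr : (0 < (size s).+1 < n)%N by [].
have [F _] := eigen_T_L hr E1 E2.
have WT : weight s (x * T (size s).+1) by apply: weight_T => //; rewrite ltnSn.
have := Q _ WT; rewrite /addpoly (bigD1 y) //= rmorphM /= mulrA horner_algXsubC.
rewrite mulrBr F -scalerAr mulr1 addrAC subrr add0r -scaleNr -scalerAl.
rewrite (eigen_horner _ E1) scalerA => /eqP; rewrite scaler_eq0 => /predU1P[/eqP|/eqP//].
rewrite mulf_eq0 oppr_eq0 (negPf (qpow_neq0 q0 _)) /= horner_prod.
move=> /prodf_eq0[z /andP[az nzy]]; rewrite hornerXsubC subr_eq0.
by rewrite (negPf (addable_qint_neq0 q0 sep hs ay az _ _)) 1?eq_sym //; arith.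
Qed.

Lemma qint_pm_neq0 (e : int) : (`|e| = 1)%N -> [e] != 0.
Proof.
move=> he; have [->|->] : e = 1 \/ e = - 1 by arith.
  by rewrite -[1]add0r qintS // qint0 mulr0 add0r oner_eq0.
by rewrite qintN_eq0 // -[1]add0r qintS // qint0 mulr0 add0r oner_eq0.
Qed.

(* Contents [c + e, c, c + e] with [e = 1] or [e = -1] would make two consecutive generators act by distinct scalars, against the braid relation. *)
Lemma zigzag_vanish s u y x (e : int) :
  (forall s' : seq (node l n), stdseq s' -> (size s' <= (size s).+1)%N -> branching s') ->
  stdseq (y :: u :: s) -> le_node u y ->
  cont u = cont y + e -> (`|e| = 1)%N -> ((size s).+2 < n)%N ->
  weight (y :: u :: s) x -> x * L (size s).+3 = [cont y + e] *: x -> x = 0.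
Proof.
move=> Q hst luy Eu he hn [/= E2 [E1 W]] E3.
move: (hst) => /= /and3P[ay au hs].
have huS : stdseq (u :: s) by rewrite /= au hs.
have nuy : u != y by case/addableP: ay; rewrite in_cons negb_or eq_sym => /andP[].
have ne : [e] != 0 := qint_pm_neq0 he.
have neN : [- e] != 0 by rewrite qintN_eq0.
have nyu : [cont y] != [cont u].
  by rewrite qint_eq // Eu (_ : _ - _ = - e) //; arith.
(* No node addable to [u :: s] has a content adjacent to that of the addable node [y], so the step
   towards the swapped weight vanishes and T acts by a scalar. [TP] follows likewise from [u] being
   addable to [s]. *)
have TN : x * T (size s).+2 = - [- e]^-1 *: x.
  have nyu' : [cont y] != [cont y + e] by rewrite -Eu.
  have hr : (0 < (size s).+2 < n)%N by [].
  have [F1 F2] := eigen_step hr nyu' E2 E3.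
  have Z : x * T (size s).+2 + [cont y - (cont y + e)]^-1 *: x = 0.
    apply: (weight_vanish (Q _ huS _)) F1 _ => //.
      apply: weightD; last by apply: weightZ.
      by apply: weight_T => //=; rewrite ?ltnSn; arith.
    move=> z az /=; apply: addable_qint_neq1 ay az he _ => //=; arith.
  move: Z; rewrite (_ : _ - _ = - e); last by arith.
  by move/eqP; rewrite addr_eq0 scaleNr => /eqP.
have TP : x * T (size s).+1 = - [e]^-1 *: x.
  have hr : (0 < (size s).+1 < n)%N by arith.
  have nuy' : [cont u] != [cont y] by rewrite eq_sym.
  have [F1 F2] := eigen_step hr nuy' E1 E2.
  have Z : x * T (size s).+1 + [cont u - cont y]^-1 *: x = 0.
    apply: (weight_vanish (Q _ hs _)) F1 _ => //.
      apply: weightD; last by apply: weightZ.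
      by apply: weight_T => //=; rewrite ?ltnSn; arith.
    move=> z az /=; have -> : cont y = cont u + - e by arith.
    by apply: addable_qint_neq1 az _ _ => //; arith.
  move: Z; rewrite (_ : _ - _ = e); last by arith.
  by move/eqP; rewrite addr_eq0 scaleNr => /eqP.
have := congr1 (fun a => x * a) (@T_braid (size s).+1 isT hn).
rewrite !mulrA TP -!scalerAl TN -!scalerAl TP -!scalerAl TN !scalerA.
move/eqP; rewrite -subr_eq0 -scalerBl scaler_eq0 => /predU1P[/eqP|/eqP//].
set a := [e] in ne *; set b := [- e] in neN *.
have -> : - a^-1 * - b^-1 * - a^-1 - - b^-1 * - a^-1 * - b^-1 = (a - b) / (a * b) ^+ 2.
  by field; rewrite ne neN.
rewrite mulf_eq0 subr_eq0 invr_eq0 expf_eq0 /= mulf_eq0 (negPf ne) (negPf neN) orbF.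
(* The two scalars coincide only if [2e] = 0, which separation excludes because 2 <= n. *)
by rewrite qint_eq // (negPf (qint_small_neq0 q0 sep _ _)) //; arith.
Qed.

(** The entries between [u] and [y] are not above [u], so [u] can be moved past them one by one
    until it directly precedes [y]. Each move is an intertwiner between two addable nodes, whose
    contents are never adjacent, hence is injective. *)
Lemma separated_zigzag_vanish s2 s u y x (e : int) :
  (forall s' : seq (node l n), stdseq s' -> (size s' <= size s2 + (size s).+1)%N -> branching s') ->
  stdseq (y :: s2 ++ u :: s) -> le_node u y -> {in s2, forall w, ~~ le_node u w} ->
  cont u = cont y + e -> (`|e| = 1)%N -> (size s2 + (size s).+2 < n)%N ->
  weight (y :: s2 ++ u :: s) x ->
  x * L (size (y :: s2 ++ u :: s)).+1 = [cont y + e] *: x -> x = 0.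
Proof.
elim/last_ind: s2 s x => [|s2 z IH] s x Q hst luy hle Eu he hn W Ex.
  exact: (zigzag_vanish Q hst luy Eu he hn W Ex).
move: Q hst hn W Ex; rewrite -cats1 size_cat /= -!catA /= => Q hst hn W Ex.
have nluz : ~~ le_node u z by apply: hle; rewrite mem_rcons mem_head.
have /andP[_ /stdseq_cat /= /and3P[az au hs]] := hst.
have hst' := stdseq_swap (s2 := y :: s2) hst nluz.
have /andP[_ /stdseq_cat /= /and3P[_ az' _]] := hst'.
have nuz : u != z by apply: contraNneq nluz => ->; apply: le_node_refl.
have hn1 : (size s + size (y :: s2) + 2 <= n)%N by rewrite /=; arith.
have Z : x * intertwiner (size s).+1 = 0.
  apply: (IH (z :: s)) => //.
  - by move=> s' hs' /= h; apply: Q => //; arith.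
  - by move=> w ws; apply: hle; rewrite mem_rcons in_cons ws orbT.
  - by rewrite /=; arith.
  - exact: (weight_swap (s2 := y :: s2)).
  - move: Ex; rewrite /= !size_cat /= => Ex.
    by rewrite -mulrA intertwiner_comm ?mulrA ?Ex ?scalerAl //; arith.
have [E2 [E1 _]] : weight (z :: u :: s) x by apply: (weight_cat (s1 := y :: s2)).
have hr : (0 < (size s).+1 < n)%N by arith.
apply: (intertwiner_inj hr E1 E2 _ _ Z);
  by apply: addable_qint_neq1 (au) (az') _ _ => //; arith.
Qed.

Lemma weight_vanish_near s y x (e : int) :
  (forall s' : seq (node l n), stdseq s' -> (size s' <= size s)%N -> branching s') ->
  stdseq (y :: s) -> ((size s).+1 < n)%N -> (`|e| = 1)%N ->
  (exists u, [/\ u \in s, le_node u y, cont u = cont y + e &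
                 {in s, forall w, le_node u w -> w = u}]) ->
  weight (y :: s) x -> x * L (size s).+2 = [cont y + e] *: x -> x = 0.
Proof.
move=> Q hst hn he [u [us luy Eu Hu]].
case/splitPr: us Q hst hn Hu => s2 s1 Q hst hn Hu W Ex.
have := stdseq_uniq hst; rewrite /= cat_uniq /= => /andP[_ /and3P[_ /norP[nu _] _]].
apply: (separated_zigzag_vanish (e := e) _ hst) W Ex => //.
- by move=> s' hs' h; apply: Q => //; rewrite size_cat.
- move=> w ws; apply: contraNN nu => luw.
  by rewrite -(Hu w) ?mem_cat ?ws.
- by move: hn; rewrite size_cat /=; arith.
Qed.

End Weights.

(** * The branching rule *)

Section Neighbours.
Variables (l n : nat) (kappa : 'I_l -> int).
Local Notation cont := (content kappa).
Implicit Types (y z u w : node l n) (s : seq (node l n)).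

Definition gains_node s y (e : int) : Prop :=
  exists z, [/\ addable (y :: s) z, ~~ addable s z & cont z = cont y + e].

(** For e = 1 the node [u] is the one directly above [y], for e = - 1 the one to its left. Its
    maximality in [s] is what allows it to be moved to just before [y]. *)
Definition blocked_by s y (e : int) : Prop :=
  exists u, [/\ u \in s, le_node u y, cont u = cont y + e &
                {in s, forall w, le_node u w -> w = u}].

Lemma not_addable_ex s z : z \notin s -> ~~ addable s z ->
  exists w, [/\ le_node w z, w != z & w \notin s].
Proof.
move=> nz; rewrite /addable nz /= negb_forall => /existsP[w].
by rewrite negb_imply => /andP[/andP[h1 h2] h3]; exists w.
Qed.

(** If the right neighbour of [y] is not addable, some node above it in its column is missing. Then
    no node of [s] lies to the right of the node directly above [y], and none below it either
    because [y] is new. *)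
Lemma right_neighbour s y : stdseq (y :: s) -> ((size s).+1 < n)%N ->
  gains_node s y 1 \/ blocked_by s y 1.
Proof.
move=> hst hn; move: (hst) => /= /andP[ay hs].
have /addableP[nys Hy] := ay.
have ys : y \in y :: s by rewrite mem_head.
have hc : ((ncol y).+1 < n)%N by have := hook_bound hst ys ys erefl => /=; arith.
have [z [E1 E2 E3]] := node_exists y (nrow_lt y) hc.
have nzy : z != y by apply/eqP=> E; move: E3; rewrite E; arith.
have lyz : le_node y z by rewrite /le_node E1 E2 E3; arith.
have nzs : z \notin s.
  by apply: contra nys => zs; apply: stdseq_closed hs zs lyz.
have nzys : z \notin y :: s by rewrite in_cons negb_or nzy.
case: (boolP (addable (y :: s) z)) => [az|naz].
  left; exists z; split=> //.
    by apply: contra nys => /addableP[_]; apply=> //; rewrite eq_sym.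
  rewrite /content E2 E3 (ncompP E1); arith.
right; have [w [lwz nwz nws]] := not_addable_ex nzys naz.
move: nws; rewrite in_cons negb_or => /andP[nwy nws].
have nlwy : ~~ le_node w y by apply: contra nws => lwy; apply: Hy.
move: (lwz) nlwy; rewrite /le_node E1 E2 E3 => /and3P[/eqP E4 lr lc].
rewrite E4 eqxx lr /= -ltnNge => lc'.
have Ec : ncol w = (ncol y).+1 by arith.
have lr' : (nrow w < nrow y)%N.
  rewrite ltn_neqAle lr andbT; apply: contra nwz => /eqP E.
  by apply/eqP/node_eqP; rewrite ?E1 ?E2 ?E3.
have hr : (0 < nrow y)%N by arith.
have [u [us F1 F2 F3]] := row_nbr ay hr.
exists u; split=> //.
- by rewrite /le_node F1 F3; arith.
- rewrite /content F3 (ncompP F1); arith.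
move=> v vs /and3P[/eqP G1 G2 G3].
have nc : ~~ (ncol y < ncol v)%N.
  apply: contra nws => h; apply: stdseq_closed hs vs _.
  by rewrite /le_node E4 -G1 F1 eqxx; arith.
have nr : ~~ (nrow y <= nrow v)%N.
  apply: contra nys => h; apply: stdseq_closed hs vs _.
  by rewrite /le_node -G1 F1 eqxx; arith.
by apply: node_eqP => //; arith.
Qed.

Lemma lower_neighbour s y : stdseq (y :: s) -> ((size s).+1 < n)%N ->
  gains_node s y (- 1) \/ blocked_by s y (- 1).
Proof.
move=> hst hn; move: (hst) => /= /andP[ay hs].
have /addableP[nys Hy] := ay.
have ys : y \in y :: s by rewrite mem_head.
have hc : ((nrow y).+1 < n)%N by have := hook_bound hst ys ys erefl => /=; arith.
have [z [E1 E2 E3]] := node_exists y hc (ncol_lt y).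
have nzy : z != y by apply/eqP=> E; move: E2; rewrite E; arith.
have lyz : le_node y z by rewrite /le_node E1 E2 E3; arith.
have nzs : z \notin s.
  by apply: contra nys => zs; apply: stdseq_closed hs zs lyz.
have nzys : z \notin y :: s by rewrite in_cons negb_or nzy.
case: (boolP (addable (y :: s) z)) => [az|naz].
  left; exists z; split=> //.
    by apply: contra nys => /addableP[_]; apply=> //; rewrite eq_sym.
  rewrite /content E2 E3 (ncompP E1); arith.
right; have [w [lwz nwz nws]] := not_addable_ex nzys naz.
move: nws; rewrite in_cons negb_or => /andP[nwy nws].
have nlwy : ~~ le_node w y by apply: contra nws => lwy; apply: Hy.
move: (lwz) nlwy; rewrite /le_node E1 E2 E3 => /and3P[/eqP E4 lr lc].
rewrite E4 eqxx lc /= andbT -ltnNge => lr'.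
have Ec : nrow w = (nrow y).+1 by arith.
have lc' : (ncol w < ncol y)%N.
  rewrite ltn_neqAle lc andbT; apply: contra nwz => /eqP E.
  by apply/eqP/node_eqP; rewrite ?E1 ?E2 ?E3.
have hr : (0 < ncol y)%N by arith.
have [u [us F1 F2 F3]] := col_nbr ay hr.
exists u; split=> //.
- by rewrite /le_node F1 F2; arith.
- rewrite /content F2 (ncompP F1); arith.
move=> v vs /and3P[/eqP G1 G2 G3].
have nc : ~~ (nrow y < nrow v)%N.
  apply: contra nws => h; apply: stdseq_closed hs vs _.
  by rewrite /le_node E4 -G1 F1 eqxx; arith.
have nr : ~~ (ncol y <= ncol v)%N.
  apply: contra nys => h; apply: stdseq_closed hs vs _.
  by rewrite /le_node -G1 F1 eqxx; arith.
by apply: node_eqP => //; arith.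
Qed.

End Neighbours.

Section Branching.
Variables (K : fieldType) (q : K) (l n : nat) (kappa : 'I_l -> int).
Variables (A : algType K) (L T : nat -> A).
Hypotheses (q0 : q != 0) (sep : separates q n kappa).
Hypothesis hrel : hecke_rel q n kappa L T.
Local Notation "[ d ]" := (qint q d) (format "[ d ]").
Local Notation cont := (content kappa).
Local Notation weight := (weight q kappa L).
Local Notation addpoly := (addpoly q kappa).

Lemma branching_nil : (0 < n)%N -> branching q kappa L (@nil (node l n)).
Proof.
move=> hn x _; rewrite /=.
case: hrel => /(_ hn) H _.
suff -> : horner_alg (L 1%N) (addpoly (@nil (node l n))) = \prod_(i < l) (L 1%N - [kappa i]%:A).
  by rewrite H mulr0.
have az z : addable (@nil (node l n)) z = ((nrow z == 0) && (ncol z == 0))%N.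
  apply/addableP/andP => [[_ Hz]|[/eqP z1 /eqP z2]]; last first.
    split=> // y /and3P[/eqP a b c] /eqP[]; apply: node_eqP => //; arith.
  have [w [E1 E2 E3]] := node_exists z hn hn.
  have [<-|nwz] := eqVneq w z; first by rewrite E2 E3.
  by have := Hz w; rewrite /le_node E1 E2 E3 eqxx /= in_nil => /(_ isT nwz).
have -> : addpoly (@nil (node l n)) = \prod_(i < l) ('X - [kappa i]%:P).
  rewrite /addpoly (reindex_onto (fun i : 'I_l => (i, Ordinal hn, Ordinal hn) : node l n)
    (fun z : node l n => z.1.1)) /=.
    apply: eq_big => [i|i _]; first by rewrite az !eqxx.
    by rewrite /content /= subr0 addr0.
  move=> z; rewrite az => /andP[/eqP z1 /eqP z2].
  by apply: node_eqP; rewrite ?z1 ?z2.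
rewrite (big_morph (horner_alg (L 1%N)) (rmorphM _) (rmorph1 _)).
by apply: eq_bigr => i _; rewrite horner_algXsubC.
Qed.

(** With r = size s + 1, the intertwiner carries L_(r+1) to L_r and keeps the weight [s], so it
    turns x times [addpoly s] at L_(r+1) into a vector killed by the hypothesis on [s]. Applying it
    once more leaves its square, a quadratic in L_(r+1) with roots [c + 1] and [c - 1]. *)
Lemma branching_factor (s : seq (node l n)) y x : stdseq (y :: s) -> branching q kappa L s ->
  ((size s).+1 < n)%N -> weight (y :: s) x ->
  x * horner_alg (L (size s).+2)
    (addpoly s * ('X - [cont y + 1]%:P) * ('X - [cont y - 1]%:P)) = 0.
Proof.
move=> hst Q hn [E W]; set r := (size s).+1 in hn E *.
have hr : (0 < r < n)%N by [].
pose X := x * horner_alg (L r.+1) (addpoly s).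
have XE : X * L r = [cont y] *: X.
  rewrite /X -mulrA (horner_alg_intertwine (F := L r) (C := L r.+1)).
    by rewrite mulrA E scalerAl.
  by apply: (LL_comm hrel); arith.
have X0 : X * (intertwiner q L T r * intertwiner q L T r) = 0.
  rewrite /X mulrA -[x * _ * _]mulrA (horner_alg_intertwine (C := L r)).
    by rewrite mulrA Q ?mul0r //; apply: weight_intertwiner => //; rewrite /r leqnn.
  by rewrite (intertwiner_L hrel hr).
have E1 : [cont y] = q * [cont y - 1] + 1 by rewrite -qintS // subrK.
have Y : X * (L r.+1 - [cont y + 1] *: 1) * (L r.+1 - [cont y - 1] *: 1) = 0.
  apply: (scalerI q0); rewrite scaler0 -oppr0 -X0 (intertwiner_sqr q0 hrel hr).
  have C : L r.+1 * L r = L r * L r.+1 by apply: (LL_comm hrel); arith.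
  rewrite !alg_simp -![X * L r.+1 * L r]mulrA C !mulrA !(XE, alg_simp) qintS // !E1.
  by lincomb K; ring.
by rewrite !rmorphM /= !horner_algXsubC !mulrA.
Qed.

Lemma branching_cons (s : seq (node l n)) y :
  (forall s' : seq (node l n), stdseq s' -> (size s' <= size s)%N -> branching q kappa L s') ->
  stdseq (y :: s) -> ((size s).+1 < n)%N -> branching q kappa L (y :: s).
Proof.
move=> Q hst hn x W.
have Hbad e : (`|e| = 1)%N -> blocked_by kappa s y e -> forall w, weight (y :: s) w ->
    w * L (size s).+2 = [cont y + e] *: w -> w = 0.
  by move=> he bl w Ww Ew; apply: (weight_vanish_near q0 hrel sep Q hst hn he bl Ww Ew).
have Hrep w : weight (y :: s) w -> w * L (size s).+2 = [cont y] *: w -> w = 0.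
  apply: (repeated_content_vanish q0 hrel sep hst _ hn).
  by apply: Q => //; case/andP: hst.
pose new := \prod_(z | addable (y :: s) z && ~~ addable s z) ('X - [cont z]%:P) : {poly K}.
have /andP[ay hs] : addable s y && stdseq s := hst.
(* Adding [y] deletes its own content and contributes the nodes that only now become addable. *)
have splitA : addpoly (y :: s) * ('X - [cont y]%:P) = addpoly s * new.
  rewrite /addpoly (bigID (addable s)) /= -/new mulrAC; congr (_ * _).
  rewrite [RHS](bigD1 y) //= mulrC; congr (_ * _); apply: eq_bigl => z.
  have [az|] := boolP (addable s z); last by rewrite andbF.
  rewrite andbT; have [->|nzy] := eqVneq z y.
    by rewrite /addable mem_head.
  by rewrite addable_cons // eq_sym.
(* [bs] collects those of the two adjacent contents that belong to no new node and are no eigenvalue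
   either; [m] is the cofactor left over. *)
suff [bs [m [Hbs E]]] : exists bs m,
    (forall b, b \in bs -> forall w, weight (y :: s) w ->
       w * L (size s).+2 = b *: w -> w = 0) /\
    new * \prod_(b <- bs) ('X - b%:P) =
    ('X - [cont y + 1]%:P) * ('X - [cont y - 1]%:P) * m.
  apply: (remove_factors (W := weight (y :: s)) (bs := [cont y] :: bs)) => //.
  - by move=> w p; apply: (weight_horner hrel) => /=; arith.
  - move=> w b; rewrite in_cons => /predU1P[->|/Hbs H] Ww; first exact: Hrep.
    exact: H.
  rewrite big_cons mulrA splitA -mulrA E !mulrA.
  rewrite rmorphM /= mulrA branching_factor ?mul0r //.
  by apply: Q.
case: (right_neighbour kappa hst hn) => [[z1 [a1 b1 c1]]|bl1];
case: (lower_neighbour kappa hst hn) => [[z2 [a2 b2 c2]]|bl2].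
- exists (@nil K), (\prod_(z | [&& addable (y :: s) z, ~~ addable s z & (z != z1) && (z != z2)])
      ('X - [cont z]%:P)); split=> //.
  rewrite big_nil mulr1 /new (bigD1 z1) /= ?a1 // (bigD1 z2) /=; last first.
    by rewrite a2 b2; apply/eqP=> E; move: c1 c2; rewrite E; arith.
  rewrite mulrA c1 c2; congr (_ * _); apply: eq_bigl => z.
  by rewrite -!andbA.
- exists [:: [cont y - 1]], (\prod_(z | (addable (y :: s) z && ~~ addable s z) && (z != z1))
      ('X - [cont z]%:P)); split.
    by move=> b; rewrite inE => /eqP-> w; apply: Hbad.
  by rewrite big_seq1 /new (bigD1 z1) /= ?a1 // c1 mulrAC.
- exists [:: [cont y + 1]], (\prod_(z | (addable (y :: s) z && ~~ addable s z) && (z != z2))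
      ('X - [cont z]%:P)); split.
    by move=> b; rewrite inE => /eqP-> w; apply: Hbad.
  by rewrite big_seq1 /new (bigD1 z2) /= ?a2 // c2 mulrC mulrA.
exists [:: [cont y + 1]; [cont y - 1]], new; split.
  by move=> b; rewrite !inE => /orP[] /eqP-> w; apply: Hbad.
by rewrite !big_cons big_nil mulr1 mulrC.
Qed.

Lemma branchingP (s : seq (node l n)) : stdseq s -> (size s < n)%N -> branching q kappa L s.
Proof.
move: {2}(size s) (leqnn (size s)) => m; elim: m s => [|m IH] [|y s] //= hm hst hn.
- exact: branching_nil.
- exact: branching_nil.
apply: branching_cons => // s' hs' h; apply: IH => //; arith.
Qed.

(** The decomposition of [A] into joint eigenspaces of L_1, ..., L_k, as an induction principle for
    additive predicates. *)
Lemma weight_decomposition (k : nat) (P : A -> Prop) : (k <= n)%N ->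
  P 0 -> (forall x y, P x -> P y -> P (x + y)) ->
  (forall (s : seq (node l n)) x, stdseq s -> size s = k -> weight s x -> P x) ->
  forall x, P x.
Proof.
move=> hk P0 PD; elim: k hk => [_ H x|k IH hk H]; first exact: (H [::]).
apply: IH; first exact: ltnW.
move=> s x hs szs W; have hn : (size s < n)%N by rewrite szs.
pose bs := [seq [cont z] | z <- enum (addable s)].
have Ebs : addpoly s = \prod_(b <- bs) ('X - b%:P).
  by rewrite big_map big_enum.
apply: (@eigen_decomposition K A (weight s) P (L (size s).+1) bs) => //.
- exact: weightD.
- exact: weightZ.
- by move=> y p; apply: (weight_horner hrel); rewrite leqnn.
- move=> y b /mapP[z]; rewrite mem_enum => az -> Wy E.
  by apply: (H (z :: s)) => //=; rewrite ?szs // hs andbT.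
- rewrite map_inj_in_uniq ?enum_uniq // => u z; rewrite !mem_enum => au az.
  by apply: contra_eq => nuz; apply: addable_qint_neq0 au az nuz hn.
by rewrite -Ebs; apply: branchingP.
Qed.

End Branching.

(** * Standard tableaux *)

Section TableauxAsSequences.
Variables (l n : nat).
Implicit Types (t u : tab l n) (x y z : node l n).

Fixpoint entries t (k : nat) : seq (node l n) :=
  if k is k'.+1 then
    if insub k' is Some i then t i :: entries t k' else entries t k'
  else [::].

Lemma entriesS t (i : 'I_n) : entries t i.+1 = t i :: entries t i.
Proof. by rewrite /= valK. Qed.

Lemma entriesSn t k (hk : (k < n)%N) : entries t k.+1 = t (Ordinal hk) :: entries t k.
Proof. exact: (entriesS t (Ordinal hk)). Qed.

Lemma size_entries t k : (k <= n)%N -> size (entries t k) = k.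
Proof. by elim: k => // k IH hk; rewrite entriesSn /= IH // ltnW. Qed.

Lemma mem_entries t k x :
  reflect (exists i : 'I_n, (i < k)%N /\ t i = x) (x \in entries t k).
Proof.
apply: (iffP idP) => [|[i [hi <-]]].
  elim: k => //= k IH; case: insubP => [i _ hi|_] //=.
    rewrite in_cons => /predU1P[->|/IH [j [hj <-]]].
      by exists i; rewrite -hi.
    by exists j; rewrite ltnW.
  by move/IH => [j [hj <-]]; exists j; rewrite ltnW.
elim: k hi => // k IH; rewrite ltnS leq_eqVlt => /predU1P[<-|/IH]; first by rewrite entriesS mem_head.
by rewrite /=; case: insubP => // j _ _ h; rewrite in_cons h orbT.
Qed.

Lemma entries_suffix t k m : (k <= m)%N -> exists s, entries t m = s ++ entries t k.
Proof.
elim: m => [|m IH]; first by rewrite leqn0 => /eqP->; exists [::].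
rewrite leq_eqVlt => /predU1P[->|]; first by exists [::].
rewrite ltnS => /IH [s Es] /=; case: insubP => [i _ _|_]; last by exists s.
by exists (t i :: s); rewrite Es.
Qed.

Lemma std_inj t i j : std t -> t i = t j -> i = j.
Proof. by case/andP => /injectiveP H _; apply: H. Qed.

(** [std] asks only for the two immediate neighbours; following them downwards reaches every smaller
    node. *)
Lemma std_closed t (k : 'I_n) y : std t -> le_node y (t k) -> y != t k ->
  y \in entries t k.
Proof.
case/andP => /injectiveP inj /forallP H.
move: {2}(k : nat) (leqnn k) => m; elim: m k => [|m IH] k hk lyk nyk.
  have := H k; case/andP => /orP[/eqP r0|/existsP[j /andP[hj _]]]; last by move: hj hk; clear; lia.
  case/orP => [/eqP c0|/existsP[j /andP[hj _]]]; last by move: hj hk; clear; lia.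
  case/and3P: lyk => /eqP E1 E2 E3; case/eqP: nyk.
  by apply: node_eqP => //; arith.
have sub (j : 'I_n) : (j < k)%N -> le_node y (t j) -> y \in entries t k.
  move=> hj lyj; have [->|nyj] := eqVneq y (t j); first by apply/mem_entries; exists j.
  have /mem_entries[i [hi <-]] : y \in entries t j by apply: IH => //; arith.
  by apply/mem_entries; exists i; rewrite (ltn_trans hi hj).
have /andP[Hr Hc] := H k; case/and3P: lyk => /eqP E1 E2 E3.
have [lt_r|ge_r] := ltnP (nrow y) (nrow (t k)).
  case/orP: Hr => [/eqP|/existsP[j /and4P[hj /eqP F1 /eqP F2 /eqP F3]]]; first by arith.
  by apply: (sub j hj); rewrite /le_node F1 F2 F3 E1 eqxx; arith.
have [lt_c|ge_c] := ltnP (ncol y) (ncol (t k)).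
  case/orP: Hc => [/eqP|/existsP[j /and4P[hj /eqP F1 /eqP F2 /eqP F3]]]; first by arith.
  by apply: (sub j hj); rewrite /le_node F1 F2 F3 E1 eqxx; arith.
by case/eqP: nyk; apply: node_eqP => //; arith.
Qed.

Lemma std_addable t (k : 'I_n) : std t -> addable (entries t k) (t k).
Proof.
move=> st; apply/addableP; split; last by move=> y; apply: std_closed.
by apply/mem_entries=> -[i [hi /(std_inj st) E]]; rewrite E ltnn in hi.
Qed.

Lemma std_stdseq t k : std t -> (k <= n)%N -> stdseq (entries t k).
Proof.
move=> st; elim: k => // k IH hk; rewrite entriesSn /= IH ?(ltnW hk) // andbT.
exact: (std_addable (Ordinal hk)).
Qed.

Lemma stdseq_std t : stdseq (entries t n) -> std t.
Proof.
move=> H; have Hk (k : 'I_n) : addable (entries t k) (t k).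
  have [s E] := entries_suffix t (ltn_ord k).
  by move: H; rewrite E => /stdseq_cat; rewrite entriesS => /andP[].
apply/andP; split.
  have Hlt (i j : 'I_n) : (i < j)%N -> t i <> t j.
    move=> hij E; case/addableP: (Hk j) => /negP[].
    by apply/mem_entries; exists i.
  apply/injectiveP => i j E; apply: val_inj => /=.
  by case: (ltngtP i j) => // [/Hlt|/Hlt/nesym].
apply/forallP => k; apply/andP; split.
  have [//|r0] := eqVneq (nrow (t k)) 0%N; apply/existsP.
  have [|w [/mem_entries[j [hj <-]] E1 E2 E3]] := row_nbr (Hk k); first by rewrite lt0n.
  by exists j; rewrite hj E1 E2 E3 !eqxx.
have [//|r0] := eqVneq (ncol (t k)) 0%N; apply/existsP.
have [|w [/mem_entries[j [hj <-]] E1 E2 E3]] := col_nbr (Hk k); first by rewrite lt0n.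
by exists j; rewrite hj E1 E2 E3 !eqxx.
Qed.

Lemma stdseq_entries (s : seq (node l n)) : stdseq s -> size s = n ->
  exists2 t, std t & entries t n = s.
Proof.
move=> hs szs.
(* The list has the last entry first, hence the reversal of indices. *)
pose t : tab l n := [ffun i => tnth (in_tuple s) (cast_ord (esym szs) (rev_ord i))].
have E k : (k <= n)%N -> entries t k = drop (n - k) s.
  elim: k => [_|k IH hk]; first by rewrite subn0 drop_oversize ?szs.
  rewrite entriesSn IH 1?ltnW // ffunE.
  rewrite (tnth_nth (t (Ordinal hk))) /=.
  rewrite [RHS](drop_nth (t (Ordinal hk))) ?szs; last by clear -hk; lia.
  by rewrite -(subSn hk) subSS.
have En : entries t n = s by rewrite E // subnn drop0.
by exists t => //; apply: stdseq_std; rewrite En.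
Qed.

Section Swap.
Variable r : nat.
Hypothesis hr : (0 < r < n)%N.

Lemma swap_lt0 : (r.-1 < n)%N. Proof. by case/andP: hr; arith. Qed.
Lemma swap_lt1 : (r < n)%N. Proof. by case/andP: hr. Qed.
Definition swap0 := Ordinal swap_lt0.
Definition swap1 := Ordinal swap_lt1.

Lemma swpL : swp r swap0 = swap1.
Proof. by apply: val_inj; rewrite /swp eqxx val_insubd swap_lt1. Qed.

Lemma swpR : swp r swap1 = swap0.
Proof.
apply: val_inj; rewrite /swp /=; case: eqP => [E|_].
  by case/andP: hr => h _; move: E h; clear; lia.
by rewrite eqxx val_insubd swap_lt0.
Qed.

Lemma swpN i : i != swap0 -> i != swap1 -> swp r i = i.
Proof. by rewrite -!val_eqE /swp /= => /negPf-> /negPf->. Qed.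

Lemma swpK : involutive (swp r : 'I_n -> 'I_n).
Proof.
move=> i; have [->|n0] := eqVneq i swap0; first by rewrite swpL swpR.
have [->|n1] := eqVneq i swap1; first by rewrite swpR swpL.
by rewrite !swpN.
Qed.

Lemma tswapL t : tswap t r swap0 = t swap1. Proof. by rewrite ffunE swpL. Qed.
Lemma tswapR t : tswap t r swap1 = t swap0. Proof. by rewrite ffunE swpR. Qed.
Lemma tswapN t i : i != swap0 -> i != swap1 -> tswap t r i = t i.
Proof. by move=> n0 n1; rewrite ffunE swpN. Qed.
Lemma tswapK t : tswap (tswap t r) r = t.
Proof. by apply/ffunP => i; rewrite !ffunE swpK. Qed.

Lemma tshape_tswap t : tshape (tswap t r) = tshape t.
Proof.
apply/setP => x; rewrite !inE; apply/codomP/codomP => [[i ->]|[i ->]].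
  by exists (swp r i); rewrite ffunE.
by exists (swp r i); rewrite ffunE swpK.
Qed.

Lemma entries_tswap_lt t k : (k < r)%N -> entries (tswap t r) k = entries t k.
Proof.
elim: k => //= k IH hk; rewrite IH; last by apply: ltnW.
case: insubP => // i _ Ei; rewrite tswapN // -val_eqE /= Ei.
  by move: hk; clear; lia.
by move: hk; clear; lia.
Qed.

Lemma entries_two t : entries t r.+1 = [:: t swap1, t swap0 & entries t r.-1].
Proof.
rewrite (entriesS t swap1) /=; congr (_ :: _).
case/andP: hr => r0 _; rewrite -{1}(prednK r0).
exact: (entriesS t swap0).
Qed.

Lemma entries_tswap_split t k : (r < k <= n)%N -> exists s,
  entries t k = s ++ [:: t swap1, t swap0 & entries t r.-1] /\
  entries (tswap t r) k = s ++ [:: t swap0, t swap1 & entries t r.-1].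
Proof.
elim: k => // k IH /andP[]; rewrite ltnS leq_eqVlt => /predU1P[<- hk|hrk hk].
  exists [::]; rewrite !entries_two tswapL tswapR entries_tswap_lt //.
  by case/andP: hr => h _; move: h; clear; lia.
have [|s [E1 E2]] := IH; first by rewrite hrk ltnW.
exists (t (Ordinal hk) :: s); rewrite !entriesSn E1 E2; split=> //=.
by rewrite tswapN // -val_eqE /=; move: hrk; clear; lia.
Qed.

Lemma std_tswap t : std t -> std (tswap t r) = ~~ le_node (t swap0) (t swap1).
Proof.
move=> st; have hrn : (r < n <= n)%N by rewrite swap_lt1 leqnn.
have [s [E1 E2]] := entries_tswap_split t hrn.
have st' := std_stdseq st (leqnn n).
apply/idP/idP => [sv|nle].
  have := std_stdseq sv (leqnn n); rewrite E2 => /stdseq_cat /= /and3P[_ a1 _].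
  case/addableP: a1 => _ H; apply/negP => /H.
  have n01 : t swap0 != t swap1.
    by apply/eqP => /(std_inj st) /(congr1 val) /=; case/andP: hr; clear; lia.
  move=> /(_ n01) h; have := std_addable swap0 st; case/addableP.
  by rewrite /= h.
by apply: stdseq_std; rewrite E2; apply: stdseq_swap => //; rewrite -E1.
Qed.

End Swap.

(** * Contents along a standard tableau *)

Section Contents.
Variable kappa : 'I_l -> int.
Local Notation cont := (content kappa).
Local Notation ct := (ct kappa).
Local Notation rho := (rho kappa).

Lemma ctS t (i : 'I_n) : ct t i.+1 = cont (t i).
Proof. by rewrite /Defs.ct /= valK. Qed.

Lemma ctSn t k (hk : (k < n)%N) : ct t k.+1 = cont (t (Ordinal hk)).
Proof. exact: (ctS t (Ordinal hk)). Qed.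

Section SwapContents.
Variable r : nat.
Hypothesis hr : (0 < r < n)%N.

Lemma ct_swap0 t : ct t r = cont (t (swap0 hr)).
Proof. by rewrite -ctS /=; case/andP: hr => h _; rewrite prednK. Qed.

Lemma ct_swap1 t : ct t r.+1 = cont (t (swap1 hr)).
Proof. by rewrite -ctS. Qed.

Lemma ct_tswapL t : ct (tswap t r) r = ct t r.+1.
Proof. by rewrite ct_swap0 tswapL ct_swap1. Qed.

Lemma ct_tswapR t : ct (tswap t r) r.+1 = ct t r.
Proof. by rewrite ct_swap1 tswapR ct_swap0. Qed.

Lemma ct_tswapN t k : (0 < k <= n)%N -> k != r -> k != r.+1 ->
  ct (tswap t r) k = ct t k.
Proof.
case: k => // k hk n0 n1; rewrite !(ctSn _ hk) tswapN // -val_eqE /=.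
by case/andP: hr; move: n0; clear; lia.
Qed.

Lemma rho_tswap t : rho (tswap t r) r = - rho t r.
Proof. by rewrite /Defs.rho ct_tswapL ct_tswapR opprB. Qed.

(** If the swap fails, r + 1 occupies a node that becomes addable only after that of r, so the two
    are neighbours in a row or a column. *)
Lemma not_std_tswap_ct t : std t -> ~~ std (tswap t r) ->
  exists2 e : int, (`|e| = 1)%N & ct t r.+1 = ct t r + e.
Proof.
move=> st; rewrite (std_tswap hr) // negbK ct_swap0 ct_swap1 => lle.
have hrn : (r.+1 <= n)%N by case/andP: hr.
have := std_stdseq st hrn; rewrite (entries_two hr) => hst.
have /and3P[a1 a0 hs] := hst.
have na1 : ~~ addable (entries t r.-1) (t (swap1 hr)).
  apply/negP => /addableP[_ H]; have h := H _ lle.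
  have : t (swap0 hr) != t (swap1 hr).
    by apply/eqP => /(std_inj st) /(congr1 val) /=; case/andP: hr; clear; lia.
  by move/h; case/addableP: a0 => /negPf->.
have hst' : stdseq (t (swap0 hr) :: entries t r.-1) by apply/andP.
have [E1 [[E2 E3]|[E2 E3]]] := addable_new hst' a1 na1.
  exists 1; first by [].
  by rewrite /content (ncompP E1) E2 E3; clear; lia.
exists (- 1); first by [].
by rewrite /content (ncompP E1) E2 E3; clear; lia.
Qed.

Lemma std_tswap_addable t : std t -> std (tswap t r) ->
  [/\ stdseq (entries t r.-1), size (entries t r.-1) = r.-1,
      addable (entries t r.-1) (t (swap0 hr)),
      addable (entries t r.-1) (t (swap1 hr)) & t (swap0 hr) != t (swap1 hr)].
Proof.
move=> st sv; have h : (r.-1 <= n)%N by case/andP: hr; clear; lia.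
split; [exact: std_stdseq|exact: size_entries|exact: (std_addable (swap0 hr))| |].
  have := std_addable (swap0 hr) sv; rewrite tswapL /= entries_tswap_lt //.
  by case/andP: hr; clear; lia.
by apply/eqP => /(std_inj st) /(congr1 val) /=; case/andP: hr; clear; lia.
Qed.

End SwapContents.

(** If [z] were further down the diagonal of [x], the right and the lower neighbour of [x] would
    both have to be entered between them, and [y] cannot be both. *)
Lemma content_two_apart (s : seq (node l n)) x y z : stdseq [:: z, y, x & s] ->
  ncomp x = ncomp z -> cont x != cont z.
Proof.
move=> hst E; have := stdseq_uniq hst.
move: (hst) => /= /and4P[az ay ax hs] /and4P[nz _ nxs _].
apply/eqP; rewrite /content (ncompP E) => Ec.
have nxz : x != z by apply: contraNneq nz => <-; rewrite !inE eqxx orbT.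
have [lt_r|ge_r] := ltnP (nrow x) (nrow z); last first.
  case/addableP: ax => _ /(_ z); rewrite eq_sym => H.
  move: nz; rewrite !inE H ?orbT //.
  by rewrite /le_node E eqxx; move: ge_r Ec; clear; lia.
have lt_c : (ncol x < ncol z)%N by move: lt_r Ec; clear; lia.
have hr' : ((nrow x).+1 < n)%N by apply: leq_ltn_trans lt_r (nrow_lt z).
have hc' : ((ncol x).+1 < n)%N by apply: leq_ltn_trans lt_c (ncol_lt z).
have sub w : le_node x w -> x != w -> le_node w z -> w != z -> w = y.
  move=> lxw nxw lwz nwz; case/addableP: az => _ /(_ w lwz nwz).
  rewrite !inE => /or3P[/eqP//|/eqP E'|ws]; first by rewrite E' eqxx in nxw.
  by rewrite (stdseq_closed hs ws lxw) in nxs.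
have [w1 [a1 b1 c1]] := node_exists x hr' (ncol_lt x).
have [w2 [a2 b2 c2]] := node_exists x (nrow_lt x) hc'.
have E1 : w1 = y.
  apply: sub; rewrite ?/le_node ?a1 ?b1 ?c1 ?E ?eqxx ?leqnn ?leqnSn ?lt_r ?(ltnW lt_c) //.
    by apply/eqP=> F; move: b1; rewrite F; clear; lia.
  by apply/eqP=> F; move: c1 lt_c; rewrite F; clear; lia.
have E2 : w2 = y.
  apply: sub; rewrite ?/le_node ?a2 ?b2 ?c2 ?E ?eqxx ?leqnn ?leqnSn ?lt_c ?(ltnW lt_r) //.
    by apply/eqP=> F; move: c2; rewrite F; clear; lia.
  by apply/eqP=> F; move: b2 lt_r; rewrite F; clear; lia.
by move: b1 b2; rewrite E1 E2; clear; lia.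
Qed.

Variables (K : fieldType) (q : K).
Hypotheses (q0 : q != 0) (sep : separates q n kappa).
Local Notation "[ d ]" := (qint q d) (format "[ d ]").

Lemma qct_two_apart t r : std t -> (0 < r)%N -> (r.+1 < n)%N ->
  [ct t r] != [ct t r.+2].
Proof.
move=> st r0 hn; have hr : (0 < r < n)%N by rewrite r0 ltnW.
have hst : stdseq (entries t r.+2) by apply: std_stdseq.
have E : entries t r.+2 = [:: t (Ordinal hn), t (swap1 hr), t (swap0 hr) & entries t r.-1].
  by rewrite entriesSn (entries_two hr).
rewrite (ct_swap0 hr) (ctSn t hn) qint_eq // -[_ - _]addr0.
apply: (qint_content_neq0 q0 sep hst); rewrite ?E ?inE ?eqxx ?orbT //.
  by rewrite -E size_entries // addn0 ltnW.
move=> Ecomp; rewrite addr0 subr_eq0; apply: (content_two_apart (s := entries t r.-1) (y := t (swap1 hr))) Ecomp.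
by rewrite -E; exact: hst.
Qed.

Lemma qct_tswap_neq t r (hr : (0 < r < n)%N) : std t -> std (tswap t r) ->
  [/\ [ct t r] != [ct t r.+1], [ct t r + 1] != [ct t r.+1] & [ct t r - 1] != [ct t r.+1]].
Proof.
move=> st sv; have [hs sz a0 a1 n01] := std_tswap_addable hr st sv.
rewrite (ct_swap0 hr) (ct_swap1 hr).
have sz0 : (size (entries t r.-1) < n)%N by rewrite sz; case/andP: (hr); clear; lia.
have sz1 : (size (entries t r.-1) + 1 < n)%N by rewrite sz; case/andP: (hr); clear; lia.
by split; [apply: addable_qint_neq0 a0 a1 _ _|apply: addable_qint_neq1 a0 a1 _ _..].
Qed.

Lemma qct_neq t r (hr : (0 < r < n)%N) : std t -> [ct t r] != [ct t r.+1].
Proof.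
move=> st; have [sv|nsv] := boolP (std (tswap t r)).
  by case: (qct_tswap_neq hr st sv).
have [e he ->] := not_std_tswap_ct hr st nsv.
have E : ct t r - (ct t r + e) = - e by clear; lia.
by rewrite qint_eq // E; apply: qint_pm_neq0 => //; move: he; clear; lia.
Qed.

(** Before the first difference the two tableaux agree, and there they occupy distinct addable nodes
    of one diagram. *)
Lemma std_separated t u : std t -> std u -> t != u ->
  exists2 k, (0 < k <= n)%N & [ct t k] != [ct u k].
Proof.
move=> st su ntu.
have [/existsP[k nk]|] := boolP [exists k : 'I_n, [cont (t k)] != [cont (u k)]].
  by exists k.+1; rewrite ?ltn_ord // !ctS.
rewrite negb_exists => /forallP H; case/eqP: ntu; apply/ffunP => i.
have Hk k (hk : (k < n)%N) : [cont (t (Ordinal hk))] == [cont (u (Ordinal hk))].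
  by rewrite -[_ == _]negbK.
have E k : (k <= n)%N -> entries t k = entries u k.
  elim: k => // k IH hk; have {}IH := IH (ltnW hk).
  rewrite !entriesSn IH; congr (_ :: _).
  apply/eqP; apply: contraTT (Hk k hk) => nti.
  apply: (addable_qint_neq0 q0 sep (std_stdseq st (ltnW hk))) nti _.
  - exact: (std_addable (Ordinal hk)).
  - by rewrite IH; apply: (std_addable (Ordinal hk)).
  - by rewrite size_entries // ltnW.
by have := E _ (ltn_ord i); rewrite !entriesS => -[].
Qed.

End Contents.
End TableauxAsSequences.

(** * Steps between tableaux and the idempotents F_t *)

Section StepScalars.
Variables (K : fieldType) (q : K).
Hypothesis q0 : q != 0.
Local Notation "[ d ]" := (qint q d) (format "[ d ]").

Lemma qpowD a b : qpow q (a + b) = qpow q a * qpow q b.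
Proof. by rewrite {1}/qpow qintD // /qpow; ring. Qed.

Lemma qpowN d : qpow q (- d) = (qpow q d)^-1.
Proof.
apply: (mulfI (qpow_neq0 q0 d)); rewrite -qpowD subrr divff ?qpow_neq0 //.
by rewrite /qpow qint0 mulr0 addr0.
Qed.

(** At d = rho_r(t) this is the scalar of a step followed by its reverse, and also the prescribed
    product alpha_r(t) alpha_r(v), since rho_r(v) = - rho_r(t). *)
Definition step_norm (d : int) : K := [1 + d] * [1 - d] / ([d] * [- d]).

Lemma step_normE d : [d] != 0 -> step_norm d = q - qpow q d / [d] ^+ 2.
Proof.
move=> d0; have := qpow_neq0 q0 d; rewrite /step_norm.
rewrite [1 + d]addrC [1 - d]addrC !qintS // qintN // qpowN /qpow => h.
by field; rewrite ?oppr_eq0 ?d0 ?h.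
Qed.

Lemma invN_qint d : [d] != 0 -> [- d]^-1 = 1 - q - [d]^-1.
Proof.
move=> d0; have := qpow_neq0 q0 d; rewrite qintN // qpowN /qpow => h.
by field; rewrite ?oppr_eq0 ?d0 ?h.
Qed.

Lemma step_norm_adjacent (d : int) : (`|d| = 1)%N -> step_norm d = 0.
Proof.
move=> hd; rewrite /step_norm; have [->|->] : d = 1 \/ d = - 1 by clear -hd; lia.
  by rewrite subrr qint0 mulr0 mul0r.
by rewrite subrr qint0 !mul0r.
Qed.

(** The three scalar hypotheses of [braid_hexagon]. The addition formula expresses [c1 - c3] by
    [c1 - c2], [c2 - c3] and q, and the claims become rational identities. *)
Lemma step_norm_braid (c1 c2 c3 : int) :
  [c1] != [c2] -> [c2] != [c3] -> [c1] != [c3] ->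
  let d a b := - [a - b]^-1 in
  [/\ d c1 c3 * d c2 c1 + d c1 c2 * d c2 c3 = d c2 c3 * d c1 c3,
      d c1 c3 * d c3 c2 + d c2 c3 * d c1 c2 = d c1 c2 * d c1 c3 &
      d c1 c2 ^+ 2 * d c2 c3 + step_norm (c1 - c2) * d c1 c3 =
      d c2 c3 ^+ 2 * d c1 c2 + step_norm (c2 - c3) * d c1 c3].
Proof.
move=> n12 n23 n13 d.
have s12 : [c1 - c2] != 0 by rewrite -qint_eq.
have s23 : [c2 - c3] != 0 by rewrite -qint_eq.
have s13 : [c1 - c3] != 0 by rewrite -qint_eq.
rewrite !step_normE // /d.
have -> : c2 - c1 = - (c1 - c2) by rewrite opprB.
have -> : c3 - c2 = - (c2 - c3) by rewrite opprB.
rewrite !invN_qint //.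
have E : [c1 - c3] = [c1 - c2] + qpow q (c1 - c2) * [c2 - c3].
  by rewrite -qintD // addrA subrK.
rewrite E /qpow in s13 *.
by split; field; rewrite ?s12 ?s23 ?s13.
Qed.

(* Both directions of the braid relation: it holds on [x] exactly when the two paths around the hexagon through [x] end in the same vector. *)
Lemma braid_hexagon (W : lmodType K) (T1 T2 : W -> W) (a a' b b' c m1 m2 : K)
    (x x1 x2 x12 x21 x121 x212 : W) :
  linear T1 -> linear T2 ->
  T1 x = x1 + a *: x -> T2 x = x2 + b *: x ->
  T1 x1 = m1 *: x + a' *: x1 -> T2 x2 = m2 *: x + b' *: x2 ->
  T2 x1 = x12 + c *: x1 -> T1 x2 = x21 + c *: x2 ->
  T1 x12 = x121 + b *: x12 -> T2 x21 = x212 + a *: x21 ->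
  c * a' + a * b = b * c -> c * b' + b * a = a * c ->
  a ^+ 2 * b + m1 * c = b ^+ 2 * a + m2 * c ->
  T1 (T2 (T1 x)) - T2 (T1 (T2 x)) = x121 - x212.
Proof.
move=> L1 L2 E1 E2 E3 E4 E5 E6 E7 E8 R1 R2 R3.
have D1 u v : T1 (u + v) = T1 u + T1 v by rewrite -[u]scale1r L1 !scale1r.
have D2 u v : T2 (u + v) = T2 u + T2 v by rewrite -[u]scale1r L2 !scale1r.
have T10 : T1 0 = 0 by have := L1 (-1) 0 0; rewrite scaler0 addr0 scaleN1r addNr.
have T20 : T2 0 = 0 by have := L2 (-1) 0 0; rewrite scaler0 addr0 scaleN1r addNr.
have Z1 k u : T1 (k *: u) = k *: T1 u by rewrite -[k *: u]addr0 L1 T10 addr0.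
have Z2 k u : T2 (k *: u) = k *: T2 u by rewrite -[k *: u]addr0 L2 T20 addr0.
rewrite !(D1, D2, Z1, Z2, E1, E2, E3, E4, E5, E6, E7, E8).
have F1 : c * a' = b * c - a * b by rewrite -R1 addrK.
have F2 : c * b' = a * c - b * a by rewrite -R2 addrK.
have F3 : m1 * c = b ^+ 2 * a + m2 * c - a ^+ 2 * b by rewrite -R3; ring.
apply/eqP; rewrite -subr_eq0; apply/eqP.
(* Zero is spelled out with the three scalar relations as coefficients, which leaves an identity of
   free linear combinations. *)
have -> : (0 : W) = (c * a' - (b * c - a * b)) *: x1 +
   - ((c * b' - (a * c - b * a)) *: x2) +
  (m1 * c - (b ^+ 2 * a + m2 * c - a ^+ 2 * b)) *: x.
  by rewrite F1 F2 F3 !subrr !scale0r subr0 !addr0.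
by lincomb K; ring.
Qed.

End StepScalars.

Lemma rho_hexagon l n (kappa : 'I_l -> int) (t : tab l n) r : (0 < r)%N -> (r.+1 < n)%N ->
  [/\ rho kappa (tswap t r) r.+1 = ct kappa t r - ct kappa t r.+2,
      rho kappa (tswap t r.+1) r = ct kappa t r - ct kappa t r.+2,
      rho kappa (tswap (tswap t r) r.+1) r = ct kappa t r.+1 - ct kappa t r.+2 &
      rho kappa (tswap (tswap t r.+1) r) r.+1 = ct kappa t r - ct kappa t r.+1].
Proof.
move=> r0 hn; have hr : (0 < r < n)%N by rewrite r0 ltnW.
have hr' : (0 < r.+1 < n)%N by [].
have hk : (0 < r.+2 <= n)%N by [].
have hk1 : (0 < r <= n)%N by rewrite r0 ltnW // ltnW.
have nr : r.+2 != r by clear; lia.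
have nr1 : r.+2 != r.+1 by clear; lia.
have nr2 : r != r.+1 by clear; lia.
have nr3 : r != r.+2 by clear; lia.
split; rewrite /rho.
- by rewrite (ct_tswapR kappa hr) (ct_tswapN kappa hr).
- by rewrite (ct_tswapL kappa hr') (ct_tswapN kappa hr').
- by rewrite (ct_tswapL kappa hr') (ct_tswapN kappa hr') // (ct_tswapL kappa hr) (ct_tswapN kappa hr).
by rewrite (ct_tswapR kappa hr) (ct_tswapN kappa hr) // (ct_tswapR kappa hr') (ct_tswapN kappa hr').
Qed.

Lemma rho_tswap_far l n (kappa : 'I_l -> int) (t : tab l n) r k :
  (0 < r < n)%N -> (0 < k < n)%N -> (r.+1 < k)%N || (k.+1 < r)%N ->
  rho kappa (tswap t r) k = rho kappa t k.
Proof. by move=> hr hk hrk; rewrite /rho !ct_tswapN //; clear -hr hk hrk; lia. Qed.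

Section TableauWeights.
Variables (K : fieldType) (q : K) (l n : nat) (kappa : 'I_l -> int).
Variables (A : algType K) (L T : nat -> A).
Hypotheses (q0 : q != 0) (sep : separates q n kappa).
Hypothesis hrel : hecke_rel q n kappa L T.
Local Notation "[ d ]" := (qint q d) (format "[ d ]").
Local Notation cont := (content kappa).
Local Notation ct := (ct kappa).
Local Notation rho := (rho kappa).
Local Notation weight := (weight q kappa L).
Local Notation Fid := (Fid q kappa L).
Implicit Types (t u v : tab l n) (x : A).

Definition tweight t x : Prop :=
  forall k, (0 < k <= n)%N -> x * L k = [ct t k] *: x.

Lemma tweight_weight t x k : (k <= n)%N -> tweight t x -> weight (entries t k) x.
Proof.
move=> hk W; elim: k hk => // k IH hk; rewrite entriesSn /= size_entries 1?ltnW //.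
by split; [rewrite -(ctSn kappa t hk); apply: W | apply/IH/ltnW].
Qed.

Lemma weight_tweight t x : weight (entries t n) x -> tweight t x.
Proof.
move=> W [//|k] /= hk; have [s E] := entries_suffix t hk.
move: W; rewrite E => /weight_cat; rewrite entriesSn /= size_entries 1?ltnW //.
by case=> -> _; rewrite (ctSn _ _ hk).
Qed.

Lemma tweightD t x y : tweight t x -> tweight t y -> tweight t (x + y).
Proof. by move=> Wx Wy k hk; rewrite mulrDl Wx // Wy // scalerDr. Qed.

Lemma tweightZ t c x : tweight t x -> tweight t (c *: x).
Proof. by move=> Wx k hk; rewrite -scalerAl Wx // !scalerA mulrC. Qed.

Lemma tweight_mull t x y : tweight t x -> tweight t (y * x).
Proof. by move=> Wx k hk; rewrite -mulrA Wx // scalerAr. Qed.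

Lemma tweight_decomposition (P : A -> Prop) :
  P 0 -> (forall x y, P x -> P y -> P (x + y)) ->
  (forall t x, std t -> tweight t x -> P x) -> forall x, P x.
Proof.
move=> P0 PD H.
apply: (weight_decomposition q0 sep hrel (leqnn n) P0 PD) => s x hs sz W.
have [t st E] := stdseq_entries hs sz.
by apply: (H t x st); apply: weight_tweight; rewrite E.
Qed.

Lemma eigen_prod (I : Type) (r : seq I) (P : pred I) (F : I -> A) (c : I -> K) x :
  (forall i, P i -> x * F i = c i *: x) ->
  x * (\prod_(i <- r | P i) F i) = (\prod_(i <- r | P i) c i) *: x.
Proof.
move=> H; elim: r => [|i r IH]; first by rewrite !big_nil mulr1 scale1r.
rewrite !big_cons; case: ifP => // Pi.
by rewrite mulrA H // -scalerAl IH scalerA.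
Qed.

Lemma eigen_prod_nat (F : nat -> A) (c : nat -> K) x :
  (forall k, (0 < k <= n)%N -> x * F k = c k *: x) ->
  x * (\prod_(1 <= k < n.+1) F k) = (\prod_(1 <= k < n.+1) c k) *: x.
Proof.
move=> H; rewrite big_nat_cond [in RHS]big_nat_cond; apply: eigen_prod => k.
by rewrite andbT ltnS => /H.
Qed.

Lemma ct_in_Cont t k : std t -> (0 < k <= n)%N -> ct t k \in Cont n kappa.
Proof.
move=> st hk; rewrite /Cont mem_undup; apply: allpairs_f; first by rewrite mem_enum.
by rewrite mem_iota add1n ltnS.
Qed.

(** For t = u every factor acts by 1. Otherwise the contents differ at some k, and the factor of F_u
    at k for the content c_k(t) kills [x]. *)
Lemma mul_Fid t u x : std t -> std u -> tweight t x ->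
  x * Fid u = if t == u then x else 0.
Proof.
move=> st su W; pose c k := \prod_(c <- Cont n kappa | [ct u k] != [c])
  (([ct t k] - [c]) / ([ct u k] - [c])).
rewrite /Defs.Fid (eigen_prod_nat (c := c)) => [|k hk]; last first.
  apply: eigen_prod => d _; rewrite mulrA mulrBr W // -!scalerAr !mulr1.
  by rewrite -scalerBl scalerA mulrC.
have [Etu|ntu] := eqVneq t u.
  rewrite big1_seq ?scale1r // => k _; apply: big1 => d nd.
  by rewrite Etu divff // subr_eq0.
have [k hk nk] := std_separated q0 sep st su ntu.
suff -> : \prod_(1 <= k < n.+1) c k = 0 by rewrite scale0r.
apply/eqP; rewrite prodf_seq_eq0; apply/hasP; exists k.
  by rewrite mem_index_iota ltnS.
rewrite /= prodf_seq_eq0; apply/hasP; exists (ct t k); first exact: ct_in_Cont.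
by rewrite eq_sym nk subrr mul0r eqxx.
Qed.

Lemma Fid_tweight_mul u x : std u -> tweight u (x * Fid u).
Proof.
move=> su; elim/tweight_decomposition: x => [|x y Wx Wy|t x st W].
- by rewrite mul0r => k hk; rewrite mul0r scaler0.
- by rewrite mulrDl; apply: tweightD.
rewrite (mul_Fid st su W); case: eqP => [<-//|_ k hk].
by rewrite mul0r scaler0.
Qed.

Lemma Fid_tweight u : std u -> tweight u (Fid u).
Proof. by rewrite -[Fid u]mul1r; apply: Fid_tweight_mul. Qed.

Lemma L_Fid u k : std u -> (0 < k <= n)%N -> L k * Fid u = [ct u k] *: Fid u.
Proof.
move=> su hk; rewrite -Fid_tweight //; rewrite /Defs.Fid big_nat.
apply: commr_prod => j hj; apply: commr_prod => c _.
have C : L k * L j = L j * L k by apply: (LL_comm hrel); move: hj; rewrite ltnS.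
by rewrite /GRing.comm !alg_simp C; lincomb K; ring.
Qed.

Lemma Fid_mul t u : std t -> std u -> Fid t * Fid u = if t == u then Fid t else 0.
Proof. by move=> st su; apply: mul_Fid => //; apply: Fid_tweight. Qed.

Lemma sum_Fid : \sum_(t in [set t : tab l n | std t]) Fid t = 1.
Proof.
suff H x : x * \sum_(t in [set t : tab l n | std t]) Fid t = x by rewrite -[LHS]mul1r H.
elim/tweight_decomposition: x => [|x y Ex Ey|t x st W].
- by rewrite mul0r.
- by rewrite mulrDl Ex Ey.
rewrite mulr_sumr (bigD1 t) ?inE //= (mul_Fid st st W) eqxx big1 ?addr0 // => u.
by rewrite inE => /andP[su nut]; rewrite (mul_Fid st su W) eq_sym (negPf nut).
Qed.

Definition step r t x : A := x * T r + [rho t r]^-1 *: x.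

Lemma step_weight r t x : (0 < r < n)%N -> std t -> std (tswap t r) -> tweight t x ->
  tweight (tswap t r) (step r t x).
Proof.
move=> hr st sv W.
have hr0 : (0 < r <= n)%N by case/andP: (hr); clear; lia.
have hr1 : (0 < r.+1 <= n)%N by case/andP: (hr); clear; lia.
have [E1 E2] := eigen_step q0 hrel hr (qct_neq q0 sep hr st) (W r hr0) (W r.+1 hr1).
move=> k hk; have [->|n0] := eqVneq k r; first by rewrite ct_tswapL.
have [->|n1] := eqVneq k r.+1; first by rewrite ct_tswapR.
rewrite (ct_tswapN kappa hr _ hk n0 n1) /step mulrDl -mulrA (TL_comm hrel hr hk n0 n1).
by rewrite mulrA -scalerAl !W // !alg_simp; lincomb K; ring.
Qed.

(** Here r and r + 1 have adjacent contents, and no node addable before r is entered has a content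
    adjacent to that of r, so no non-zero vector has the swapped eigenvalues. *)
Lemma step_eq0 r t x : (0 < r < n)%N -> std t -> ~~ std (tswap t r) -> tweight t x ->
  step r t x = 0.
Proof.
move=> hr st sv W.
have hr0 : (0 < r <= n)%N by case/andP: (hr); clear; lia.
have hr1 : (0 < r.+1 <= n)%N by case/andP: (hr); clear; lia.
have [E1 _] := eigen_step q0 hrel hr (qct_neq q0 sep hr st) (W r hr0) (W r.+1 hr1).
have hp : (r.-1 <= n)%N by case/andP: (hr); clear; lia.
have sz : size (entries t r.-1) = r.-1 by apply: size_entries.
have hst : stdseq (entries t r.-1) by apply: std_stdseq.
have [e he Ee] := not_std_tswap_ct kappa hr st sv.
apply: (@weight_vanish _ q _ _ kappa _ L (entries t r.-1) _ [ct t r.+1]).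
- by apply: (branchingP q0 sep hrel) => //; rewrite sz; case/andP: (hr); clear; lia.
- apply: weightD; last by apply: weightZ; apply: tweight_weight.
  apply: (weight_T hrel); last exact: tweight_weight.
  by rewrite sz; case/andP: (hr); clear; lia.
- by rewrite sz prednK //; case/andP: hr.
move=> z az; rewrite Ee (ct_swap0 _ hr).
apply: (addable_qint_neq1 q0 sep hst _ az he).
  exact: (std_addable (swap0 hr)).
by rewrite sz; case/andP: (hr); clear; lia.
Qed.

Lemma qrho_neq0 r t : (0 < r < n)%N -> std t -> [rho t r] != 0.
Proof. by move=> hr st; rewrite -qint_eq //; apply: (qct_neq q0 sep hr). Qed.

Lemma step_sqr r t x : (0 < r < n)%N -> std t -> tweight t x ->
  step r (tswap t r) (step r t x) = step_norm q (rho t r) *: x.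
Proof.
move=> hr st W; have [sv|nsv] := boolP (std (tswap t r)); last first.
  rewrite (step_eq0 hr st nsv W) /step mul0r scaler0 addr0 step_norm_adjacent ?scale0r //.
  have [e he Ee] := not_std_tswap_ct kappa hr st nsv.
  by rewrite /Defs.rho Ee; move: he; clear; lia.
have d0 := qrho_neq0 hr st.
rewrite /step (rho_tswap kappa hr) step_normE // invN_qint // !alg_simp -mulrA (T_quad hrel hr).
rewrite !alg_simp /qpow.
by lincomb K; field.
Qed.

Lemma step_comm r k t x : (0 < r < n)%N -> (0 < k < n)%N ->
  (r.+1 < k)%N || (k.+1 < r)%N ->
  step k (tswap t r) (step r t x) = step r (tswap t k) (step k t x).
Proof.
move=> hr hk hrk.
rewrite /step !rho_tswap_far // 1?orbC // !alg_simp -![x * T _ * T _]mulrA (TT_comm hrel hr hk) //.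
by rewrite !alg_simp; lincomb K; ring.
Qed.

(** [braid_hexagon] read from the relation to the paths: the T_r satisfy the braid relation in [A],
    so both paths end in the same vector. *)
Lemma step_braid r t x : (0 < r)%N -> (r.+1 < n)%N -> std t -> tweight t x ->
  step r (tswap (tswap t r) r.+1) (step r.+1 (tswap t r) (step r t x)) =
  step r.+1 (tswap (tswap t r.+1) r) (step r (tswap t r.+1) (step r.+1 t x)).
Proof.
move=> r0 hn st W.
have hr : (0 < r < n)%N by rewrite r0 ltnW.
have hr' : (0 < r.+1 < n)%N by [].
have n12 := qct_neq q0 sep hr st; have n23 := qct_neq q0 sep hr' st.
have n13 := qct_two_apart q0 sep st r0 hn.
have [R1 R2 R3] := step_norm_braid q0 n12 n23 n13.
set x1 := step r t x; set x2 := step r.+1 t x.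
set x12 := step r.+1 _ x1; set x21 := step r _ x2.
have [rho12 rho21 rho121 rho212] := rho_hexagon kappa t r0 hn.
have stepT k u y : y * T k = step k u y + (- [rho u k]^-1) *: y.
  by rewrite /step scaleNr addrK.
apply/eqP; rewrite -subr_eq0; apply/eqP.
rewrite -(@braid_hexagon K A (fun y => y * T r) (fun y => y * T r.+1) _ _ _ _ _ _ _
   x x1 x2 x12 x21 _ _ _ _ _ _ _ _ _ _ _ _ R1 R2 R3).
- by rewrite -!mulrA (mulrA (T r)) (T_braid hrel r0 hn) -!mulrA subrr.
- by move=> a y z; rewrite mulrDl scalerAl.
- by move=> a y z; rewrite mulrDl scalerAl.
- exact: stepT.
- exact: stepT.
- rewrite (stepT r (tswap t r)) step_sqr // (rho_tswap kappa hr).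
  by rewrite opprB.
- rewrite (stepT r.+1 (tswap t r.+1)) step_sqr // (rho_tswap kappa hr').
  by rewrite opprB.
- by rewrite (stepT r.+1 (tswap t r)) rho12.
- by rewrite (stepT r (tswap t r.+1)) rho21.
- by rewrite (stepT r (tswap (tswap t r) r.+1)) rho121.
- by rewrite (stepT r.+1 (tswap (tswap t r.+1) r)) rho212.
Qed.

End TableauWeights.

(** * The seminormal representation *)

Section SwapRelations.
Variables (l n : nat).
Implicit Types t : tab l n.

Lemma val_swp r (i : 'I_n) : (0 < r < n)%N ->
  val (swp r i) = if val i == r.-1 then r else if val i == r then r.-1 else val i.
Proof.
move=> /andP[r0 rn]; rewrite /swp; case: eqP => [_|_]; first by rewrite val_insubd rn.
by case: eqP => // _; rewrite val_insubd (leq_ltn_trans (leq_pred r) rn).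
Qed.

Lemma tswap_braid t r : (0 < r)%N -> (r.+1 < n)%N ->
  tswap (tswap (tswap t r) r.+1) r = tswap (tswap (tswap t r.+1) r) r.+1.
Proof.
case: r => // r _ hn; apply/ffunP => i; rewrite !ffunE; congr (t _); apply: val_inj.
rewrite !val_swp /=; try (clear -hn; lia).
by do ?case: eqP => //; clear; lia.
Qed.

Lemma tswap_comm t r k : (0 < r < n)%N -> (0 < k < n)%N ->
  (r.+1 < k)%N || (k.+1 < r)%N -> tswap (tswap t r) k = tswap (tswap t k) r.
Proof.
move=> hr hk hrk; apply/ffunP => i; rewrite !ffunE; congr (t _); apply: val_inj.
rewrite !val_swp //; move: hr hk hrk; clear.
by case: r k => [//|r] [//|k] /=; do ?case: eqP => //; lia.
Qed.

End SwapRelations.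

Section SeminormalRepresentation.
Variables (K : fieldType) (q : K) (l n : nat) (kappa : 'I_l -> int).
Variable alpha : nat -> tab l n -> K.
Hypotheses (q0 : q != 0) (sep : separates q n kappa).
Hypothesis halpha : seminormal_coeff q kappa alpha.
Local Notation "[ d ]" := (qint q d) (format "[ d ]").
Local Notation cont := (content kappa).
Local Notation ct := (ct kappa).
Local Notation rho := (rho kappa).
Local Notation al := (alphaz alpha).
Implicit Types (t u v : tab l n).

Lemma alpha_norm r t : (0 < r < n)%N -> std t ->
  al r t * al r (tswap t r) = step_norm q (rho t r).
Proof.
move=> hr st; have [_ _ /(_ r hr)] := halpha st.
rewrite /=; case: ifP => [sv ->|/negbT nsv ->]; first by rewrite (rho_tswap kappa hr).
rewrite mul0r; apply/esym/step_norm_adjacent.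
have [e he Ee] := not_std_tswap_ct kappa hr st nsv.
by rewrite /Defs.rho Ee; move: he; clear; lia.
Qed.

Lemma alpha_neq0 r t : (0 < r < n)%N -> std t -> std (tswap t r) -> al r t != 0.
Proof.
move=> hr st sv; have [n0 n1 n2] := qct_tswap_neq q0 sep hr st sv.
apply/eqP => a0; have := alpha_norm hr st; rewrite a0 mul0r => /esym/eqP; apply/negP.
rewrite /step_norm !mulf_neq0 ?invr_neq0 ?mulf_neq0 //.
- by move: n1; rewrite qint_eq //; congr (qint _ _ != 0); rewrite /Defs.rho; clear; lia.
- move: n2; rewrite qint_eq // -(qintN_eq0 q0) opprB /Defs.rho.
  by congr (qint _ _ != 0); clear; lia.
- by rewrite -qint_eq.
by rewrite qintN_eq0 // -qint_eq.
Qed.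

Variable t0 : tab l n.
Hypothesis st0 : std t0.

Local Notation stds := (enum [pred t : tab l n | std t]).
(** A predecessor, so that the matrices have visibly positive size and form a non-zero algebra; [t0]
    guarantees that nothing is lost. *)
Definition std_dim : nat := (size stds).-1.
Local Notation B := 'M[K]_std_dim.+1.

Lemma std_dimS : std_dim.+1 = size stds.
Proof. by rewrite prednK // -has_predT; apply/hasP; exists t0; rewrite ?mem_enum. Qed.

Definition std_idx t : 'I_std_dim.+1 := inord (index t stds).

Lemma std_idx_inj t u : std t -> std u -> std_idx t = std_idx u -> t = u.
Proof.
have Hm v : std v -> v \in stds by move=> sv; rewrite mem_enum.
have Hi v : std v -> (index v stds < std_dim.+1)%N by rewrite std_dimS index_mem; apply: Hm.
move=> st su /(congr1 val); rewrite /std_idx /= !inordK ?Hi // => E.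
by rewrite -(nth_index t0 (Hm t st)) E nth_index ?Hm.
Qed.

Lemma std_idx_surj i : exists2 t, std t & std_idx t = i.
Proof.
have hi : (i < size stds)%N by rewrite -std_dimS.
exists (nth t0 stds i).
  by have := mem_nth t0 hi; rewrite mem_enum.
by apply: val_inj; rewrite /= inordK index_uniq ?enum_uniq // std_dimS.
Qed.

Definition std_unit u v : B :=
  if std u && std v then delta_mx (std_idx u) (std_idx v) else 0.

(* The row vector [v_t], stored as the first row of a square matrix. *)
Definition std_vec t : B := if std t then delta_mx 0 (std_idx t) else 0.

Lemma std_vec_unit t u v : std u ->
  std_vec t * std_unit u v = if t == u then std_vec v else 0.
Proof.
move=> su; rewrite /std_vec /std_unit su /=.
have [->|ntu] := eqVneq t u.
  by rewrite su; case: ifP => sv; rewrite ?mulr0 // -[LHS]/(_ *m _) mul_delta_mx.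
case: ifP => st; last by rewrite mul0r.
case: ifP => sv; last by rewrite mulr0.
rewrite -[LHS]/(_ *m _) mul_delta_mx_cond; case: eqP => //= /(std_idx_inj st su) E.
by rewrite E eqxx in ntu.
Qed.

Lemma std_vec_sum t (c : tab l n -> K) (p : tab l n -> tab l n) :
  std_vec t * \sum_(u | std u) c u *: std_unit u (p u) =
  if std t then c t *: std_vec (p t) else 0.
Proof.
case: ifP => st; last by rewrite /std_vec st mul0r.
rewrite mulr_sumr (bigD1 t) //= -scalerAr std_vec_unit // eqxx big1 ?addr0 // => u.
by case/andP=> su nut; rewrite -scalerAr std_vec_unit // eq_sym (negPf nut) scaler0.
Qed.

Lemma std_vec_ext (M N : B) : (forall t, std t -> std_vec t * M = std_vec t * N) -> M = N.
Proof.
have E t (P : B) j : std t -> P (std_idx t) j = (std_vec t * P) 0 j.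
  move=> st; rewrite /std_vec st mxE (bigD1 (std_idx t)) //= mxE !eqxx mul1r big1 ?addr0 //.
  by move=> i ni; rewrite mxE (negPf ni) andbF mul0r.
move=> H; apply/matrixP => i j; have [t st <-] := std_idx_surj i.
by rewrite !E // H.
Qed.

Section Relations.
Variables (rep_L rep_T : nat -> B).
Hypothesis std_vec_L : forall t k, std_vec t * rep_L k = [ct t k] *: std_vec t.
Hypothesis std_vec_T : forall t r, std_vec t * rep_T r =
  al r t *: std_vec (tswap t r) + (- [rho t r]^-1) *: std_vec t.

Lemma std_vec_TT t r : (0 < r < n)%N -> std t ->
  (al r t *: std_vec (tswap t r)) * rep_T r =
  step_norm q (rho t r) *: std_vec t +
  (- [- rho t r]^-1) *: (al r t *: std_vec (tswap t r)).
Proof.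
move=> hr st; rewrite -scalerAl std_vec_T (tswapK hr) (rho_tswap kappa hr) -alpha_norm //.
by lincomb K; ring.
Qed.

Lemma content_first t : std t -> (0 < n)%N -> exists i, ct t 1 = kappa i.
Proof.
move=> st hn; rewrite (ctSn kappa t hn).
have hst := std_stdseq st hn; have ht := mem_head (t (Ordinal hn)) [::].
have := hook_bound hst; rewrite entriesSn => /(_ _ _ ht ht erefl).
by rewrite /= /content => h; exists (t (Ordinal hn)).1.1; move: h; clear; lia.
Qed.

(** Each relation is tested on the vectors v_t. For the braid relation, vectors weighted by alpha
    play the role of the steps, and the first condition on alpha makes the two ends of the hexagon
    agree. *)
Lemma rep_hecke : hecke_rel q n kappa rep_L rep_T.
Proof.
split; [|split; [|split; [|split; [|split; [|split]]]]].
- move=> hn; apply: std_vec_ext => t st; rewrite mulr0.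
  rewrite (@eigen_prod K _ _ _ _ _ (fun i => [ct t 1] - [kappa i])) => [|i _].
    have [i Ei] := content_first st hn; apply/eqP; rewrite scaler_eq0; apply/orP; left.
    by apply/prodf_eq0; exists i; rewrite ?Ei ?subrr.
  by rewrite mulrBr std_vec_L -scalerAr mulr1 -scalerBl.
- move=> r hr; apply: std_vec_ext => t st; have d0 := qrho_neq0 q0 sep hr st.
  have E1 := std_vec_T t r; have E2 := std_vec_TT hr st.
  rewrite invN_qint // step_normE // in E2.
  move: E1 E2; move: (al r t *: _) => x1 E1 E2.
  rewrite mulr0 mulrA !(alg_simp, E1, E2) /qpow.
  by lincomb K; field.
- by move=> r s _ _; apply: std_vec_ext => t st; rewrite !mulrA !(std_vec_L, =^~ scalerAl) !scalerA mulrC.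
- move=> r s hr hs hrs; apply: std_vec_ext => t st.
  have [_ /(_ r s hr hs hrs) E _] := halpha st.
  rewrite !mulrA !(std_vec_T, mulrDl, =^~ scalerAl) (tswap_comm _ hr hs hrs).
  have hsr : (s.+1 < r)%N || (r.+1 < s)%N by rewrite orbC.
  rewrite (rho_tswap_far kappa _ hr hs hrs) // (rho_tswap_far kappa _ hs hr hsr) // !scalerDr !scalerA E.
  by lincomb K; ring.
- move=> r r0 hn; apply: std_vec_ext => t st; rewrite !mulrA.
  have hr : (0 < r < n)%N by rewrite r0 ltnW.
  have hr' : (0 < r.+1 < n)%N by [].
  have [/(_ r r0 hn) Ea _ _] := halpha st.
  have n12 := qct_neq q0 sep hr st; have n23 := qct_neq q0 sep hr' st.
  have n13 := qct_two_apart q0 sep st r0 hn.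
  have [R1 R2 R3] := step_norm_braid q0 n12 n23 n13.
  apply/eqP; rewrite -subr_eq0; apply/eqP.
  have [S1 S2 S3 S4] := rho_hexagon kappa t r0 hn.
  rewrite (@braid_hexagon K _ (fun y => y * rep_T r) (fun y => y * rep_T r.+1) _ _ _ _ _ _ _
   (std_vec t) (al r t *: std_vec (tswap t r)) (al r.+1 t *: std_vec (tswap t r.+1))
   (al r t *: (al r.+1 (tswap t r) *: std_vec (tswap (tswap t r) r.+1)))
   (al r.+1 t *: (al r (tswap t r.+1) *: std_vec (tswap (tswap t r.+1) r)))
   (al r t *: (al r.+1 (tswap t r) *: (al r (tswap (tswap t r) r.+1) *:
      std_vec (tswap (tswap (tswap t r) r.+1) r))))
   (al r.+1 t *: (al r (tswap t r.+1) *: (al r.+1 (tswap (tswap t r.+1) r) *: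
      std_vec (tswap (tswap (tswap t r.+1) r) r.+1)))) _ _ _ _ _ _ _ _ _ _ R1 R2 R3).
  + by rewrite !scalerA Ea (tswap_braid _ r0 hn) subrr.
  + by move=> a y z; rewrite mulrDl scalerAl.
  + by move=> a y z; rewrite mulrDl scalerAl.
  + exact: std_vec_T.
  + exact: std_vec_T.
  + by rewrite std_vec_TT // /Defs.rho opprB.
  + by rewrite std_vec_TT // /Defs.rho opprB.
  + by rewrite -scalerAl std_vec_T S1; lincomb K; ring.
  + by rewrite -scalerAl std_vec_T S2; lincomb K; ring.
  + by rewrite -!scalerAl std_vec_T S3; lincomb K; ring.
  + by rewrite -!scalerAl std_vec_T S4; lincomb K; ring.
- move=> r s hr hs n1 n2; apply: std_vec_ext => t st.
  rewrite !mulrA !(std_vec_T, std_vec_L, mulrDl, =^~ scalerAl) (ct_tswapN kappa hr) //.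
  by lincomb K; ring.
move=> r hr; apply: std_vec_ext => t st; have n12 := qct_neq q0 sep hr st.
rewrite !mulrDr !mulrA std_vec_L mulrN -!scalerAl -scalerAr !mulr1 !std_vec_T.
rewrite mulrDl -!scalerAl !std_vec_L (ct_tswapL kappa hr) /Defs.rho qint_subVE // /qpow.
by lincomb K; field; rewrite subr_eq0.
Qed.

End Relations.

Lemma seminormal_rep : exists rep_L rep_T : nat -> B,
  hecke_rel q n kappa rep_L rep_T /\ Fid q kappa rep_L t0 != 0.
Proof.
pose rep_L k : B := \sum_(u | std u) [ct u k] *: std_unit u u.
pose rep_T r : B := \sum_(u | std u) al r u *: std_unit u (tswap u r) -
  \sum_(u | std u) [rho u r]^-1 *: std_unit u u.
have EL t k : std_vec t * rep_L k = [ct t k] *: std_vec t.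
  by rewrite std_vec_sum; case: ifP => // st; rewrite /std_vec st scaler0.
have ET t r : std_vec t * rep_T r =
    al r t *: std_vec (tswap t r) + (- [rho t r]^-1) *: std_vec t.
  rewrite mulrBr !std_vec_sum; case: ifP => st; first by rewrite scaleNr.
  by rewrite /alphaz /std_vec st scale0r !scaler0 addr0 subr0.
have H := rep_hecke EL ET; exists rep_L, rep_T; split=> //.
have W : tweight q kappa rep_L t0 (std_vec t0) by move=> k _; apply: EL.
have := mul_Fid q0 sep st0 st0 W; rewrite eqxx => E.
apply/eqP => F0; move: E; rewrite F0 mulr0 /std_vec st0 => /esym.
by move/matrixP/(_ 0 (std_idx t0)) /eqP; rewrite !mxE !eqxx oner_eq0.
Qed.

End SeminormalRepresentation.

(** * Generation by the L_k and T_r *)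

Section Generation.
Variables (K : fieldType) (A : algType K).

Record subalgebra := Subalgebra {
  subalgebra_pred :> A -> Prop;
  subalgebra1 : subalgebra_pred 1;
  subalgebra_lin : forall (c : K) x y,
    subalgebra_pred x -> subalgebra_pred y -> subalgebra_pred (c *: x + y);
  subalgebraM : forall x y,
    subalgebra_pred x -> subalgebra_pred y -> subalgebra_pred (x * y) }.

Variable P : subalgebra.

(** Subalgebra structures live on boolean predicates, so membership is decided classically. *)
Definition subalgebra_mem : {pred A} :=
  fun x => if excluded_middle_informative (P x) then true else false.

Lemma subalgebra_memP x : reflect (P x) (x \in subalgebra_mem).
Proof.
by rewrite unfold_in /subalgebra_mem; case: excluded_middle_informative => h; constructor.
Qed.

Fact subalgebra_closed : subalg_closed subalgebra_mem.
Proof.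
split; first exact/subalgebra_memP/subalgebra1.
  by move=> c x y /subalgebra_memP Px /subalgebra_memP Py; apply/subalgebra_memP/subalgebra_lin.
by move=> x y /subalgebra_memP Px /subalgebra_memP Py; apply/subalgebra_memP/subalgebraM.
Qed.

HB.instance Definition _ :=
  GRing.isSubalgClosed.Build K A subalgebra_mem subalgebra_closed.

Definition subalgebra_type := {x : A | x \in subalgebra_mem}.
HB.instance Definition _ := Choice.on subalgebra_type.
HB.instance Definition _ := SubType.on subalgebra_type.
HB.instance Definition _ := [SubChoice_isSubAlgebra of subalgebra_type by <:].

Definition subalgebra_val : subalgebra_type -> A := val.
Fact subalgebra_val_linear : linear subalgebra_val.
Proof. by move=> c x y; rewrite /subalgebra_val linearP. Qed.
HB.instance Definition _ := GRing.isLinear.Build K subalgebra_type A _ subalgebra_val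
  subalgebra_val_linear.
Fact subalgebra_val_monoid : monoid_morphism subalgebra_val.
Proof. by split; [exact: (rmorph1 (val : subalgebra_type -> A))|exact: (rmorphM (val : subalgebra_type -> A))]. Qed.
HB.instance Definition _ := GRing.isMonoidMorphism.Build subalgebra_type A subalgebra_val
  subalgebra_val_monoid.

End Generation.

(** The generators lie in the subalgebra cut out by [P] and satisfy the relations there, so [A] maps
    to it. Composed with the inclusion, this map fixes the generators and is the identity by
    uniqueness; hence every element lies in [P]. *)
Lemma hecke_generated (K : fieldType) (q : K) (l n : nat) (kappa : 'I_l -> int)
    (A : algType K) (L T : nat -> A) (P : A -> Prop) :
  is_hecke q n kappa L T -> P 1 ->
  (forall (c : K) x y, P x -> P y -> P (c *: x + y)) ->
  (forall x y, P x -> P y -> P (x * y)) ->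
  (forall k, (0 < k <= n)%N -> P (L k)) -> (forall r, (0 < r < n)%N -> P (T r)) ->
  forall x, P x.
Proof.
move=> [hrel hun] P1 Plin PM PL PT.
pose S := subalgebra_type (Subalgebra P1 Plin PM).
pose v : {lrmorphism S -> A} := @subalgebra_val K A _.
have vinj : injective v by apply: val_inj.
have inS (Q : nat -> A) (b : pred nat) : (forall k, b k -> P (Q k)) ->
    exists QS : nat -> S, forall k, b k -> v (QS k) = Q k.
  (* Values not in [P] default to 1; this can happen only at indices that no relation mentions. *)
  move=> H; exists (fun k => insubd (1 : S) (Q k)) => k bk.
  by rewrite /v /= /subalgebra_val val_insubd; case: subalgebra_memP => // /(_ (H k bk)).
have [LS ELS] := inS L _ PL; have [TS ETS] := inS T _ PT.
have hS : hecke_rel q n kappa LS TS.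
  have [R1 [R2 [R3 [R4 [R5 [R6 R7]]]]]] := hrel.
  split; [|split; [|split; [|split; [|split; [|split]]]]].
  - move=> hn; apply: vinj; rewrite rmorph0 -[RHS](R1 hn).
    rewrite (big_morph v (rmorphM v) (rmorph1 v)); apply: eq_bigr => i _.
    by rewrite rmorphB linearZ rmorph1 /= ELS.
  - move=> r hr; apply: vinj; rewrite rmorph0 -[RHS](R2 r hr).
    by rewrite rmorphM rmorphD rmorphB linearZ rmorph1 /= ETS.
  - by move=> r s hr hs; apply: vinj; rewrite !rmorphM /= !ELS // R3.
  - by move=> r s hr hs hrs; apply: vinj; rewrite !rmorphM /= !ETS // R4.
  - move=> s s0 hs; apply: vinj; rewrite !rmorphM /= !ETS //; first exact: R5.
    by rewrite s0 ltnW.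
  - by move=> r s hr hs n1 n2; apply: vinj; rewrite !rmorphM /= ETS // ELS // R6.
  have vA c : v c%:A = c%:A by rewrite linearZ rmorph1.
  move=> r hr; apply: vinj; rewrite rmorphM !rmorphD (rmorphN v) !rmorph1 rmorphM.
  transitivity (v (LS r.+1) * (v (TS r) - q%:A + 1)).
    by congr (_ * (_ - _ + _)); apply: vA.
  by rewrite /= ETS // !ELS ?R7 //; case/andP: hr; clear; lia.
have [f [[fL fT] _]] := hun S LS TS hS.
have [g [_ gu]] := hun A L T hrel.
pose h : {lrmorphism A -> A} := v \o f.
move=> x; have -> : x = val (f x).
  rewrite -[RHS]/(h x) (gu h) => [|k hk|r hr].
  - by rewrite -(gu idfun).
  - by rewrite /= fL // ELS.
  by rewrite /= fT // ETS.
exact: (elimT (subalgebra_memP (Subalgebra P1 Plin PM) _) (valP (f x))).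
Qed.

(** * Transport along descents *)

Section Descents.
Variables (l n : nat).
Implicit Types (t u v : tab l n) (x y z : node l n).

Definition node_rank x : nat := ((ncomp x * n + nrow x) * n + ncol x)%N.

Lemma lex_lt (u u' c c' : nat) : (u < u')%N -> (c < n)%N -> (u * n + c < u' * n + c')%N.
Proof.
move=> uu cn; apply: (@leq_trans (u.+1 * n)%N); first by rewrite mulSn addnC ltn_add2r.
by apply: leq_trans (leq_addr _ _); rewrite leq_mul2r uu orbT.
Qed.

Lemma node_lt_rank x y : node_lt x y -> (node_rank x < node_rank y)%N.
Proof.
rewrite /node_rank; case/orP => [h|/andP[/eqP-> /orP[h|/andP[/eqP-> h]]]].
- by apply: lex_lt (ncol_lt _); apply: lex_lt (nrow_lt _).
- by apply: lex_lt (ncol_lt _); rewrite ltn_add2l.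
- by rewrite ltn_add2l.
Qed.

Lemma node_lt_total x y : x != y -> node_lt x y || node_lt y x.
Proof.
move=> nxy; have : ~ [/\ ncomp x = ncomp y, nrow x = nrow y & ncol x = ncol y].
  by case=> a b c; case/eqP: nxy; apply: node_eqP.
rewrite /node_lt; case: (ltngtP (ncomp x) (ncomp y)) => //= E1.
case: (ltngtP (nrow x) (nrow y)) => //= E2.
by case: (ltngtP (ncol x) (ncol y)) => //= E3 [].
Qed.

Lemma node_lt_anti x y : node_lt x y -> ~~ node_lt y x.
Proof. by move/node_lt_rank => h; apply/negP => /node_lt_rank; move: h; clear; lia. Qed.

Lemma node_lt_trans y x z : node_lt x y -> node_lt y z -> node_lt x z.
Proof. by rewrite /node_lt; clear; lia. Qed.

Lemma le_node_lt x y : le_node x y -> x != y -> node_lt x y.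
Proof.
move=> /and3P[/eqP a b c] nxy; have := node_lt_total nxy.
by rewrite /node_lt; move: a b c; clear; lia.
Qed.

(** Quantifying over both positions makes this false outside 0 < r < n, so a descent brings its
    range along. *)
Definition descent t r : bool :=
  [exists i : 'I_n, exists j : 'I_n,
     [&& val j == r, val j == (val i).+1 & node_lt (t j) (t i)]].

Lemma descent_range t r : descent t r -> (0 < r < n)%N.
Proof.
case/existsP => i /existsP[j /and3P[/eqP <- /eqP E _]].
by rewrite ltn_ord E.
Qed.

Lemma descentE t r (hr : (0 < r < n)%N) :
  descent t r = node_lt (t (swap1 hr)) (t (swap0 hr)).
Proof.
apply/existsP/idP => [[i /existsP[j /and3P[/eqP E1 /eqP E2 h]]]|h].
  have <- : j = swap1 hr by apply: val_inj.
  by have <- : i = swap0 hr by apply: val_inj; rewrite /= -E1 E2.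
exists (swap0 hr); apply/existsP; exists (swap1 hr); rewrite eqxx h andbT /=.
by case/andP: (hr) => r0 _; rewrite prednK.
Qed.

Lemma swap01_neq t r (hr : (0 < r < n)%N) : std t -> t (swap0 hr) != t (swap1 hr).
Proof.
move=> st; apply/eqP => /(std_inj st) /(congr1 val) /=.
by case/andP: (hr); clear; lia.
Qed.

Lemma descent_std t r : std t -> descent t r -> std (tswap t r).
Proof.
move=> st dt; have hr := descent_range dt; rewrite (std_tswap hr) //.
rewrite (descentE _ hr) in dt; apply: contraL dt => lle.
by apply/node_lt_anti/le_node_lt => //; apply: swap01_neq.
Qed.

Lemma descent_tswap t r : (0 < r < n)%N -> std t -> descent (tswap t r) r = ~~ descent t r.
Proof.
move=> hr st; rewrite !(descentE _ hr) tswapL tswapR; apply/idP/idP => [/node_lt_anti//|h].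
by have := node_lt_total (swap01_neq hr st); rewrite (negPf h) orbF.
Qed.

(** Termination measure: swapping a descent moves the node of smaller rank to the earlier position,
    which has the larger weight n - i. *)
Definition energy t : nat := (\sum_(i < n) (n - i) * node_rank (t i))%N.

Lemma energy_descent t r : descent t r -> (energy (tswap t r) < energy t)%N.
Proof.
move=> dt; have hr := descent_range dt; rewrite (descentE _ hr) in dt.
have n01 : swap1 hr != swap0 hr.
  by rewrite -val_eqE /=; case/andP: (hr); clear; lia.
rewrite /energy (bigD1 (swap0 hr)) //= (bigD1 (swap1 hr)) //= [X in (_ < X)%N](bigD1 (swap0 hr)) //=.
rewrite [X in (_ < _ + X)%N](bigD1 (swap1 hr)) //= tswapL tswapR.
rewrite !addnA; set S := (X in (_ + X < _)%N).
rewrite (_ : (\sum_(i < n | _) _)%N = S); last first.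
  by apply: eq_bigr => i /andP[n0 n1]; rewrite (@tswapN _ _ _ hr).
rewrite ltn_add2r; have := node_lt_rank dt; have [r0 rn] := andP hr.
have -> : (n - r.-1 = (n - r).+1)%N by move: r0 rn; clear; lia.
by rewrite !mulSn; clear; lia.
Qed.

Lemma descent_far t r k : (r.+1 < k)%N || (k.+1 < r)%N -> descent t r -> descent t k ->
  descent (tswap t r) k.
Proof.
move=> hrk dr dk; have hr := descent_range dr; have hk := descent_range dk.
rewrite (descentE _ hk) in dk; rewrite (descentE _ hk).
by rewrite !(@tswapN _ _ _ hr) // -val_eqE /=; move: (hr) (hk) hrk; clear; lia.
Qed.

Lemma initial_descent t r : initial t -> ~~ descent t r.
Proof.
case/andP => st /forallP H; apply/negP => dt; have hr := descent_range dt.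
rewrite (descentE _ hr) in dt; have /forallP/(_ (swap1 hr)) := H (swap0 hr).
have -> : (swap0 hr < swap1 hr)%N by rewrite /=; case/andP: (hr); clear; lia.
by move/node_lt_anti; rewrite dt.
Qed.

Lemma no_descent_initial t : std t -> (forall r, ~~ descent t r) -> initial t.
Proof.
move=> st H; rewrite /initial st; apply/forallP => i; apply/forallP => j; apply/implyP.
case: j => m /= hm; elim: m hm => // m IH hm; rewrite ltnS => him.
have hm' : (m < n)%N := ltnW hm.
have step : node_lt (t (Ordinal hm')) (t (Ordinal hm)).
  have hr : (0 < m.+1 < n)%N by [].
  have E0 : swap0 hr = Ordinal hm' by apply: val_inj.
  have E1 : swap1 hr = Ordinal hm by apply: val_inj.
  have := node_lt_total (swap01_neq hr st); have := H m.+1.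
  by rewrite (descentE _ hr) E0 E1 => /negPf->; rewrite orbF.
move: him; rewrite leq_eqVlt => /predU1P[E|lt_im].
  by have -> : i = Ordinal hm' by apply: val_inj.
exact: node_lt_trans (IH hm' lt_im) step.
Qed.

Lemma initial_uniq t u : initial t -> initial u -> tshape t = tshape u -> t = u.
Proof.
move=> it iu E; have [st _] := andP it; have [su _] := andP iu.
have S v : initial v -> sorted (@node_lt l n) [seq v i | i <- enum 'I_n].
  case/andP => _ /forallP H; rewrite sorted_map.
  have := iota_ltn_sorted 0 n; rewrite -val_enum_ord sorted_map.
  by apply: sub_sorted => i j /= hij; have /forallP/(_ j)/implyP := H i; apply.
have irr : irreflexive (@node_lt l n).
  by move=> x; apply/negP => h; have := node_lt_anti h; rewrite h.
have tr : transitive (@node_lt l n) by move=> y x z; apply: node_lt_trans.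
have Em : [seq t i | i <- enum 'I_n] = [seq u i | i <- enum 'I_n].
  apply: (irr_sorted_eq tr irr); [exact: S|exact: S|move=> x].
  have M v : (x \in [seq v i | i <- enum 'I_n]) = (x \in tshape v).
    rewrite inE; apply/mapP/codomP => [[i _ ->]|[i ->]]; first by exists i.
    by exists i; rewrite ?mem_enum.
  by rewrite !M E.
apply/ffunP => i; move/eq_in_map: Em; apply.
by rewrite mem_enum.
Qed.

Lemma descent_ind (P : tab l n -> Prop) :
  (forall t, initial t -> P t) ->
  (forall t r, std t -> descent t r -> std (tswap t r) -> P (tswap t r) -> P t) ->
  forall t, std t -> P t.
Proof.
move=> Pi Pd t; move: {2}(energy t) (leqnn (energy t)) => m.
elim: m t => [|m IH] t hm st.
all: have [/existsP[i di]|] := boolP [exists i : 'I_n, descent t i].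
1,3: have he := energy_descent di.
- by move: he hm; clear; lia.
- apply: (Pd _ i st di (descent_std st di)); apply: IH; last exact: descent_std.
  by move: he hm; clear; lia.
all: rewrite negb_exists => /forallP H; apply/Pi/no_descent_initial => // r.
all: apply/negP => dr; have /andP[_ rn] := descent_range dr.
all: by have := H (Ordinal rn); rewrite dr.
Qed.

Lemma initial_exists t : std t -> exists2 b, initial b & tshape b = tshape t.
Proof.
elim/descent_ind => [{}t it|{}t r st dt sv [b ib E]]; first by exists t.
by exists b; rewrite // E (tshape_tswap (descent_range dt)).
Qed.

End Descents.

Section Transport.
Variables (K : fieldType) (q : K) (l n : nat) (kappa : 'I_l -> int).
Variables (A : algType K) (L T : nat -> A) (alpha : nat -> tab l n -> K).
Hypotheses (q0 : q != 0) (sep : separates q n kappa).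
Hypothesis hrel : hecke_rel q n kappa L T.
Hypothesis halpha : seminormal_coeff q kappa alpha.
Local Notation "[ d ]" := (qint q d) (format "[ d ]").
Local Notation ct := (ct kappa).
Local Notation rho := (rho kappa).
Local Notation al := (alphaz alpha).
Local Notation tweight := (tweight q kappa L).
Local Notation step := (step q kappa T).
Local Notation Fid := (Fid q kappa L).
Implicit Types (t u v w : tab l n).

(** Dividing by alpha_r(t) is what makes alpha_r(t) the coefficient of the swapped vector in the
    action of T_r. *)
Definition nstep r t (x : A) : A := (al r t)^-1 *: step r t x.

Lemma stepZ r t c x : step r t (c *: x) = c *: step r t x.
Proof. by rewrite /step -scalerAl scalerDr !scalerA mulrC. Qed.

Lemma step_mull r t x y : step r t (y * x) = y * step r t x.
Proof. by rewrite /step mulrDr mulrA scalerAr. Qed.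

Lemma nstep_comm r k w x : (0 < r < n)%N -> (0 < k < n)%N ->
  (r.+1 < k)%N || (k.+1 < r)%N -> std w ->
  nstep k (tswap w r) (nstep r w x) = nstep r (tswap w k) (nstep k w x).
Proof.
move=> hr hk hrk sw; rewrite /nstep !stepZ !scalerA (step_comm hrel _ _ hr hk hrk).
have [_ /(_ r k hr hk hrk) E _] := halpha sw.
by rewrite -!invfM; congr (_^-1 *: _); rewrite mulrC E mulrC.
Qed.

Lemma nstep_braid r w x : (0 < r)%N -> (r.+1 < n)%N -> std w -> tweight w x ->
  nstep r (tswap (tswap w r) r.+1) (nstep r.+1 (tswap w r) (nstep r w x)) =
  nstep r.+1 (tswap (tswap w r.+1) r) (nstep r (tswap w r.+1) (nstep r.+1 w x)).
Proof.
move=> r0 hn sw W; rewrite /nstep !stepZ !scalerA (step_braid q0 sep hrel r0 hn sw W).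
have [/(_ r r0 hn) E _ _] := halpha sw.
rewrite -!invfM; congr (_^-1 *: _).
rewrite [LHS](_ : _ = al r w * al r.+1 (tswap w r) * al r (tswap (tswap w r) r.+1)).
  by rewrite E; ring.
by ring.
Qed.

Lemma nstep_weight r t x : (0 < r < n)%N -> std t -> std (tswap t r) -> tweight t x ->
  tweight (tswap t r) (nstep r t x).
Proof. by move=> hr st sv W; apply/tweightZ/(step_weight q0 sep hrel). Qed.

(** The recursion follows descents and is not structural in [t]; [energy t] is enough fuel. *)
Fixpoint transport_fuel (m : nat) t : A :=
  if m is m'.+1 then
    if [pick i : 'I_n | descent t i] is Some i
    then nstep i (tswap t i) (transport_fuel m' (tswap t i)) else Fid t
  else Fid t.

(* [F_{t^lambda}] carried to [t] along a chosen sequence of descents. *)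
Definition transport t : A := transport_fuel (energy t) t.
Local Notation g := transport.

Lemma transport_fuelE m m' t : (energy t <= m)%N -> (energy t <= m')%N ->
  transport_fuel m t = transport_fuel m' t.
Proof.
have D0 u (i : 'I_n) : (energy u <= 0)%N -> descent u i = false.
  apply: contraTF => d; rewrite -ltnNge; exact: leq_ltn_trans (leq0n _) (energy_descent d).
elim: m m' t => [|m IH] [|m'] t hm hm' //=.
- by case: pickP => // i; rewrite D0.
- by case: pickP => // i; rewrite D0.
case: pickP => // i di; rewrite (IH m') //; have := energy_descent di; move: hm hm'; clear; lia.
Qed.

Lemma transportE t : g t = if [pick i : 'I_n | descent t i] is Some i
  then nstep i (tswap t i) (g (tswap t i)) else Fid t.
Proof.
rewrite {1}/transport (@transport_fuelE _ (energy t).+1) //=.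
case: pickP => // i di; congr (nstep _ _ _); apply: transport_fuelE => //.
exact/ltnW/energy_descent.
Qed.

Lemma transport_initial t : initial t -> g t = Fid t.
Proof.
by move=> it; rewrite transportE; case: pickP => // i; rewrite (negPf (initial_descent i it)).
Qed.

Lemma transport_weight t : std t -> tweight t (g t).
Proof.
move: {2}(energy t) (leqnn (energy t)) => m; elim: m t => [|m IH] t hm st.
all: rewrite transportE; case: pickP => [i di|_]; try exact: (Fid_tweight q0 sep hrel).
all: have he := energy_descent di.
  by move: he hm; clear; lia.
have hi := descent_range di; rewrite -{1}(tswapK hi t).
apply: nstep_weight; rewrite ?(tswapK hi) ?(descent_std st di) //.
by apply: IH; [move: he hm; clear; lia | apply: descent_std].
Qed.

(* Two descents of [t] are joined by descending paths that form a square or a hexagon. *)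
Lemma transport_descent t r : std t -> descent t r ->
  g t = nstep r (tswap t r) (g (tswap t r)).
Proof.
move: {2}(energy t) (leqnn (energy t)) => m; elim: m t r => [|m IH] t r hm st dr.
  by have := energy_descent dr; move: hm; clear; lia.
have IHd u k : (energy u < energy t)%N -> std u -> descent u k ->
    g u = nstep k (tswap u k) (g (tswap u k)).
  by move=> hu; apply: IH; move: hu hm; clear; lia.
rewrite {1}transportE; case: pickP => [i di|/(_ (swap1 (descent_range dr)))]; last by rewrite /= dr.
have hr := descent_range dr; have hi := descent_range di.
have sr := descent_std st dr; have si := descent_std st di.
have er := energy_descent dr; have ei := energy_descent di.
(* For consecutive descents the three nodes involved are in decreasing order, so every swap around
   the hexagon is a descent. Both paths end in one tableau [w], from which [nstep_braid] leads back
   up. *)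
have Hex k : descent t k -> descent t k.+1 ->
    nstep k (tswap t k) (g (tswap t k)) = nstep k.+1 (tswap t k.+1) (g (tswap t k.+1)).
  move=> d1 d2; have h1 := descent_range d1; have h2 := descent_range d2.
  have s1 := descent_std st d1; have s2 := descent_std st d2.
  have e1 := energy_descent d1; have e2 := energy_descent d2.
  have [k0 _] := andP h1; have [_ kn] := andP h2.
  have O : swap1 h1 = swap0 h2 by apply: val_inj.
  have n1 : swap1 h2 != swap0 h1 by rewrite -val_eqE /=; clear; lia.
  have n2 : swap1 h2 != swap1 h1 by rewrite -val_eqE /=; clear; lia.
  have n3 : swap0 h1 != swap0 h2 by rewrite -val_eqE /=; move: k0; clear; lia.
  have n4 : swap0 h1 != swap1 h2 by rewrite eq_sym.
  have L1 : node_lt (t (swap1 h1)) (t (swap0 h1)) by rewrite -descentE.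
  have L2 : node_lt (t (swap1 h2)) (t (swap1 h1)) by rewrite O -descentE.
  have L3 := node_lt_trans L2 L1.
  have d12 : descent (tswap t k) k.+1.
    by rewrite (descentE _ h2) (@tswapN _ _ _ h1) // -O tswapR.
  have d21 : descent (tswap t k.+1) k.
    by rewrite (descentE _ h1) O tswapL (@tswapN _ _ _ h2).
  have d121 : descent (tswap (tswap t k) k.+1) k.
    by rewrite (descentE _ h1) O tswapL (@tswapN _ _ _ h1) // (@tswapN _ _ _ h2) // tswapL.
  have d212 : descent (tswap (tswap t k.+1) k) k.+1.
    by rewrite (descentE _ h2) (@tswapN _ _ _ h1) // tswapR -O tswapR (@tswapN _ _ _ h2).
  have s12 := descent_std s1 d12; have s21 := descent_std s2 d21.
  have e12 := energy_descent d12; have e21 := energy_descent d21.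
  have e121 := energy_descent d121.
  rewrite (IHd _ _ e1 s1 d12) (IHd _ _ (ltn_trans e12 e1) s12 d121).
  rewrite (IHd _ _ e2 s2 d21) (IHd _ _ (ltn_trans e21 e2) s21 d212).
  rewrite -(tswap_braid t k0 kn).
  set w := tswap (tswap (tswap t k) k.+1) k.
  have sw : std w by apply: descent_std.
  have E1 : tswap (tswap t k) k.+1 = tswap w k by rewrite /w (tswapK h1).
  have E2 : tswap t k = tswap (tswap w k) k.+1 by rewrite /w (tswapK h1) (tswapK h2).
  have wE : w = tswap (tswap (tswap t k.+1) k) k.+1 by apply: tswap_braid.
  have E3 : tswap (tswap t k.+1) k = tswap w k.+1 by rewrite wE (tswapK h2).
  have E4 : tswap t k.+1 = tswap (tswap w k.+1) k by rewrite wE (tswapK h2) (tswapK h1).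
  rewrite [in LHS]E1 [in LHS]E2 [in RHS]E3 [in RHS]E4.
  by apply: nstep_braid => //; apply: transport_weight.
case: (ltngtP i r) => [lt_ir|lt_ri|E]; last by rewrite E.
- have [E|ne] := eqVneq r i.+1; first by rewrite E in dr *; apply: Hex.
  (* Distant descents persist after each other's swap and close a square with bottom [w]. *)
  have hir : (i.+1 < r)%N || (r.+1 < i)%N by rewrite ltn_neqAle eq_sym ne lt_ir.
  have dri := descent_far hir di dr.
  have hri : (r.+1 < i)%N || (i.+1 < r)%N by rewrite orbC.
  have dir := descent_far hri dr di.
  rewrite (IHd _ _ ei si dri) (IHd _ _ er sr dir) (tswap_comm t hi hr hir).
  set w := tswap (tswap t r) i; have sw : std w by apply: descent_std.
  have E1 : tswap t r = tswap w i by rewrite /w (tswapK hi).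
  have E2 : tswap t i = tswap w r by rewrite /w -(tswap_comm t hi hr hir) (tswapK hr).
  by rewrite E1 E2; apply: nstep_comm.
have [E|ne] := eqVneq (i : nat) r.+1; first by rewrite E in di *; apply/esym/Hex.
have hri : (r.+1 < i)%N || (i.+1 < r)%N by rewrite ltn_neqAle eq_sym ne lt_ri.
have hir : (i.+1 < r)%N || (r.+1 < i)%N by rewrite orbC.
have dri := descent_far hir di dr.
have dir := descent_far hri dr di.
rewrite (IHd _ _ ei si dri) (IHd _ _ er sr dir) (tswap_comm t hi hr hir).
set w := tswap (tswap t r) i; have sw : std w by apply: descent_std.
have E1 : tswap t r = tswap w i by rewrite /w (tswapK hi).
have E2 : tswap t i = tswap w r by rewrite /w -(tswap_comm t hi hr hir) (tswapK hr).
by rewrite E1 E2; apply: nstep_comm.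
Qed.

(** If the swapped tableau has a descent at r, this is the recursion for its vector. Otherwise the
    step undoes the last one, and its square is alpha_r(t) alpha_r(v). *)
Lemma step_transport t r : (0 < r < n)%N -> std t ->
  step r t (g t) = if std (tswap t r) then al r t *: g (tswap t r) else 0.
Proof.
move=> hr st; have W := transport_weight st.
case: ifP => [sv|/negbT nsv]; last exact: (step_eq0 q0 sep hrel hr st nsv W).
have a0 : al r t != 0 by apply: (alpha_neq0 q0 sep halpha).
have [dt|] := boolP (descent t r); last first.
  rewrite -descent_tswap // => dv.
  by rewrite (transport_descent sv dv) (tswapK hr) /nstep scalerA mulfV ?scale1r.
have a1 : al r (tswap t r) != 0.
  by apply: (alpha_neq0 q0 sep halpha); rewrite ?(tswapK hr).
rewrite (transport_descent st dt) /nstep stepZ.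
have := step_sqr q0 sep hrel hr sv (transport_weight sv); rewrite (tswapK hr) => ->.
rewrite -(alpha_norm halpha hr sv) (tswapK hr) scalerA.
by rewrite mulrA mulVf // mul1r.
Qed.

Lemma transport_T t r : (0 < r < n)%N -> std t ->
  g t * T r = (if std (tswap t r) then alpha r t *: g (tswap t r) else 0)
              - [rho t r]^-1 *: g t.
Proof.
move=> hr st; have := step_transport hr st; rewrite /alphaz st => <-.
by rewrite /step addrK.
Qed.

(** Steps act on the right, so the initial factor F_b on the left stays untouched. *)
Lemma Fid_transport b t : initial b -> std t -> tshape b = tshape t -> Fid b * g t = g t.
Proof.
move=> ib st; have [sb _] := andP ib; elim/descent_ind: st => [u iu E|u r su du sv IH E].
  by rewrite -(initial_uniq ib iu E) transport_initial // (Fid_mul q0 sep hrel) ?eqxx.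
rewrite (transport_descent su du) /nstep -scalerAr -step_mull IH //.
by rewrite E (tshape_tswap (descent_range du)).
Qed.

End Transport.

(** * The seminormal basis *)

Section LinearCombinations.
Variables (K : fieldType) (W : lmodType K) (I : finType) (S : pred I) (e : I -> W).

Definition lin_comb (x : W) : Prop := exists c : I -> K, x = \sum_(i | S i) c i *: e i.

Lemma lin_comb_lin (c : K) x y : lin_comb x -> lin_comb y -> lin_comb (c *: x + y).
Proof.
move=> [a ->] [b ->]; exists (fun i => c * a i + b i).
by rewrite scaler_sumr -big_split; apply: eq_bigr => i _; rewrite scalerDl scalerA.
Qed.

Lemma lin_comb0 : lin_comb 0.
Proof. by exists (fun _ => 0); rewrite big1 // => i _; rewrite scale0r. Qed.

Lemma lin_combZ (c : K) x : lin_comb x -> lin_comb (c *: x).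
Proof. by move=> Hx; rewrite -[c *: x]addr0; apply: lin_comb_lin => //; apply: lin_comb0. Qed.

Lemma lin_comb_sum (J : Type) (r : seq J) (P : pred J) (F : J -> W) :
  (forall j, P j -> lin_comb (F j)) -> lin_comb (\sum_(j <- r | P j) F j).
Proof.
move=> H; elim/big_ind: _ => //; first exact: lin_comb0.
by move=> x y Hx Hy; rewrite -[x]scale1r; apply: lin_comb_lin.
Qed.

Lemma lin_comb_gen i : S i -> lin_comb (e i).
Proof.
move=> Si; exists (fun j => if j == i then 1 else 0).
rewrite (bigD1 i) //= eqxx scale1r big1 ?addr0 // => j /andP[_ /negPf->].
by rewrite scale0r.
Qed.

End LinearCombinations.

Section SeminormalBasis.
Variables (K : fieldType) (q : K) (l n : nat) (kappa : 'I_l -> int).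
Variables (A : algType K) (L T : nat -> A) (star : A -> A) (alpha : nat -> tab l n -> K).
Hypotheses (q0 : q != 0) (sep : separates q n kappa).
Hypotheses (hA : is_hecke q n kappa L T) (hstar : is_star n L T star).
Hypothesis halpha : seminormal_coeff q kappa alpha.
Local Notation "[ d ]" := (qint q d) (format "[ d ]").
Local Notation ct := (ct kappa).
Local Notation rho := (rho kappa).
Local Notation al := (alphaz alpha).
Local Notation tweight := (tweight q kappa L).
Local Notation step := (step q kappa T).
Local Notation Fid := (Fid q kappa L).
Local Notation g := (transport q kappa L T alpha).
Implicit Types (s t u v w b : tab l n).

Let hrel : hecke_rel q n kappa L T := proj1 hA.

Lemma starM x y : star (x * y) = star y * star x.
Proof. by case: hstar => _ [H _]. Qed.

Lemma starK x : star (star x) = x.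
Proof. by case: hstar => _ [_ [H _]]. Qed.

Lemma starL k : (0 < k <= n)%N -> star (L k) = L k.
Proof. by case: hstar => _ [_ [_ [H _]]]; apply: H. Qed.

Lemma starT r : (0 < r < n)%N -> star (T r) = T r.
Proof. by case: hstar => _ [_ [_ [_ H]]]; apply: H. Qed.

Lemma star_lin c x y : star (c *: x + y) = c *: star x + star y.
Proof. by case: hstar. Qed.

Lemma star0 : star 0 = 0.
Proof. by have := star_lin (-1) 0 0; rewrite scaler0 addr0 scaleN1r addNr. Qed.

Lemma starZ c x : star (c *: x) = c *: star x.
Proof. by rewrite -[c *: x]addr0 star_lin star0 addr0. Qed.

Lemma FidM t u : std t -> std u -> Fid t * Fid u = if t == u then Fid t else 0.
Proof. exact: (Fid_mul q0 sep hrel). Qed.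

Lemma Fid_idem t : std t -> Fid t * Fid t = Fid t.
Proof. by move=> st; rewrite FidM // eqxx. Qed.

Lemma Fid_neq0 t : std t -> Fid t != 0.
Proof.
move=> st; have [RL [RT [hR nz]]] := seminormal_rep q0 sep halpha st.
have [_ /(_ _ RL RT hR) [f [[fL _] _]]] := hA.
apply: contraNneq nz => F0; have : f (Fid t) = 0 by rewrite F0 rmorph0.
rewrite /Defs.Fid (big_morph f (rmorphM f) (rmorph1 f)) => E.
apply/eqP; rewrite -[RHS]E; apply: eq_big_nat => k hk.
rewrite (big_morph f (rmorphM f) (rmorph1 f)); apply: eq_bigr => c _.
have fA a : f a%:A = a%:A by rewrite linearZ rmorph1.
by rewrite rmorphM rmorphB; congr ((_ - _) * _); apply: esym; [apply: fL|apply: fA|apply: fA].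
Qed.

(** F_t is also a left eigenvector, so [star (Fid t)] is a right one of weight [t] and star(F_t) F_t
    = star(F_t). The left side is fixed by [star]. *)
Lemma star_Fid t : std t -> star (Fid t) = Fid t.
Proof.
move=> st; have W : tweight t (star (Fid t)).
  move=> k hk; rewrite -{1}(starL hk) -starM -starZ; congr star.
  exact: (L_Fid q0 sep hrel).
have E : star (Fid t) * Fid t = star (Fid t) by rewrite (mul_Fid q0 sep st st W) eqxx.
by rewrite -{2}[Fid t]starK -E starM starK E.
Qed.

Lemma weight_Fid t x : std t -> tweight t x -> x * Fid t = x.
Proof. by move=> st W; rewrite (mul_Fid q0 sep st st W) eqxx. Qed.

Lemma transport_Fid t : std t -> g t * Fid t = g t.
Proof. by move=> st; apply: weight_Fid => //; apply: (transport_weight alpha q0 sep hrel). Qed.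

Lemma Fid_star_transport t : std t -> Fid t * star (g t) = star (g t).
Proof. by move=> st; rewrite -{1}(star_Fid st) -starM transport_Fid. Qed.

(* [(T_r + c) F_v = F_t (T_r + c')], as both sides are equal to [F_t T_r F_v]. *)
Lemma star_step_Fid r t v : (0 < r < n)%N -> std t -> v = tswap t r -> std v ->
  star (step r v (Fid v)) = step r t (Fid t).
Proof.
move=> hr st Ev sv; have Et : t = tswap v r by rewrite Ev (tswapK hr).
have ntv : (t == v) = false.
  apply/eqP; rewrite Ev => E; have := swap01_neq hr st.
  by rewrite {1}E tswapL eqxx.
have Wt := Fid_tweight q0 sep hrel st; have Wv := Fid_tweight q0 sep hrel sv.
have W1 : tweight v (step r t (Fid t)).
  by rewrite Ev; apply: (step_weight q0 sep hrel) => //; rewrite -Ev.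
have W2 : tweight t (step r v (Fid v)).
  by rewrite {1}Et; apply: (step_weight q0 sep hrel) => //; rewrite -Et.
have E1 : Fid t * T r * Fid v = step r t (Fid t).
  rewrite -[RHS](weight_Fid sv W1) /step mulrDl -scalerAl FidM // ntv.
  by rewrite scaler0 addr0.
have E2 : Fid v * T r * Fid t = step r v (Fid v).
  rewrite -[RHS](weight_Fid st W2) /step mulrDl -scalerAl FidM // eq_sym ntv.
  by rewrite scaler0 addr0.
by rewrite -E2 -E1 !starM (starT hr) !star_Fid // mulrA.
Qed.

(** Passing from v to t multiplies both products by [step_norm] / alpha_r(v)^2 = alpha_r(t) /
    alpha_r(v), so a single scalar serves both. It becomes gamma_t: one product normalises f_tt, the
    other governs f_st f_tv. *)
Lemma transport_norm t : std t -> exists c : K, [/\ c != 0,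
  star (g t) * g t = c *: Fid t &
  forall b, initial b -> tshape b = tshape t -> g t * star (g t) = c *: Fid b].
Proof.
elim/descent_ind => [{}t it|{}t r st dt sv [c [c0 E1 E2]]].
  have [st _] := andP it; exists 1; rewrite oner_eq0 scale1r transport_initial // star_Fid //.
  by split=> // [|b ib Eb]; rewrite ?(initial_uniq ib it Eb) ?scale1r Fid_idem.
have hr := descent_range dt; set v := tswap t r in sv c0 E1 E2.
have Et : t = tswap v r by rewrite /v (tswapK hr).
have a0 : al r v != 0 by apply: (alpha_neq0 q0 sep halpha) => //; rewrite -Et.
have b0 : al r t != 0 by apply: (alpha_neq0 q0 sep halpha).
have Eg : al r v *: g t = step r v (g v).
  by rewrite (transport_descent q0 sep hrel halpha st dt) /nstep scalerA mulfV ?scale1r.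
have Wv := Fid_tweight q0 sep hrel sv; have Wt := Fid_tweight q0 sep hrel st.
have Es : g t = (al r v)^-1 *: (g v * step r v (Fid v)).
  by rewrite -step_mull (transport_Fid sv) -Eg scalerA mulVf ?scale1r.
have Ess : star (g t) = (al r v)^-1 *: (step r t (Fid t) * star (g v)).
  by rewrite Es starZ starM (star_step_Fid hr st).
have N1 : step r t (Fid t) * step r v (Fid v) = step_norm q (rho t r) *: Fid t.
  have W1 : tweight v (step r t (Fid t)) by apply: (step_weight q0 sep hrel).
  by rewrite -(step_sqr q0 sep hrel hr st Wt) -{2}(weight_Fid sv W1) step_mull.
have N2 : step r v (Fid v) * step r t (Fid t) = step_norm q (rho t r) *: Fid v.
  have W1 : tweight t (step r v (Fid v)).
    by rewrite {1}Et; apply: (step_weight q0 sep hrel) => //; rewrite -Et.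
  have := step_sqr q0 sep hrel hr sv Wv; rewrite -Et.
  rewrite -{1}(weight_Fid st W1) step_mull => ->; congr (_ *: _).
  by rewrite -!(alpha_norm halpha hr) // -/v -Et mulrC.
have Na : step_norm q (rho t r) = al r t * al r v by rewrite -(alpha_norm halpha hr st).
exists (al r t / al r v * c); split.
- by rewrite !mulf_neq0 ?invr_neq0.
- rewrite Ess Es -scalerAl -scalerAr !mulrA -[step r t _ * _ * _]mulrA E1.
  rewrite -!scalerAr -!scalerAl -[step r t _ * Fid v]/(_ * _).
  rewrite (weight_Fid sv) ?N1 ?Na; last by apply: (step_weight q0 sep hrel).
  by rewrite !scalerA; congr (_ *: _); field.
move=> b ib Eb; rewrite Ess Es -scalerAl -scalerAr !mulrA -[g v * _ * _]mulrA N2.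
rewrite -!scalerAr -!scalerAl (transport_Fid sv) (E2 b ib) ?Na.
  by rewrite !scalerA; congr (_ *: _); field.
by rewrite Eb /v (tshape_tswap hr).
Qed.

Lemma gamma_exists : exists gamma : tab l n -> K, forall t, std t -> [/\ gamma t != 0,
  star (g t) * g t = gamma t *: Fid t &
  forall b, initial b -> tshape b = tshape t -> g t * star (g t) = gamma t *: Fid b].
Proof.
apply: (fin_all_exists (P := fun t c => std t -> [/\ c != 0,
  star (g t) * g t = c *: Fid t &
  forall b, initial b -> tshape b = tshape t -> g t * star (g t) = c *: Fid b])) => t.
have [st|nst] := boolP (std t); last by exists 0.
by have [c Hc] := transport_norm st; exists c.
Qed.

Definition same_shape t v : bool := std v && (tshape t == tshape v).

Lemma transport_span t a : std t -> lin_comb (same_shape t) g (g t * a).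
Proof.
move: t; pose P a := forall t, std t -> lin_comb (same_shape t) g (g t * a).
move: a; apply: (hecke_generated (P := P) hA) => [t st|c x y Hx Hy t st|x y Hx Hy t st|k hk t st|r hr t st].
- by rewrite mulr1; apply: lin_comb_gen; rewrite /same_shape st eqxx.
- by rewrite mulrDr -scalerAr; apply: lin_comb_lin; [apply: Hx|apply: Hy].
- rewrite mulrA; have [c ->] := Hx t st; rewrite mulr_suml; apply: lin_comb_sum => v.
  case/andP => sv /eqP E; rewrite -scalerAl; apply: lin_combZ.
  by have := Hy v sv; rewrite /same_shape E.
- rewrite (transport_weight alpha q0 sep hrel st hk); apply/lin_combZ/lin_comb_gen.
  by rewrite /same_shape st eqxx.
rewrite (transport_T q0 sep hrel halpha hr st) addrC -scaleNr.
apply: lin_comb_lin; first by apply: lin_comb_gen; rewrite /same_shape st eqxx.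
case: ifP => [sv|_]; last exact: lin_comb0.
by apply/lin_combZ/lin_comb_gen; rewrite /same_shape sv (tshape_tswap hr) eqxx.
Qed.

Definition fbasis s t : A := star (g s) * g t.
Local Notation f := fbasis.

Section WithGamma.
Variable gamma : tab l n -> K.
Hypothesis hgamma : forall t, std t -> [/\ gamma t != 0,
  star (g t) * g t = gamma t *: Fid t &
  forall b, initial b -> tshape b = tshape t -> g t * star (g t) = gamma t *: Fid b].

Lemma Std2P s t : reflect [/\ std s, std t & tshape s = tshape t] ((s, t) \in Std2 l n).
Proof. by rewrite inE; apply: (iffP and3P) => -[a b /eqP]. Qed.

Lemma Fid_f s t u : std s -> std u -> Fid u * f s t = if u == s then f s t else 0.
Proof.
move=> ss su; rewrite /f -(Fid_star_transport ss) mulrA mulrA FidM //.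
by case: eqP => [->|_]; rewrite ?mul0r.
Qed.

Lemma f_Fid s t v : std t -> std v -> f s t * Fid v = if t == v then f s t else 0.
Proof.
move=> st sv; rewrite /f -{1}(transport_Fid st) -!mulrA FidM //.
by case: eqP => _; rewrite ?mulr0 ?transport_Fid.
Qed.

Lemma f_mul s t u v : (s, t) \in Std2 l n -> (u, v) \in Std2 l n ->
  f s t * f u v = if t == u then gamma t *: f s v else 0.
Proof.
move=> /Std2P[ss st E1] /Std2P[su sv E2].
have [Etu|ntu] := eqVneq t u.
  have [b ib Eb] := initial_exists st; have [_ _ H] := hgamma st.
  have Ebv : tshape b = tshape v by rewrite Eb Etu E2.
  rewrite -Etu /f -mulrA [g t * _]mulrA (H b ib Eb) -scalerAl -scalerAr.
  by rewrite (Fid_transport q0 sep hrel halpha ib sv Ebv).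
rewrite /f -mulrA [g t * _]mulrA -{1}(transport_Fid st) -(Fid_star_transport su).
by rewrite -!mulrA [Fid t * _]mulrA FidM // (negPf ntu) mul0r !mulr0.
Qed.

Lemma Fid_f_diag t : std t -> Fid t = (gamma t)^-1 *: f t t.
Proof.
by move=> st; have [c0 E _] := hgamma st; rewrite /f E scalerA mulVf ?scale1r.
Qed.

(** Since f_st f_ts = gamma_t f_ss = gamma_t gamma_s F_s. *)
Lemma f_neq0 s t : (s, t) \in Std2 l n -> f s t != 0.
Proof.
move=> hst; have [ss st E] := elimT (Std2P _ _) hst; have [s0 Es _] := hgamma ss.
have hts : (t, s) \in Std2 l n by apply/Std2P.
have [t0 _ _] := hgamma st.
apply/eqP => f0; have := f_mul hst hts; rewrite f0 mul0r eqxx => /esym/eqP.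
rewrite /f Es scalerA scaler_eq0 mulf_eq0 (negPf s0) (negPf t0) /=.
by apply/negP/Fid_neq0.
Qed.

Lemma star_f s t : star (f s t) = f t s.
Proof. by rewrite /f starM starK. Qed.

Lemma f_L s t k : std t -> (0 < k <= n)%N -> f s t * L k = [ct t k] *: f s t.
Proof.
by move=> st hk; apply: (tweight_mull _ (transport_weight alpha q0 sep hrel st) hk).
Qed.

Lemma L_f s t k : std s -> (0 < k <= n)%N -> L k * f s t = [ct s k] *: f s t.
Proof.
move=> ss hk; rewrite -[f s t]star_f -{1}(starL hk) -starM f_L // starZ //.
Qed.

Lemma f_T s t r : std t -> (0 < r < n)%N ->
  f s t * T r = (if std (tswap t r) then alpha r t *: f s (tswap t r) else 0)
                - [rho t r]^-1 *: f s t.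
Proof.
move=> st hr; rewrite /f -mulrA (transport_T q0 sep hrel halpha hr st) mulrBr -scalerAr.
by case: ifP => _; rewrite ?mulr0 // -scalerAr.
Qed.

Lemma Fid_span s a : std s -> lin_comb (same_shape s) (f s) (Fid s * a).
Proof.
move=> ss; rewrite Fid_f_diag // -scalerAl /f -mulrA; apply: lin_combZ.
have [c ->] := transport_span a ss; exists c; rewrite mulr_sumr.
by apply: eq_bigr => v _; rewrite scalerAr.
Qed.

Lemma f_basis : is_basis (Std2 l n) (fun p => f p.1 p.2).
Proof.
split=> [c E [s t] hst|a].
  have [ss st _] := elimT (Std2P _ _) hst.
  (* Cutting with F_s and F_t isolates the coefficient of f_st. *)
  have := congr1 (fun x => Fid s * x * Fid t) E; rewrite mulr0 mul0r.
  rewrite mulr_sumr mulr_suml (bigD1 (s, t)) //= big1 ?addr0 => [|[u v] /andP[huv ne]].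
    rewrite -scalerAr -scalerAl Fid_f // eqxx f_Fid // eqxx => /eqP.
    by rewrite scaler_eq0 (negPf (f_neq0 hst)) orbF => /eqP.
  have [su sv _] := elimT (Std2P _ _) huv; rewrite /= -scalerAr -scalerAl Fid_f //.
  case: eqP => [Esu|_]; last by rewrite mul0r scaler0.
  rewrite f_Fid //; case: eqP => [Evt|_]; last by rewrite scaler0.
  by rewrite Esu Evt eqxx in ne.
suff [c ->] : lin_comb (mem (Std2 l n)) (fun p => f p.1 p.2) a by exists c.
rewrite -[a]mul1r -(sum_Fid q0 sep hrel) mulr_suml; apply: lin_comb_sum => s.
rewrite inE => ss; have [c ->] := Fid_span a ss; apply: lin_comb_sum => v /andP[sv /eqP E].
apply: lin_combZ; apply: (lin_comb_gen (fun p => f p.1 p.2) (i := (s, v))).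
by apply/Std2P.
Qed.

Lemma f_seminormal : seminormal_basis q kappa L T star alpha f gamma.
Proof.
split; first exact: f_basis.
split.
  move=> s t /Std2P[ss st E]; split.
  - by move=> r hr; split; [apply: L_f|apply: f_L].
  - exact: star_f.
  - by move=> k hk; apply: f_L.
  - by move=> r hr; apply: f_T.
split; first by move=> t st; case: (hgamma st).
split.
  move=> s t u v /Std2P[ss st _] su sv; rewrite Fid_f //.
  by case: eqP => _ /=; rewrite ?mul0r // f_Fid.
split; first by move=> s t u v; apply: f_mul.
exact: Fid_f_diag.
Qed.

(** * Corners, primitive idempotents and irreducible modules *)

Lemma corner s u a : std s -> std u -> exists c : K, Fid s * a * Fid u = c *: f s u.
Proof.
move=> ss su; have [c ->] := Fid_span a ss.
case: (boolP (same_shape s u)) => [hu|hu].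
  exists (c u); rewrite mulr_suml (bigD1 u) //= big1 ?addr0 => [|v /andP[/andP[sv _] nvu]].
    by rewrite -scalerAl f_Fid // eqxx.
  by rewrite -scalerAl f_Fid // (negPf nvu) scaler0.
exists 0; rewrite scale0r mulr_suml big1 // => v hv; rewrite -scalerAl f_Fid //; last by case/andP: hv.
by case: eqP => [E|_]; rewrite ?scaler0 //; rewrite -E hv in hu.
Qed.

Lemma corner0 s u a : std s -> std u -> tshape s != tshape u -> Fid s * a * Fid u = 0.
Proof.
move=> ss su E; have [c ->] := Fid_span a ss.
rewrite mulr_suml big1 // => v /andP[sv /eqP E']; rewrite -scalerAl f_Fid //.
by case: eqP => [Evu|_]; rewrite ?scaler0 //; rewrite E' Evu eqxx in E.
Qed.

Lemma corner_scalar s a : std s -> exists c : K, Fid s * a * Fid s = c *: Fid s.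
Proof.
move=> ss; have [c ->] := corner a ss ss; have [c0 E _] := hgamma ss.
by exists (c * gamma s); rewrite /f E scalerA.
Qed.

(** The corner F_s A F_s is K F_s, so a summand e1 is c F_s with c idempotent in a field. *)
Lemma Fid_primitive s : std s -> primitive_idem (Fid s).
Proof.
move=> ss; split; [exact: Fid_idem|split; first exact: Fid_neq0].
move=> e1 e2 I1 I2 E12 E21 E.
have [c Ec] := corner_scalar e1 ss.
have Ee : e1 = c *: Fid s.
  by rewrite -Ec E mulrDl I1 E21 addr0 mulrDr I1 E12 addr0.
have : (c * c - c) *: Fid s = 0.
  apply/eqP; rewrite scalerBl subr_eq0; apply/eqP.
  by rewrite -[RHS]Ee -I1 Ee -scalerAl -scalerAr Fid_idem // scalerA.
move/eqP; rewrite scaler_eq0 (negPf (Fid_neq0 ss)) orbF.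
rewrite -{3}[c]mulr1 -mulrBr mulf_eq0 subr_eq0 => /orP[]/eqP c1.
  by left; rewrite Ee c1 scale0r.
right; apply: (addrI e1); rewrite -E addr0 Ee c1 scale1r //.
Qed.

(** Irreducibility of F_s A: if f_sv occurs in the element, right multiplication by f_vs kills all
    other basis vectors f_su and returns a non-zero multiple of F_s. *)
Lemma Fid_reach s a : std s -> Fid s * a <> 0 -> exists b : A, Fid s * a * b = Fid s.
Proof.
move=> ss nz; have [c E] := Fid_span a ss.
have [v /andP[/andP[sv /eqP Esv] cv]] : exists v, same_shape s v && (c v != 0).
  apply/existsP; apply: contraT; rewrite negb_exists => /forallP H; case: nz.
  rewrite E big1 // => v hv; have := H v; rewrite hv /= negbK => /eqP->.
  by rewrite scale0r.
have hsv : (s, v) \in Std2 l n by apply/Std2P.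
have hvs : (v, s) \in Std2 l n by apply/Std2P.
have [s0 Es _] := hgamma ss; have [v0 _ _] := hgamma sv.
exists ((c v * gamma v * gamma s)^-1 *: f v s).
rewrite E mulr_suml (bigD1 v) /=; last by rewrite /same_shape sv Esv eqxx.
rewrite big1 ?addr0 => [|u /andP[/andP[su /eqP Esu] nuv]]; last first.
  have hsu : (s, u) \in Std2 l n by apply/Std2P.
  by rewrite -scalerAl -scalerAr f_mul // (negPf nuv) !scaler0.
rewrite -scalerAl -scalerAr f_mul // eqxx /f Es !scalerA.
rewrite (_ : _ * _ = 1) ?scale1r //; field.
by rewrite cv v0 s0.
Qed.

Lemma ideal_iso_shape s u : std s -> std u ->
  ideal_iso (Fid s) (Fid u) <-> tshape s = tshape u.
Proof.
move=> ss su; split=> [[phi [_ [phiM [phi_inj phi_im]]]]|E].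
  (* The image of F_s has the form F_u h F_s, which is 0 when the shapes differ; injectivity then
     forces F_s = 0. *)
  apply/eqP; apply: contraT => nE; have /eqP[] := Fid_neq0 ss.
  have E1 x : phi (Fid s * x) = phi (Fid s * 1) * x by rewrite -phiM mulr1.
  rewrite -[LHS]mulr1 -[RHS](mulr0 (Fid s)); apply: phi_inj.
  have [_ /(_ (ex_intro _ 1 erefl)) [h Eh]] := phi_im (phi (Fid s * 1)).
  rewrite [RHS]E1 mulr0.
  have -> : Fid s * 1 = Fid s * Fid s by rewrite mulr1 Fid_idem.
  by rewrite E1 Eh corner0 // eq_sym.
have hsu : (s, u) \in Std2 l n by apply/Std2P.
have hus : (u, s) \in Std2 l n by apply/Std2P.
have [s0 Es _] := hgamma ss; have [u0 Eu _] := hgamma su.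
have Efs : f u s * Fid s = f u s by rewrite f_Fid // eqxx.
have Efu : Fid u * f u s = f u s by rewrite Fid_f // eqxx.
have g0 : gamma u * gamma s != 0 by rewrite mulf_neq0.
have Esus z : f s u * (f u s * (Fid s * z)) = (gamma u * gamma s) *: (Fid s * z).
  by rewrite (mulrA (f s u)) f_mul // eqxx /f Es scalerA -scalerAl mulrA Fid_idem.
have Eusu z : f u s * (f s u * z) = (gamma u * gamma s) *: (Fid u * z).
  by rewrite (mulrA (f u s)) f_mul // eqxx /f Eu scalerA -scalerAl mulrC.
(* Left multiplication by f_us, with inverse that by f_su up to gamma_u gamma_s. *)
exists (fun x => f u s * x); split; first by move=> x y; rewrite mulrDr.
split; first by move=> x a; rewrite (mulrA (f u s)).
split=> [x y /(congr1 (fun z => f s u * z)) /=|y]; first by rewrite !Esus => /(scalerI g0).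
split=> [[h ->]|[x ->]]; last by exists (f u s * (Fid s * x)); rewrite (mulrA (Fid u)) Efu.
exists ((gamma u * gamma s)^-1 *: (f s u * h)).
by rewrite (mulrA (f u s)) Efs -scalerAr Eusu scalerA mulVf ?scale1r.
Qed.

Lemma irreducible_iso (M : lmodType A^c) : irreducible_rmod M ->
  exists s, std s /\ rmod_iso_ideal M (Fid s).
Proof.
move=> [[m m0] simple].
have [s /andP[ss ms]] : exists s, std s && ((Fid s : A^c) *: m != 0).
  apply/existsP; apply: contraT; rewrite negb_exists => /forallP H.
  case/eqP: m0; rewrite -[m]scale1r -[1 : A^c](sum_Fid q0 sep hrel) scaler_suml.
  rewrite big1 // => t; rewrite inE => st.
  by have := H t; rewrite st negbK => /eqP.
exists s; split=> //; set m1 := (Fid s : A^c) *: m in ms.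
have act (a h : A) : (a : A^c) *: ((h : A^c) *: m) = (h * a : A^c) *: m by rewrite scalerA.
have actF (h : A) : (h : A^c) *: m1 = (Fid s * h : A^c) *: m by rewrite act.
have surj x : exists h : A, x = (h : A^c) *: m1.
  have [] := simple (fun x => exists h : A, x = (h : A^c) *: m1).
  - by exists 0; rewrite scale0r.
  - by move=> y z [h ->] [k ->]; exists (h + k); rewrite scalerDl.
  - by move=> y a [h ->]; exists (h * a : A); rewrite scalerA.
  - by move=> H; case/eqP: ms; apply: H; exists 1; rewrite scale1r.
  by apply.
have inj (h k : A) : (h : A^c) *: m1 = (k : A^c) *: m1 -> Fid s * h = Fid s * k.
  (* Otherwise some [b] leads F_s (h - k) back to F_s, and [m1] would be 0. *)
  move=> E; apply/eqP; rewrite -subr_eq0 -mulrBr; apply: contraT => nz.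
  have [b Eb] := Fid_reach ss (elimN eqP nz).
  case/eqP: ms; rewrite /m1 -Eb -act -actF scalerBl E subrr scaler0 //.
(* The preimage is an arbitrary choice; after left multiplication by F_s it no longer depends on it,
   by [inj]. *)
pose pre x : A := proj1_sig (constructive_indefinite_description _ (surj x)).
have preE x : x = (pre x : A^c) *: m1.
  exact: proj2_sig (constructive_indefinite_description _ (surj x)).
have phiE x (h : A) : x = (h : A^c) *: m1 -> Fid s * pre x = Fid s * h.
  by move=> E; apply: inj; rewrite -preE.
exists (fun x => Fid s * pre x); split=> [x y|].
  by rewrite -mulrDr; apply: phiE; rewrite scalerDl -!preE.
split=> [x a|].
  by rewrite -mulrA; apply: phiE; rewrite {1}(preE x) scalerA.
split=> [x y E|y].
  by rewrite (preE x) (preE y) !actF E.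
split=> [[h ->]|[x ->]]; last by exists (pre x).
by exists ((h : A^c) *: m1); apply/esym/phiE.
Qed.

End WithGamma.

(** The vector f_bb at b = t^lambda is gamma_b F_b, hence determined. Along ascending swaps alpha_r
    is non-zero, so the action of T_r determines the whole row from its entry at b, and [star]
    exchanges rows with columns. *)
Lemma seminormal_basis_uniq f' gamma' f'' gamma'' :
  seminormal_basis q kappa L T star alpha f' gamma' ->
  seminormal_basis q kappa L T star alpha f'' gamma'' ->
  (forall t, initial t -> gamma' t = gamma'' t) ->
  forall s t, (s, t) \in Std2 l n -> f' s t = f'' s t.
Proof.
move=> [_ [B1 [N1 [_ [_ D1]]]]] [_ [B2 [N2 [_ [_ D2]]]]] Eg.
have Ediag b : initial b -> f' b b = f'' b b.
  move=> ib; have [sb _] := andP ib; have := D1 b sb; rewrite (D2 b sb) (Eg b ib).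
  move=> E; apply/esym; move: E; apply: scalerI.
  by rewrite invr_neq0 // N2.
have Erow s b : initial b -> (s, b) \in Std2 l n -> f' s b = f'' s b ->
    forall t, (s, t) \in Std2 l n -> f' s t = f'' s t.
  move=> ib /Std2P[ss sb Eb] Esb t /Std2P[_ st].
  elim/descent_ind: st => [u iu Eu|u r su du sv IH Eu].
    by rewrite -(initial_uniq ib iu) // -Eb.
  have hr := descent_range du; have Ev : tshape s = tshape (tswap u r).
    by rewrite (tshape_tswap hr).
  have hsv : (s, tswap u r) \in Std2 l n by apply/Std2P.
  have [_ _ _ /(_ r hr) E1] := B1 _ _ hsv; have [_ _ _ /(_ r hr) E2] := B2 _ _ hsv.
  rewrite (tswapK hr) su in E1 E2; rewrite IH // E2 in E1.
  have a0 : alpha r (tswap u r) != 0.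
    have := alpha_neq0 q0 sep halpha hr sv; rewrite (tswapK hr) /alphaz sv; exact.
  by apply: (scalerI a0); apply: (addIr (- ([rho (tswap u r) r]^-1 *: f'' s (tswap u r)))).
move=> s t hst; have [ss st E] := elimT (Std2P _ _) hst.
have [b ib Eb] := initial_exists ss; have [sb _] := andP ib.
have hbb : (b, b) \in Std2 l n by apply/Std2P.
have hbs : (b, s) \in Std2 l n by apply/Std2P.
have hsb : (s, b) \in Std2 l n by apply/Std2P.
(* Row s starts at f_sb = star(f_bs), and f_bs lies in row b, which starts on the diagonal. *)
apply: (Erow s b ib hsb) => //.
have [_ S1 _ _] := B1 _ _ hbs; have [_ S2 _ _] := B2 _ _ hbs.
by rewrite -S1 -S2 (Erow b b ib hbb (Ediag b ib)).
Qed.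

End SeminormalBasis.

Theorem theorem3p9 (K : fieldType) (q : K) (l n : nat) (kappa : 'I_l -> int)
    (A : algType K) (L T : nat -> A) (star : A -> A)
    (alpha : nat -> tab l n -> K) :
  q != 0 -> (0 < l)%N -> kappa_gap n kappa -> separates q n kappa ->
  is_hecke q n kappa L T -> is_star n L T star ->
  seminormal_coeff q kappa alpha ->
  (exists (f : tab l n -> tab l n -> A) (gamma : tab l n -> K),
      seminormal_basis q kappa L T star alpha f gamma) /\
  complete_orth_prim [set t : tab l n | std t] (Fid q kappa L) /\
  (forall M : lmodType A^c, irreducible_rmod M ->
     exists s : tab l n, std s /\ rmod_iso_ideal M (Fid q kappa L s)) /\
  (forall s u : tab l n, std s -> std u ->
     (ideal_iso (Fid q kappa L s) (Fid q kappa L u) <-> tshape s = tshape u)) /\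
  (forall f gamma f' gamma',
     seminormal_basis q kappa L T star alpha f gamma ->
     seminormal_basis q kappa L T star alpha f' gamma' ->
     (forall t, initial t -> gamma t = gamma' t) ->
     forall s t, (s, t) \in Std2 l n -> f s t = f' s t).
Proof.
move=> q0 _ _ sep hA hstar halpha; have hrel := proj1 hA.
have [gamma hg] := gamma_exists q0 sep hA hstar halpha.
split.
  exists (fbasis q kappa L T star alpha), gamma.
  exact: (f_seminormal q0 sep hA hstar halpha hg).
split; [split; [|split]|split; [|split]].
- exact: (sum_Fid q0 sep hrel).
- move=> s t; rewrite !inE => ss st nst.
  by rewrite (Fid_mul q0 sep hrel ss st) (negPf nst).
- by move=> s; rewrite inE; apply: (Fid_primitive q0 sep hA halpha hg).
- exact: (irreducible_iso q0 sep hA hstar halpha hg).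
- exact: (ideal_iso_shape q0 sep hA hstar halpha hg).
exact: (seminormal_basis_uniq q0 sep halpha).
Qed.
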